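(* Let $(\boldsymbol\sigma,u)$ be the solution of the mixed problem (M), and let $(\boldsymbol\sigma_h,u_h)$ be the solution of the discrete mixed problem (M$_h$) in $\Sigma\times D$, where either $\Sigma\times D=RT_k\times D_k$ with $k\ge0$ or $\Sigma\times D=BDM_k\times D_{k-1}$ with $k\ge1$. For $K\in\mathcal T$ let $u_{h,K}^*\in P_{k+1}(K)$ be Stenberg's post-processed potential, defined by $$(\alpha\nabla u_{h,K}^*,\nabla v_h)_K=(f,v_h)_K-(\boldsymbol\sigma_h\cdot\mathbf n,v_h)_{\partial K}\quad\forall v_h\in P_{k+1}(K)/\mathbb R,\qquad \int_Ku_{h,K}^*\,dx=\int_Ku_h\,dx.$$ Then there is a constant $C>0$, independent of $\alpha$ and of the mesh size, such that for each $K\in\mathcal T$ $$\|\alpha_K^{1/2}\nabla(u-u_{h,K}^* )\|_{0,K}\le C\Big(\inf_{w_h\in P_{k+1}(K)}\|\alpha_K^{1/2}\nabla(u-w_h)\|_{0,K}+\|\boldsymbol\sigma-\boldsymbol\sigma_h\|_{\alpha,h,H(\mathrm{div}),K}\Big).$$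
   Context: $\Omega\subset\mathbb R^d$ ($d=2$ or $3$) is a bounded polygonal (polyhedral) domain partitioned into open polygonal subdomains $\Omega_1,\dots,\Omega_n$; $\alpha$ is piecewise constant with $\alpha=\alpha_i>0$ on $\Omega_i$; $f\in L^2(\Omega)$. The problem is $-\nabla\cdot(\alpha\nabla u)=f$ in $\Omega$, $u=0$ on $\partial\Omega$, with flux $\boldsymbol\sigma=-\alpha\nabla u$. (M): find $(\boldsymbol\sigma,u)\in H(\mathrm{div};\Omega)\times L^2(\Omega)$ with $(\alpha^{-1}\boldsymbol\sigma,\boldsymbol\tau)-(\nabla\cdot\boldsymbol\tau,u)=0$ for all $\boldsymbol\tau\in H(\mathrm{div};\Omega)$ and $(\nabla\cdot\boldsymbol\sigma,v)=(f,v)$ for all $v\in L^2(\Omega)$. $(\cdot,\cdot)$, $(\cdot,\cdot)_K$, $(\cdot,\cdot)_{\partial K}$ are $L^2$ inner products on $\Omega$, $K$, $\partial K$; $\|\cdot\|_{0,K}$ is the $L^2(K)$ norm; $\mathbf n$ is the unit outward normal on $\partial K$. $\mathcal T$ is a regular (conforming, shape-regular) simplicial triangulation of $\Omega$ such that the interfaces $\partial\Omega_i\cap\partial\Omega_j$ do not cut through any element; $\alpha_K$ is the constant value of $\alpha$ on $K$ and $h_K$ the diameter of $K$. $P_k(K)$: polynomials on $K$ of total degree $\le k$; $P_{k+1}(K)/\mathbb R$ is the space of polynomials in $P_{k+1}(K)$ with zero mean over $K$. $D_k=\{v\in L^2(\Omega):v|_K\in P_k(K)\ \forall K\in\mathcal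 T\}$; $RT_k=\{\boldsymbol\tau\in H(\mathrm{div};\Omega):\boldsymbol\tau|_K\in P_k(K)^d+\mathbf xP_k(K)\ \forall K\in\mathcal T\}$; $BDM_k=\{\boldsymbol\tau\in H(\mathrm{div};\Omega):\boldsymbol\tau|_K\in P_k(K)^d\ \forall K\in\mathcal T\}$. (M$_h$): find $(\boldsymbol\sigma_h,u_h)\in\Sigma\times D$ with $(\alpha^{-1}\boldsymbol\sigma_h,\boldsymbol\tau_h)-(\nabla\cdot\boldsymbol\tau_h,u_h)=0$ for all $\boldsymbol\tau_h\in\Sigma$ and $(\nabla\cdot\boldsymbol\sigma_h,v_h)=(f,v_h)$ for all $v_h\in D$. Local norm: $\|\boldsymbol\tau\|_{\alpha,h,H(\mathrm{div}),K}=\big(\|\alpha^{-1/2}\boldsymbol\tau\|_{0,K}^2+h_K^2\|\alpha^{-1/2}\nabla\cdot\boldsymbol\tau\|_{0,K}^2\big)^{1/2}$. The constant $C$ may depend on $d$, $k$ and the shape-regularity of $\mathcal T$. *)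

(* Defs.v *)
From HB Require Import structures.
From mathcomp Require Import all_boot all_order all_algebra.
From mathcomp Require Import all_classical all_reals all_analysis.
Set Implicit Arguments.
Unset Strict Implicit.
Unset Printing Implicit Defensive.
Import Order.TTheory GRing.Theory Num.Theory.
Import numFieldNormedType.Exports.
Local Open Scope classical_set_scope.
Local Open Scope ring_scope.

(* The sigma-algebra on R^d generated by the coordinates. *)
Definition rV_display : measure_display. Proof. exact. Qed.

Section measurable_rV.
Context {R : realType} (d : nat).

Let coords (i : 'I_d) (x : 'rV[R]_d) : measurableTypeR R := x ord0 i.

Let rV_set0 : g_sigma_preimage coords set0.
Proof. exact: sigma_algebra0. Qed.

Let rV_setC A : g_sigma_preimage coords A -> g_sigma_preimage coords (~` A).
Proof. exact: sigma_algebraC. Qed.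

Let rV_bigcup (F : _^nat) : (forall i, g_sigma_preimage coords (F i)) ->
  g_sigma_preimage coords (\bigcup_i (F i)).
Proof. exact: sigma_algebra_bigcup. Qed.

HB.instance Definition _ := @isMeasurable.Build rV_display
  'rV[R]_d (g_sigma_preimage coords) rV_set0 rV_setC rV_bigcup.

End measurable_rV.

Section lebesgue_rV.
Context {R : realType}.

Lemma measurable_coord d (i : 'I_d) :
  measurable_fun [set: 'rV[R]_d] (fun x : 'rV[R]_d => x ord0 i).
Proof.
move=> _ Y mY; rewrite setTI; apply: sub_sigma_algebra => /=.
rewrite -bigcup_seq/=; exists i => /=; first by rewrite mem_index_enum.
by exists Y => //; rewrite setTI.
Qed.

Lemma measurable_fun_rV d' (T : measurableType d') d (f : T -> 'rV[R]_d) :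
  (forall i, measurable_fun [set: T] (fun t => f t ord0 i)) ->
  measurable_fun [set: T] f.
Proof.
move=> mf.
have : g_sigma_preimage (fun (i : 'I_d) t => f t ord0 i : measurableTypeR R)
    `<=` measurable.
  apply: smallest_sub; first exact: sigma_algebra_measurable.
  case: d f mf => [|d] f mf; first by rewrite big_ord0.
  rewrite -bigcup_mkord_ord; apply: bigcup_sub => i Ii.
  by move=> A [B mB <-]; exact: mf.
have -> : g_sigma_preimage (fun (i : 'I_d) t => f t ord0 i : measurableTypeR R)
  = preimage_set_system [set: T] f
      (g_sigma_preimage (fun (i : 'I_d) (x : 'rV[R]_d) =>
         x ord0 i : measurableTypeR R)).
  exact: (g_sigma_preimage_comp (fun (i : 'I_d) (x : 'rV[R]_d) =>
         x ord0 i : measurableTypeR R) f).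
by move=> prefS _ A mA; apply: prefS; exists A.
Qed.


(* (a, v) in R x R^d is sent to the vector of R^(d+1) with first coordinate a
   and remaining coordinates v. *)
Definition row_cons d (p : measurableTypeR R * 'rV[R]_d) : 'rV[R]_d.+1 :=
  \row_i (if unlift ord0 i is Some j then p.2 ord0 j else p.1).

Lemma measurable_row_cons d : measurable_fun [set: _] (@row_cons d).
Proof.
apply: measurable_fun_rV => i.
case: (unliftP ord0 i) => [j|] ->.
  rewrite (_ : (fun _ => _) = (fun x : 'rV[R]_d => x ord0 j) \o snd).
    by apply: measurableT_comp => //; exact: measurable_coord.
  by apply/funext => p /=; rewrite mxE liftK.
rewrite (_ : (fun _ => _) = fst); first exact: measurable_fst.
by apply/funext => p /=; rewrite mxE unlift_none.
Qed.

Section step.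
Context (d : nat) (mu : {sigma_finite_measure set 'rV[R]_d -> \bar R}).
Local Open Scope ereal_scope.

Definition lebesgue_rV_step : set 'rV[R]_d.+1 -> \bar R :=
  pushforward (@lebesgue_measure R \x mu) (@row_cons d).

Let mpre (A : set 'rV[R]_d.+1) : measurable A ->
  measurable (@row_cons d @^-1` A).
Proof.
by move=> mA; rewrite -[X in measurable X]setTI; exact: measurable_row_cons.
Qed.

Let step0 : lebesgue_rV_step set0 = 0.
Proof. by rewrite /lebesgue_rV_step /pushforward preimage_set0 measure0. Qed.

Let step_ge0 A : 0 <= lebesgue_rV_step A.
Proof. by rewrite /lebesgue_rV_step /pushforward; exact: measure_ge0. Qed.

Let step_sigma_additive : semi_sigma_additive lebesgue_rV_step.
Proof.
move=> F mF tF mUF; rewrite /lebesgue_rV_step /pushforward preimage_bigcup.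
apply: measure_semi_sigma_additive.
- by move=> n; exact: mpre.
- apply/trivIsetP => /= i j _ _ ij; rewrite -preimage_setI.
  by move/trivIsetP : tF => /(_ _ _ _ _ ij) ->//; rewrite preimage_set0.
- by rewrite -preimage_bigcup; exact: mpre.
Qed.

HB.instance Definition _ := isMeasure.Build _ _ _
  lebesgue_rV_step step0 step_ge0 step_sigma_additive.

Let step_sigma_finite : sigma_finite setT lebesgue_rV_step.
Proof.
have /sigma_finiteP[F [TF ndF Foo]] := sigma_finiteT (@lebesgue_measure R).
have /sigma_finiteP[G [TG ndG Goo]] := sigma_finiteT mu.
exists (fun n => (fun x : 'rV[R]_d.+1 => x ord0 ord0) @^-1` F n `&`
  (fun x : 'rV[R]_d.+1 => \row_j x ord0 (lift ord0 j)) @^-1` G n).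
  apply/seteqP; split => // x _.
  have [i _ Fi] : (\bigcup_i F i) (x ord0 ord0) by rewrite -TF.
  have [j _ Gj] : (\bigcup_i G i) (\row_j x ord0 (lift ord0 j)) by rewrite -TG.
  exists (maxn i j) => //; split => /=.
    by move: Fi; exact/subsetPset/ndF/leq_maxl.
  by move: Gj; exact/subsetPset/ndG/leq_maxr.
move=> n; have [mFn Fn] := Foo n; have [mGn Gn] := Goo n; split.
  apply: measurableI; rewrite -[X in measurable X]setTI.
    exact: measurable_coord.
  apply: measurable_fun_rV mGn => // j.
  by under eq_fun do rewrite mxE; exact: measurable_coord.
rewrite /lebesgue_rV_step /pushforward.
rewrite (_ : _ @^-1` _ = F n `*` G n).
  by rewrite product_measure1E// lte_mul_pinfty// ge0_fin_numE.
apply/seteqP; split => -[a v] /=; rewrite mxE unlift_none.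
  move=> [? h]; split=> //; move: h; rewrite (_ : \row_j _ = v)//.
  by apply/rowP => j; rewrite !mxE liftK.
move=> [? h]; split=> //; rewrite (_ : \row_j _ = v)//.
by apply/rowP => j; rewrite !mxE liftK.
Qed.

HB.instance Definition _ := Measure_isSigmaFinite.Build _ _ _
  lebesgue_rV_step step_sigma_finite.

End step.

(* d-dimensional Lebesgue measure, as an iterated product; see lebesgue_rV_box. *)
Fixpoint lebesgue_rV d : {sigma_finite_measure set 'rV[R]_d -> \bar R} :=
  if d is d'.+1 then lebesgue_rV_step (lebesgue_rV d')
  else @dirac _ 'rV[R]_0 0 R.

Lemma lebesgue_rV_box d (A : 'I_d -> set (measurableTypeR R)) :
  (forall i, measurable (A i)) ->
  (lebesgue_rV d [set x : 'rV[R]_d | forall i, A i (x ord0 i)] =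
   \prod_(i < d) lebesgue_measure (A i))%E.
Proof.
elim: d A => [|d ih] A mA /=.
  by rewrite big_ord0 diracE mem_set//= => -[].
rewrite big_ord_recl -(ih (fun i => A (lift ord0 i)))//.
rewrite /lebesgue_rV_step /pushforward /= -product_measure1E//.
- congr (_ _); apply/seteqP; split => [[a v] /= h|[a v] /= [h0 h] i].
    split; first by have := h ord0; rewrite mxE unlift_none.
    by move=> i /=; have := h (lift ord0 i); rewrite mxE liftK.
  by rewrite mxE; case: unliftP => [j|] ->; [exact: h|exact: h0].
- rewrite (_ : [set _ | _] =
    \big[setI/setT]_(i < d)
      ((fun x : 'rV[R]_d => x ord0 i) @^-1` A (lift ord0 i))).
    apply: bigsetI_measurable => i _.
    by rewrite -[X in measurable X]setTI; apply: measurable_coord => //; exact: mA.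
  apply/seteqP; split=> [x h|x]; rewrite -bigcap_seq.
    by move=> i _; exact: h.
  by move=> h i; apply: (h i); rewrite /= mem_index_enum.
Qed.

End lebesgue_rV.
Arguments lebesgue_rV {R} d.


Section geometry.
Context {R : realType} (d : nat).
Implicit Types (A : set 'rV[R]_d) (S : 'M[R]_(d.+1, d)) (T : seq 'M[R]_(d.+1, d)).

Definition dotv (x y : 'rV[R]_d) : R := \sum_(i < d) x ord0 i * y ord0 i.

(* The library norm on 'rV[R]_d is the sup norm, hence this Euclidean one. *)
Definition enorm (x : 'rV[R]_d) : R := Num.sqrt (dotv x x).

Definition frontier A : set 'rV[R]_d := closure A `\` interior A.

(* Convex hull of the rows of F with index in B. *)
Definition face m (F : 'M[R]_(m, d)) (B : {set 'I_m}) : set 'rV[R]_d :=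
  [set x | exists l : 'rV[R]_m, [/\ forall i, 0 <= l ord0 i,
     forall i, i \notin B -> l ord0 i = 0,
     \sum_(i < m) l ord0 i = 1 & x = l *m F]].

Definition hull m (F : 'M[R]_(m, d)) : set 'rV[R]_d := face F [set: 'I_m]%SET.

Definition affinely_independent m (F : 'M[R]_(m, d)) : bool :=
  row_free (row_mx F (const_mx 1 : 'M[R]_(m, 1))).

(* The boundary is a finite union of nondegenerate (d-1)-simplices: segments
   for d = 2, triangles for d = 3. *)
Definition polygonal_domain A : Prop :=
  [/\ A !=set0, open A, connected A, bounded_set A &
   exists2 Fs : seq 'M[R]_(d, d), {in Fs, forall F, affinely_independent F} &
     frontier A = [set x | exists2 F, F \in Fs & hull F x]].

Definition polygonal_partition (Omega : set 'rV[R]_d) n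
    (Om : 'I_n -> set 'rV[R]_d) : Prop :=
  [/\ forall i, polygonal_domain (Om i) /\ Om i `<=` Omega,
      forall i j, i != j -> Om i `&` Om j = set0 &
      closure Omega = \bigcup_i closure (Om i)].

(* A mesh element is encoded by the matrix of its vertices; as a domain of
   integration it is the open simplex. *)
Definition elem S : set 'rV[R]_d := interior (hull S).

Definition triangulation (Omega : set 'rV[R]_d) T : Prop :=
  [/\ {in T, forall S, affinely_independent S},
      closure Omega = [set x | exists2 S, S \in T & hull S x],
      {in T, forall S, elem S `<=` Omega},
      {in T &, injective (@hull d.+1)} &
      (* two elements meet exactly along the face spanned by their common
         vertices *)
      {in T &, forall S S', hull S `&` hull S' =
         face S [set i | [exists j, row i S == row j S']]%SET}].

Definition diam A : R := sup [set r | exists x y, [/\ A x, A y & r = enorm (x - y)]].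

Definition inball_diam A : R :=
  sup [set r | exists c rho, [/\ 0 <= rho,
    forall y, enorm (y - c) <= rho -> A y & r = 2 * rho]].

Definition shape_regular (gamma : R) T : Prop :=
  {in T, forall S, diam (hull S) <= gamma * inball_diam (hull S)}.

Definition interfaces_uncut n (Om : 'I_n -> set 'rV[R]_d) T : Prop :=
  {in T, forall S, forall i j, i != j ->
    frontier (Om i) `&` frontier (Om j) `&` elem S = set0}.

(* nu is the outward unit normal on the face of S opposite to vertex a. *)
Definition outward_unit_normal S (a : 'I_d.+1) (nu : 'rV[R]_d) : Prop :=
  [/\ enorm nu = 1,
      forall i j, i != a -> j != a -> dotv nu (row i S - row j S) = 0 &
      forall i, i != a -> dotv nu (row a S - row i S) < 0].

Definition ref_simplex p : set 'rV[R]_p :=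
  [set t | (forall i, 0 <= t ord0 i) /\ \sum_(i < p) t ord0 i <= 1].

(* Integral of g over the p-simplex with p.+1 vertices the rows of F, with
   respect to p-dimensional surface measure: parametrization by the reference
   simplex, with E the matrix of edge vectors and Gram Jacobian factor. *)
Definition simplex_integral m : 'M[R]_(m, d) -> ('rV[R]_d -> R) -> R :=
  match m return 'M[R]_(m, d) -> ('rV[R]_d -> R) -> R with
  | 0%N => fun _ _ => 0
  | p.+1 => fun F g =>
      let E := \matrix_(i < p) (row (lift ord0 i) F - row ord0 F) in
      Num.sqrt (\det (E *m E^T)) *
      \int[lebesgue_rV p]_(t in @ref_simplex p) g (row ord0 F + t *m E)
  end.

(* Integral over the boundary of S of the function equal to g a on the face
   opposite to vertex a. *)
Definition boundary_integral S (g : 'I_d.+1 -> 'rV[R]_d -> R) : R :=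
  \sum_(a < d.+1) @simplex_integral d (row' a S) (g a).

End geometry.

Section spaces.
Context {R : realType} (d : nat).
Implicit Types (D Omega : set 'rV[R]_d) (T : seq 'M[R]_(d.+1, d)).
Implicit Types (v w f g phi alpha : 'rV[R]_d -> R) (tau sigma : 'rV[R]_d -> 'rV[R]_d).
Notation mu := (@lebesgue_rV R d).

Definition partial (i : 'I_d) f : 'rV[R]_d -> R :=
  fun x => 'D_(delta_mx ord0 i) f x.

Definition grad f : 'rV[R]_d -> 'rV[R]_d := fun x => \row_i partial i f x.

Definition smooth f : Prop :=
  forall (s : seq 'I_d) x, differentiable (foldr partial f s) x.

Definition test_function D phi : Prop :=
  smooth phi /\ exists2 A : set 'rV[R]_d, compact A &
    A `<=` D /\ forall x, ~ A x -> phi x = 0.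

Definition L2 D v : Prop :=
  measurable_fun D v /\ mu.-integrable D (fun x => (v x ^+ 2)%:E).

Definition L2v D tau : Prop := forall i, L2 D (fun x => tau x ord0 i).

Definition inner D v w : R := \int[mu]_(x in D) (v x * w x).
Definition innerv D tau sigma : R := \int[mu]_(x in D) dotv (tau x) (sigma x).
Definition norm0 D v : R := Num.sqrt (inner D v v).
Definition norm0v D tau : R := Num.sqrt (innerv D tau tau).

(* Hdiv D tau g : tau belongs to H(div; D) and g is its weak divergence.
   H1 D v g : v belongs to H^1(D) and g is its weak gradient.
   In both cases g is determined almost everywhere on the open set D. *)
Definition Hdiv D tau g : Prop :=
  [/\ L2v D tau, L2 D g & forall phi, test_function D phi ->
    innerv D tau (grad phi) = - inner D g phi].

Definition H1 D v (g : 'rV[R]_d -> 'rV[R]_d) : Prop :=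
  [/\ L2 D v, L2v D g & forall phi, test_function D phi ->
    forall i, inner D v (partial i phi) = - inner D (fun x => g x ord0 i) phi].

(* Polynomial functions of total degree at most k; m ranges over exponents. *)
Definition Pk (k : nat) : set ('rV[R]_d -> R) :=
  [set p | exists c : {ffun 'I_d -> 'I_k.+1} -> R, forall x : 'rV[R]_d,
     p x = \sum_(m : {ffun 'I_d -> 'I_k.+1} | (\sum_(i < d) m i <= k)%N)
             c m * \prod_(i < d) x ord0 i ^+ m i].

Definition Pkv (k : nat) : set ('rV[R]_d -> 'rV[R]_d) :=
  [set p | forall i, Pk k (fun x => p x ord0 i)].

Definition D_space Omega T (k : nat) v : Prop :=
  L2 Omega v /\ {in T, forall S, exists2 p, Pk k p & ae_eq mu (elem S) v p}.

(* As for Hdiv, the second argument is the divergence of the first one. *)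
Definition RT_space Omega T (k : nat) tau g : Prop :=
  Hdiv Omega tau g /\ {in T, forall S, exists p s, [/\ Pkv k p, Pk k s &
    ae_eq mu (elem S) tau (fun x => p x + s x *: x)]}.

Definition BDM_space Omega T (k : nat) tau g : Prop :=
  Hdiv Omega tau g /\ {in T, forall S, exists2 p, Pkv k p &
    ae_eq mu (elem S) tau p}.

(* The values of the coefficient on the interfaces, a null set, are
   irrelevant; this choice makes them 0. *)
Definition piecewise_coef n (Om : 'I_n -> set 'rV[R]_d) (a : 'I_n -> R) :
    'rV[R]_d -> R :=
  fun x => \sum_(i < n) a i * \1_(Om i) x.

(* The mixed problem posed in Sigma x V, where Sigma tau g means that tau
   belongs to the flux space and has divergence g. *)
Definition mixed_solution Omega alpha f
    (Sigma : ('rV[R]_d -> 'rV[R]_d) -> ('rV[R]_d -> R) -> Prop)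
    (V : ('rV[R]_d -> R) -> Prop) sigma (divsigma u : 'rV[R]_d -> R) : Prop :=
  [/\ Sigma sigma divsigma, V u,
      forall tau divtau, Sigma tau divtau ->
        innerv Omega (fun x => (alpha x)^-1 *: sigma x) tau
          - inner Omega divtau u = 0 &
      forall v, V v -> inner Omega divsigma v = inner Omega f v].

(* The trace of sigmah on the boundary of S is that of the polynomial field q
   which coincides with sigmah almost everywhere on S; both q and the family nu
   of outward normals are uniquely determined. *)
Definition stenberg_postprocessed (alpha f : 'rV[R]_d -> R) (k : nat)
    (S : 'M[R]_(d.+1, d)) sigmah (uh ustar : 'rV[R]_d -> R) : Prop :=
  [/\ Pk k.+1 ustar,
      exists q nu, [/\ exists m, Pkv m q, ae_eq mu (elem S) sigmah q,
        forall a, outward_unit_normal S a (nu a) &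
        forall vh, Pk k.+1 vh -> \int[mu]_(x in elem S) vh x = 0 ->
          innerv (elem S) (fun x => alpha x *: grad ustar x) (grad vh) =
          inner (elem S) f vh
            - boundary_integral S (fun a x => dotv (q x) (nu a) * vh x)] &
      \int[mu]_(x in elem S) ustar x = \int[mu]_(x in elem S) uh x].

Definition local_Hdiv_norm alpha (S : 'M[R]_(d.+1, d)) tau divtau : R :=
  Num.sqrt
    (norm0v (elem S) (fun x => (Num.sqrt (alpha x))^-1 *: tau x) ^+ 2 +
     diam (hull S) ^+ 2 *
       norm0 (elem S) (fun x => (Num.sqrt (alpha x))^-1 * divtau x) ^+ 2).

End spaces.

(* RT_pair stands for RT_k x D_k and BDM_pair for BDM_k x D_(k-1). *)
Variant mixed_pair := RT_pair | BDM_pair.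

Definition flux_space (R : realType) d (pair : mixed_pair) (Omega : set 'rV[R]_d)
    (T : seq 'M[R]_(d.+1, d)) (k : nat) :=
  match pair with
  | RT_pair => RT_space Omega T k
  | BDM_pair => BDM_space Omega T k
  end.

Definition potential_space (R : realType) d (pair : mixed_pair)
    (Omega : set 'rV[R]_d) (T : seq 'M[R]_(d.+1, d)) (k : nat) :=
  match pair with
  | RT_pair => D_space Omega T k
  | BDM_pair => D_space Omega T k.-1
  end.

(* Main.v *)
(* On an element K, put v = w - u* - c with w in P_(k+1)(K) and c chosen so that
   v has zero mean. Testing the mixed problem with compactly supported fluxes
   shows that alpha grad u = - sigma on K, and the divergence theorem turns the
   boundary term of the post-processing into (sigma_h, grad v) + (div sigma_h, v).
   Subtracting the equation div sigma = f gives
     alpha_K |grad v|^2 = alpha_K (grad w - grad u, grad v)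
       + (sigma_h - sigma, grad v) + (div sigma_h - div sigma, v).
   The Poincare inequality |v| <= 2^(d/2) h_K |grad v|, which holds on every
   convex set, and Cauchy-Schwarz bound |grad v|; the triangle inequality
   finishes with C = 2 + 2^(d/2), whatever the shape of the elements. The case
   alpha_K <= 0 is trivial since then the square root of alpha_K is 0. *)
Require Import Defs.
From mathcomp Require Import all_boot all_order all_algebra.
From mathcomp Require Import all_classical all_reals all_analysis.
From mathcomp Require Import perm fingroup measurable_realfun ring lra.
Set Implicit Arguments.
Unset Strict Implicit.
Unset Printing Implicit Defensive.
Import Order.TTheory GRing.Theory Num.Theory.
Import numFieldNormedType.Exports.
Local Open Scope classical_set_scope.
Local Open Scope ring_scope.

(** * Affine changes of variables *)

(** The fluxes and their divergences are known only through weak equations. Everything is therefore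
    tested against one class of smooth functions, closed under sums, products, partial derivatives
    and affine substitutions, which contains both the polynomials and smooth cut-offs vanishing
    outside compact parts of an element. Letting the cut-offs tend to 1 under dominated convergence
    turns orthogonality to test functions into orthogonality to polynomials on the element, without
    any density theorem. The boundary integral is given through Gram determinants of the faces; it
    becomes tractable because the Gram factor times the outward normal is a fixed multiple of the
    gradient of a barycentric coordinate. The factor 2^d under the root comes from comparing two
    points with their midpoint: the maps involved are dilations of ratio at least 1/2, whose
    Jacobian is at least 2^(-d). In the summand 2 of the constant, one unit pays for the triangle
    inequality through [w], the other for the error of [w] in the bound of |grad v|. *)

Section lebesgue_line.
Context {R : realType}.
Implicit Types (b c : R).
Local Open Scope ereal_scope.

Lemma measurable_affine_line b c :
  measurable_fun [set: measurableTypeR R]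
    (fun a : measurableTypeR R => (b + c * a)%R : measurableTypeR R).
Proof. by apply: measurable_funD => //; exact: measurable_funM. Qed.

(** The pushforward is a measure only by virtue of [mf]; the existential hides that proof and leaves
    a bundled measure known by its two formulas. *)
Lemma image_measure d1 d2 (T1 : measurableType d1) (T2 : measurableType d2)
    (mu : {measure set T1 -> \bar R}) (f : T1 -> T2) : measurable_fun [set: T1] f ->
  exists2 nu : {measure set T2 -> \bar R}, (forall B, nu B = mu (f @^-1` B)) &
    forall g, measurable_fun [set: T2] g -> (forall x, 0 <= g x) ->
      \int[nu]_x g x = \int[mu]_x g (f x).
Proof.
move=> mf; unshelve (eexists (pushforward mu f)); [exact: mf|by []|].
by move=> g mg g0; rewrite (ge0_integral_pushforward mf).
Qed.

(** Uniqueness of Lebesgue measure: the rescaled image measure has the right value on half-open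
    intervals. For negative [c] the preimage is closed at the other end, which does not change its
    length. *)
Lemma lebesgue_measure_preimage_affine b c (A : set (measurableTypeR R)) :
  c != 0%R -> measurable A ->
  lebesgue_measure A =
    `|c|%:E * lebesgue_measure ((fun a : measurableTypeR R => (b + c * a)%R) @^-1` A).
Proof.
move=> c0 mA.
have [mu muE _] := image_measure (@lebesgue_measure R) (measurable_affine_line b c).
pose nu := mscale (NngNum (normr_ge0 c)) mu.
rewrite -muE [RHS](_ : _ = nu A)//; apply: (@lebesgue_measure_unique _ nu) => //= X.
case/ocitvP => [->|[[u v] /= uv ->]]; first by rewrite !measure0.
rewrite /nu /mscale muE/= lebesgue_measure_itv/= lte_fin uv -EFinB.
have [cpos|cneg|/eqP] := ltrgt0P c; last by rewrite (negbTE c0).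
- rewrite (_ : _ @^-1` _ = `]((u - b) / c)%R, ((v - b) / c)%R]%classic).
    rewrite lebesgue_measure_itv/= lte_fin ltr_pM2r ?invr_gt0//.
    by rewrite ltrD2r uv -EFinB -EFinM; congr _%:E; field.
  apply/seteqP; split => a /=; rewrite !in_itv/= ltr_pdivrMr// ler_pdivlMr//;
    by move=> /andP[? ?]; apply/andP; split; lra.
- rewrite (_ : _ @^-1` _ = `[((v - b) / c)%R, ((u - b) / c)%R[%classic).
    rewrite lebesgue_measure_itv/= lte_fin ltr_nM2r ?invr_lt0//.
    by rewrite ltrD2r uv -EFinB -EFinM; congr _%:E; field.
  apply/seteqP; split => a /=; rewrite !in_itv/= ltr_ndivlMr// ler_ndivrMr//;
    by move=> /andP[? ?]; apply/andP; split; lra.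
Qed.

Lemma ge0_integral_affine_line b c (f : measurableTypeR R -> \bar R) : c != 0%R ->
  measurable_fun [set: _] f -> (forall x, 0 <= f x) ->
  \int[lebesgue_measure]_x f x = `|c|%:E * \int[lebesgue_measure]_x f (b + c * x)%R.
Proof.
move=> c0 mf f0.
have [mu muE muI] := image_measure (@lebesgue_measure R) (measurable_affine_line b c).
transitivity (\int[mscale (NngNum (normr_ge0 c)) mu]_x f x).
  apply: eq_measure_integral => A mA _.
  by rewrite /= /mscale/= muE; exact: lebesgue_measure_preimage_affine.
by rewrite ge0_integral_mscale// muI.
Qed.

End lebesgue_line.

Section lebesgue_space.
Context {R : realType}.
Local Open Scope ereal_scope.

Lemma row_consE d (p : measurableTypeR R * 'rV[R]_d) :
  row_cons p = row_mx (const_mx p.1) p.2 :> 'rV_(1 + d).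
Proof.
apply/rowP => i; case: (split_ordP i) => j ->.
  rewrite row_mxEl mxE ord1 mxE (_ : lshift d ord0 = ord0); last exact/val_inj.
  by rewrite unlift_none.
rewrite row_mxEr mxE (_ : rshift 1 j = lift ord0 j); last exact/val_inj.
by rewrite liftK.
Qed.

Lemma measurable_affine d m (b : 'rV[R]_m) (A : 'M[R]_(d, m)) :
  measurable_fun [set: 'rV[R]_d] (fun x => b + x *m A)%R.
Proof.
apply: measurable_fun_rV => i; under eq_fun do rewrite !mxE.
apply: measurable_funD => //; apply: measurable_sum => j.
by apply: measurable_funM => //; exact: measurable_coord.
Qed.

Lemma ge0_integral_rVS d (f : 'rV[R]_d.+1 -> \bar R) :
  measurable_fun [set: _] f -> (forall x, 0 <= f x) ->
  \int[lebesgue_rV d.+1]_x f x =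
  \int[lebesgue_measure]_a \int[lebesgue_rV d]_v f (row_cons (a, v)).
Proof.
move=> mf f0.
rewrite [LHS](ge0_integral_pushforward (@measurable_row_cons R d))//.
rewrite fubini_tonelli1 => [|//=|x]; first by [].
  by apply: measurableT_comp => //; exact: measurable_row_cons.
exact: f0.
Qed.

(** The order of integration with the first coordinate innermost serves block lower triangular
    matrices, the opposite order block upper triangular ones. *)
Lemma ge0_integral_rVS_swap d (f : 'rV[R]_d.+1 -> \bar R) :
  measurable_fun [set: _] f -> (forall x, 0 <= f x) ->
  \int[lebesgue_rV d.+1]_x f x =
  \int[lebesgue_rV d]_v \int[lebesgue_measure]_a f (row_cons (a, v)).
Proof.
move=> mf f0.
rewrite [LHS](ge0_integral_pushforward (@measurable_row_cons R d))//.
rewrite fubini_tonelli2 => [|//=|x]; first by [].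
  by apply: measurableT_comp => //; exact: measurable_row_cons.
exact: f0.
Qed.

(** The shift [b] is quantified inside the property because eliminating one coordinate of a block
    triangular map leaves an affine map whose shift depends on that coordinate. *)
Definition affine_change d (A : 'M[R]_d) := forall (b : 'rV[R]_d) f,
  measurable_fun [set: _] f -> (forall x, 0 <= f x) ->
  \int[lebesgue_rV d]_x f x =
    `|\det A|%:E * \int[lebesgue_rV d]_x f (b + x *m A)%R.

Lemma affine_changeM d (A B : 'M[R]_d) :
  affine_change A -> affine_change B -> affine_change (A *m B).
Proof.
move=> hA hB b f mf f0; rewrite (hB b)// (hA 0%R (fun x => f (b + x *m B)%R)).
- rewrite det_mulmx normrM mulrC EFinM -muleA; congr (_ * (_ * _)).
  by apply: eq_integral => x _; rewrite add0r mulmxA.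
- by apply: measurableT_comp => //; exact: measurable_affine.
- by move=> x.
Qed.

Lemma measurable_row_consl d (a : R) :
  measurable_fun [set: 'rV[R]_d] (fun v => row_cons (a, v)).
Proof.
by apply: measurableT_comp; [exact: measurable_row_cons|exact: pair1_measurable].
Qed.

Lemma measurable_row_consr d (v : 'rV[R]_d) :
  measurable_fun [set: measurableTypeR R] (fun a => row_cons (a, v)).
Proof.
by apply: measurableT_comp; [exact: measurable_row_cons|exact: pair2_measurable].
Qed.

(** Vectors are rows, so (a, v) is sent to (c a, a r + v A): for fixed [a] the remaining coordinates
    undergo [A] with shift [a *: r], and then [a] is rescaled on the line. *)
Lemma affine_change_upper d (c : R) (r : 'rV[R]_d) (A : 'M[R]_d) : (c != 0)%R ->
  affine_change A -> affine_change (block_mx (const_mx c) r 0%R A : 'M[R]_(1 + d)).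
Proof.
move=> c0 hA b f mf f0.
pose g (x : 'rV[R]_d.+1) := f (b + x *m (block_mx (const_mx c) r 0%R A : 'M[R]_(1 + d)))%R.
have mg : measurable_fun [set: _] g.
  by apply: measurableT_comp => //; exact: measurable_affine.
rewrite ge0_integral_rVS// ge0_integral_rVS//.
pose b1 : R := lsubmx (b : 'rV_(1 + d)) ord0 ord0.
pose b2 := rsubmx (b : 'rV_(1 + d)).
pose F a := \int[lebesgue_rV d]_v f (row_cons (a, v)).
have mF : measurable_fun [set: measurableTypeR R] F.
  apply: (measurable_fun_fubini_tonelli_F (fun z => f (row_cons z))) => //.
  by apply: measurableT_comp => //; exact: measurable_row_cons.
have F0 a : 0 <= F a by apply: integral_ge0.
rewrite -/(F _) (ge0_integral_affine_line b1 c0 mF F0).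
rewrite (_ : \det (block_mx _ _ _ _) = c * \det A)%R; last first.
  by rewrite (det_ublock (const_mx c : 'M[R]_1)) det_mx11 mxE.
rewrite normrM EFinM -muleA; congr (_ * _).
rewrite -ge0_integralZl//; last 2 first.
- apply: (measurable_fun_fubini_tonelli_F (fun z => g (row_cons z))) => [|z]; last exact: f0.
  by apply: measurableT_comp => //; exact: measurable_row_cons.
- by move=> a _; exact: integral_ge0.
apply: eq_integral => a _; rewrite /F (hA (b2 + a *: r)%R)//; last first.
  by apply: measurableT_comp => //; exact: measurable_row_consl.
congr (_ * _); apply: eq_integral => v _; congr f.
rewrite !row_consE/= -[b in RHS](@hsubmxK _ _ 1 d) mul_row_block add_row_mx.
rewrite mulmx0 addr0; apply: congr2.
  by apply/rowP => i; rewrite /b1 !mxE big_ord1 !mxE !ord1 mulrC.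
rewrite addrA; congr (_ + _ + _)%R.
by apply/rowP => i; rewrite !mxE big_ord1 !mxE.
Qed.

(** Here (a, v) is sent to (c a + v r, v A), so the line integral in [a] has to be transformed
    first, for fixed [v]. *)
Lemma affine_change_lower d (c : R) (r : 'cV[R]_d) (A : 'M[R]_d) : (c != 0)%R ->
  affine_change A -> affine_change (block_mx (const_mx c) 0%R r A : 'M[R]_(1 + d)).
Proof.
move=> c0 hA b f mf f0.
pose g (x : 'rV[R]_d.+1) := f (b + x *m (block_mx (const_mx c) 0%R r A : 'M[R]_(1 + d)))%R.
have mg : measurable_fun [set: _] g.
  by apply: measurableT_comp => //; exact: measurable_affine.
rewrite ge0_integral_rVS_swap// ge0_integral_rVS_swap//.
pose b1 : R := lsubmx (b : 'rV_(1 + d)) ord0 ord0.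
pose b2 := rsubmx (b : 'rV_(1 + d)).
pose F v := \int[lebesgue_measure]_a f (row_cons (a, v)).
have mF : measurable_fun [set: 'rV[R]_d] F.
  apply: (measurable_fun_fubini_tonelli_G (fun z => f (row_cons z))) => //.
  by apply: measurableT_comp => //; exact: measurable_row_cons.
have F0 v : 0 <= F v by apply: integral_ge0.
rewrite -/(F _) (hA b2 F mF F0).
rewrite (_ : \det (block_mx _ _ _ _) = c * \det A)%R; last first.
  by rewrite (det_lblock (const_mx c : 'M[R]_1)) det_mx11 mxE.
rewrite normrM mulrC EFinM -muleA; congr (_ * _).
rewrite -ge0_integralZl//; last 2 first.
- apply: (measurable_fun_fubini_tonelli_G (fun z => g (row_cons z))) => [|z]; last exact: f0.
  by apply: measurableT_comp => //; exact: measurable_row_cons.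
- by move=> a _; exact: integral_ge0.
apply: eq_integral => v _.
rewrite /F (ge0_integral_affine_line (b1 + (v *m r) ord0 ord0)%R c0)//; last first.
  by apply: measurableT_comp => //; exact: measurable_row_consr.
congr (_ * _); apply: eq_integral => a _; congr f.
rewrite !row_consE/= -[b in RHS](@hsubmxK _ _ 1 d) mul_row_block add_row_mx.
rewrite mulmx0 add0r; apply: congr2 => //.
apply/rowP => i; rewrite /b1 !mxE big_ord1 !mxE !ord1.
by rewrite -addrA [(\sum_(_ < _) _ + _)%R]addrC [(a * c)%R]mulrC.
Qed.

Lemma affine_change1 d : affine_change (1%:M : 'M[R]_d).
Proof.
elim: d => [|d ih].
  move=> b f mf f0; rewrite det1 normr1 mul1e; apply: eq_integral => x _.
  by congr f; apply/rowP => -[].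
have -> : 1%:M = block_mx (const_mx 1%R) 0%R 0%R 1%:M :> 'M[R]_(1 + d).
  rewrite (scalar_mx_block 1 d); congr block_mx.
  by apply/matrixP => i j; rewrite !ord1 !mxE.
by apply: affine_change_upper => //; exact: oner_neq0.
Qed.

(* Gaussian elimination without pivoting: if the upper left entry vanishes, a row
   with a nonzero first entry is first added to the top row. *)
Lemma affine_change_unitmx d (A : 'M[R]_d) : A \in unitmx -> affine_change A.
Proof.
elim: d A => [|d ih] A uA.
  have -> : A = 1%:M by apply/matrixP => -[].
  exact: affine_change1.
move: A uA; rewrite -[d.+1]/(1 + d)%N => A uA.
have pivot (B : 'M[R]_(1 + d)) : B \in unitmx -> B ord0 ord0 != 0%R ->
    affine_change B.
  move=> uB B00; set c := B ord0 ord0 in B00.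
  (* Block LU factorization; taking determinants shows that the Schur complement is invertible, as
     the induction hypothesis requires. *)
  have e : B = block_mx (const_mx 1%R) 0%R (c^-1 *: dlsubmx B) 1%:M *m
      block_mx (const_mx c) (ursubmx B) 0%R
        (drsubmx B - c^-1 *: (dlsubmx B *m ursubmx B))%R.
    rewrite mulmx_block -[LHS](submxK B) !mul0mx !mulmx0 !addr0 !mul1mx.
    have h1 (m : nat) (x : 'M[R]_(1, m)) : const_mx 1%R *m x = x.
      by apply/matrixP => i j; rewrite (ord1 i) mxE big_ord1 mxE mul1r.
    rewrite !h1 -!scalemxAl addrCA subrr addr0.
    congr block_mx.
      apply/matrixP => i j; rewrite !mxE !ord1 /c.
      by congr (B _ _); exact/val_inj.
    apply/matrixP => i j; rewrite !mxE big_ord1 !mxE !ord1.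
    by rewrite mulrCA mulVf// mulr1.
  have dA : (drsubmx B - c^-1 *: (dlsubmx B *m ursubmx B))%R \in unitmx.
    move: uB; rewrite !unitmxE {1}e det_mulmx (det_lblock (const_mx 1%R : 'M[R]_1)).
    rewrite (det_ublock (const_mx c : 'M[R]_1)) unitrM => /andP[_].
    by rewrite unitrM => /andP[].
  rewrite e; apply: affine_changeM.
    by apply: affine_change_lower; [exact: oner_neq0|exact: affine_change1].
  by apply: affine_change_upper => //; exact: ih.
have [A0|] := eqVneq (A ord0 ord0) 0%R; last exact: pivot.
have [i Ai] : exists i, dlsubmx A i ord0 != 0%R.
  apply/existsP; rewrite -negb_forall; apply/negP => /forallP h.
  move: uA; rewrite unitmxE -det_tr (expand_det_row _ ord0) big1 ?unitr0// => j _.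
  rewrite mxE; case: (split_ordP (j : 'I_(1 + d))) => j' jE.
    rewrite (_ : j = ord0) ?A0 ?mul0r//; apply/val_inj.
    by rewrite jE/= ord1.
  have /eqP := h j'; rewrite !mxE jE (_ : lshift d ord0 = ord0); last exact/val_inj.
  by move=> ->; rewrite mul0r.
pose T : 'M[R]_(1 + d) := block_mx (const_mx 1%R) (delta_mx ord0 i) 0%R 1%:M.
pose T' : 'M[R]_(1 + d) := block_mx (const_mx 1%R) (- delta_mx ord0 i)%R 0%R 1%:M.
have detT : \det T = 1%R.
  by rewrite (det_ublock (const_mx 1%R : 'M[R]_1)) det1 mulr1 det_mx11 mxE.
have TT : T' *m T = 1%:M.
  rewrite mulmx_block !mul0mx !mulmx0 !addr0 !mulmx1 add0r.
  rewrite (scalar_mx_block 1 d 1%R); congr block_mx.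
    by apply/matrixP => u v; rewrite mxE big_ord1 !mxE !ord1 mulr1.
  by apply/matrixP => u v; rewrite !mxE big_ord1 !mxE !ord1 mul1r subrr.
rewrite -[A]mul1mx -TT -mulmxA; apply: affine_changeM.
  by apply: affine_change_upper; [exact: oner_neq0|exact: affine_change1].
apply: pivot; first by rewrite unitmx_mul uA andbT unitmxE detT unitr1.
rewrite /T -[A]submxK mulmx_block.
rewrite (_ : ord0 = lshift d (ord0 : 'I_1)); last exact/val_inj.
rewrite block_mxEul mxE [X in (X + _)%R]mxE big_ord1 !mxE.
rewrite (_ : lshift d (ord0 : 'I_1) = ord0); last exact/val_inj.
rewrite A0 mulr0 add0r (bigD1 i)//= big1 ?addr0 => [|j ji].
  rewrite mxE !eqxx mul1r.
  by move: Ai; rewrite !mxE (_ : lshift d ord0 = ord0)//; exact/val_inj.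
by rewrite mxE (negbTE ji) andbF mul0r.
Qed.

Lemma ge0_integral_affine d (A : 'M[R]_d) (b : 'rV[R]_d) f : A \in unitmx ->
  measurable_fun [set: _] f -> (forall x, 0 <= f x) ->
  \int[lebesgue_rV d]_x f x =
    `|\det A|%:E * \int[lebesgue_rV d]_x f (b + x *m A)%R.
Proof. by move=> uA; exact: affine_change_unitmx. Qed.

End lebesgue_space.

(** * Borel sets, continuous functions and bounded sets for the coordinate sigma-algebra *)

Section open_measurable.
Context {R : realType} {d : nat}.
Notation mu := (@lebesgue_rV R d).

Lemma coord_le_norm (x : 'rV[R]_d) i : `|x ord0 i| <= `|x|.
Proof.
rewrite [leRHS]mx_normrE.
exact: (@le_bigmax _ _ _ _ (fun ij : 'I_1 * 'I_d => `|x ij.1 ij.2|) (ord0, i)).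
Qed.

Lemma norm_le_coord (x : 'rV[R]_d) M : 0 <= M ->
  (forall i, `|x ord0 i| <= M) -> `|x| <= M.
Proof.
move=> M0 xM; rewrite [leLHS]mx_normrE; apply/bigmax_leP; split => // -[i j] _ /=.
by rewrite ord1.
Qed.

Definition box (x : 'rV[R]_d) (r : R) : set 'rV[R]_d :=
  [set y | forall i, `]x ord0 i - r, x ord0 i + r[%classic (y ord0 i)].

Lemma boxE x r y : box x r y <-> forall i, `|y ord0 i - x ord0 i| < r.
Proof.
by split=> h i; have := h i; rewrite /box/= in_itv/= ltr_distl.
Qed.

Lemma measurable_box x r : measurable (box x r).
Proof.
rewrite (_ : box x r = \bigcap_(i in [set: 'I_d])
    ((fun y : 'rV[R]_d => y ord0 i) @^-1` `]x ord0 i - r, x ord0 i + r[%classic)).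
  apply: fin_bigcap_measurable => // i _; rewrite -[X in measurable X]setTI.
  exact: measurable_coord.
by apply/seteqP; split => y h i; [move=> _; exact: h|exact: h].
Qed.

(** The sigma-algebra is generated by the coordinates, so an open set is written as the countable
    union of the boxes with rational centre and radius 1/(n+1) that it contains. *)
Lemma open_rV_measurable (A : set 'rV[R]_d) : open A -> measurable A.
Proof.
move=> oA.
pose c (q : 'rV[rat]_d) : 'rV[R]_d := map_mx ratr q.
pose F (p : 'rV[rat]_d * nat) : set 'rV[R]_d :=
  if `[< box (c p.1) p.2.+1%:R^-1 `<=` A >] then box (c p.1) p.2.+1%:R^-1 else set0.
suff -> : A = \bigcup_p F p.
  apply: countable_bigcupT_measurable; first exact: countableP.
  by move=> p; rewrite /F; case: ifPn => _; [exact: measurable_box|].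
apply/seteqP; split => [x Ax|x [p _]]; last first.
  by rewrite /F; case: ifPn => // /asboolP; exact.
have /nbhs_ballP[e /= e0 eA] : nbhs x A by exact: open_nbhs_nbhs.
(* The rational centre lies within [r] of [x], so points of its box lie within [2 * r] of [x]. *)
have [n [r [rE re r0]]] : exists n r, [/\ n.+1%:R^-1 = r, 2 * r < e & 0 < r].
  have /ltr_add_invr[n] : 0 < e / 2 by rewrite divr_gt0.
  rewrite add0r => h; exists n, n.+1%:R^-1; split => //.
  by rewrite mulrC -ltr_pdivlMr.
have /choice[q qP] : forall i, exists q : rat, `|x ord0 i - ratr q| < r.
  move=> i; have h : x ord0 i - r < x ord0 i + r by lra.
  have [q] := rat_in_itvoo h; rewrite in_itv/= => hq; exists q.
  by rewrite distrC ltr_distl.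
exists (\row_i q i, n) => //; rewrite /F/= rE ifT.
  by apply/boxE => i; rewrite !mxE.
apply/asboolP => y /boxE h; apply: eA.
rewrite -ball_normE /ball_/=; apply: (le_lt_trans _ re).
apply: norm_le_coord => [|i]; first by rewrite mulr_ge0// ltW.
have := h i; have := qP i; rewrite !mxE !ltr_norml ler_norml.
by move=> /andP[? ?] /andP[? ?]; apply/andP; split; lra.
Qed.

Lemma continuous_rV_measurable (f : 'rV[R]_d -> R) : continuous f ->
  measurable_fun [set: _] f.
Proof.
move=> /continuousP cf.
apply: (measurability _ (RGenOInfty.measurableE R)) => _ [_ [x ->] <-].
by rewrite setTI; apply: open_rV_measurable; apply: cf; exact: interval_open.
Qed.

Lemma bounded_measure_fin (A : set 'rV[R]_d) : measurable A -> bounded_set A ->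
  (mu A < +oo)%E.
Proof.
move=> mA [M [_ hM]]; have {}hM x : A x -> `|x| <= `|M| + 1.
  by apply: hM; rewrite (le_lt_trans (ler_norm M))// ltrDl.
have hb : A `<=` box 0 (`|M| + 2).
  move=> x Ax; apply/boxE => i; rewrite mxE subr0.
  by apply: (le_lt_trans (coord_le_norm _ _)); have := hM _ Ax; lra.
apply: (@le_lt_trans _ _ (mu (box 0 (`|M| + 2)))).
  by apply: le_measure => //; apply/mem_set => //; exact: measurable_box.
rewrite (@lebesgue_rV_box _ _
  (fun i => `](0 : 'rV[R]_d) ord0 i - (`|M| + 2), (0 : 'rV[R]_d) ord0 i + (`|M| + 2)[%classic))//.
rewrite [ltLHS](_ : _ = \prod_(i < d) (2 * (`|M| + 2))%:E)%E; last first.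
  apply: eq_bigr => i _; rewrite lebesgue_measure_itv/= lte_fin !mxE.
  have := normr_ge0 M => M0; rewrite ifT; last by lra.
  by rewrite -EFinD; congr _%:E; ring.
by rewrite prodEFin ltry.
Qed.

End open_measurable.

(** * Smooth cut-off functions *)

Section flat_function.
Context {R : realType}.
Implicit Types (q : {poly R}) (y : R).

(* The functions [y |-> q(1/y) exp(-1/y)], extended by 0 to [y <= 0], form a
   class of smooth functions closed under differentiation. *)
Definition flat q y : R := if 0 < y then q.[y^-1] * expR (- y^-1) else 0.

(** Chain rule in the variable z = 1/y, for which dz/dy = - z^2. *)
Definition dflat q : {poly R} := 'X^2 * (q - q^`()).

Lemma horner_le q : exists m C, 0 <= C /\
  forall z, 1 <= z -> `|q.[z]| <= C * z ^+ m.
Proof.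
exists (size q), (\sum_(i < size q) `|q`_i|); split; first exact: sumr_ge0.
move=> z z1; rewrite horner_coef mulr_suml.
apply: (le_trans (ler_norm_sum _ _ _)); apply: ler_sum => i _.
have z0 : 0 <= z by apply: le_trans z1.
rewrite normrM ler_wpM2l// normrX ger0_norm// ler_weXn2l//.
exact: ltnW.
Qed.

(** With z = 1/y, the bound z^(m+2) <= (m+2)! exp(z) lets the exponential absorb the growth z^m of
    the polynomial and leaves a factor y^2 to spare. *)
Lemma flat_le q : exists C, 0 <= C /\
  forall y, `|y| <= 1 -> `|flat q y| <= C * y ^+ 2.
Proof.
have [m [C [C0 qC]]] := horner_le q.
exists (C * (m.+2)`!%:R); split; first by rewrite mulr_ge0.
move=> y; rewrite /flat; have [y0|y0] := ltP 0 y => y1; last first.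
  by rewrite normr0 mulr_ge0 ?sqr_ge0// mulr_ge0.
rewrite gtr0_norm// in y1.
have z1 : 1 <= y^-1 by rewrite invf_ge1.
have z0 : 0 < y^-1 by rewrite invr_gt0.
rewrite normrM [X in _ * X]gtr0_norm ?expR_gt0// expRN.
rewrite ler_pdivrMr ?expR_gt0//; apply: (le_trans (qC _ z1)).
rewrite -!mulrA ler_wpM2l//.
have h : (y^-1) ^+ m.+2 <= (m.+2)`!%:R * expR y^-1.
  have := @expR_ge1Dxn _ y^-1 m.+1 (ltW z0).
  rewrite -ler_pdivrMl ?ltr0n ?fact_gt0// mulrC => h.
  by apply: le_trans h; rewrite lerDr.
have -> : y^-1 ^+ m = y ^+ 2 * y^-1 ^+ m.+2.
  by rewrite -[m.+2]addn2 exprD mulrCA -exprMn mulfV ?gt_eqF// expr1n mulr1.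
by rewrite (_ : _%:R * _ = y ^+ 2 * ((m.+2)`!%:R * expR y^-1)) ?ler_wpM2l ?sqr_ge0//; ring.
Qed.

Lemma is_derive_flat q y : is_derive y 1 (flat q) (flat (dflat q) y).
Proof.
have [y0|y0|->] := ltrgtP y 0.
- rewrite {2}/flat ltNge (ltW y0)/=.
  apply: (@near_eq_is_derive _ _ _ (cst 0)) => //.
  have : \forall z \near y, z < 0 by exact: lt_nbhsl.
  by apply: filterS => z z0; rewrite /flat ltNge (ltW z0).
- rewrite {2}/flat y0.
  have y1 : y != 0 by rewrite gt_eqF.
  have dV : is_derive y 1 (fun z : R => z^-1) (- y ^- 2 *: 1) by exact: is_deriveV.
  have dq := is_derive1_comp (is_derive_poly q y^-1) dV.
  have dN : is_derive y 1 (fun z : R => - z^-1) (- (- y ^- 2 *: 1)).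
    exact: is_deriveN.
  have de := @is_derive1_comp R expR (fun z => - z^-1) y _ _
    (is_derive_expR (- y^-1)) dN.
  have h := is_deriveM dq de.
  have {}h : is_derive y 1 ((horner q \o (fun z : R => z^-1)) *
       (expR \o (fun z : R => - z^-1))) ((dflat q).[y^-1] * expR (- y^-1)).
    apply: (is_derive_eq h); rewrite /dflat !hornerE /GRing.scale/=.
    by field.
  apply: near_eq_is_derive h.
  have : \forall z \near y, 0 < z by exact: lt_nbhsr.
  by apply: filterS => z z0; rewrite /flat z0.
(* At the origin the quadratic bound of [flat_le] makes the difference quotient of order h. *)
have lim0 : h^-1 *: ((flat q \o shift 0) (h *: 1) - flat q 0) @[h --> (0:R)^'] --> (0:R).
  have [C [C0 qC]] := flat_le q.
  apply/cvgr0Pnorm_le => e e0.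
  have e1 : 0 < Num.min 1 (e / (C + 1)).
    by rewrite lt_min ltr01 divr_gt0// ltr_wpDl.
  near=> h.
  have h0 : h != 0 by near: h; exact: nbhs_dnbhs_neq.
  have : `|h| < Num.min 1 (e / (C + 1)).
    by near: h; apply: dnbhs0_lt.
  rewrite lt_min => /andP[h1 he].
  rewrite /= addr0 [flat q 0]/flat ltxx subr0 normrZ normfV.
  rewrite -[_ *: 1]/(h * 1) mulr1 ler_pdivrMl ?normr_gt0//.
  apply: (le_trans (qC _ (ltW h1))); rewrite -real_normK ?num_real//.
  rewrite expr2 mulrCA ler_wpM2l//.
  move: he; rewrite ltr_pdivlMr ?ltr_wpDl// => he.
  by apply: le_trans (ltW he); rewrite mulrDr mulr1 mulrC lerDl.
have -> : flat (dflat q) 0 = 0 by rewrite /flat ltxx.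
apply: DeriveDef; first exact: cvgP lim0.
exact: cvg_lim lim0.
Unshelve. all: by end_near. Qed.

Lemma flat1_ge0 y : 0 <= flat 1 y.
Proof. by rewrite /flat; case: ifP => // _; rewrite hornerC mul1r expR_ge0. Qed.

Lemma flat1_le1 y : flat 1 y <= 1.
Proof.
rewrite /flat; case: ifP => // y0; rewrite hornerC mul1r.
by rewrite -expR0 ler_expR oppr_le0 invr_ge0 ltW.
Qed.

Lemma flat1_cvg y : 0 < y -> flat 1 (n%:R * y - 1) @[n --> \oo] --> (1 : R).
Proof.
move=> y0; apply/cvgrPdist_le => e e0; near=> n.
have : (1 + e^-1) / y <= n%:R by near: n; exact: nbhs_infty_ger.
rewrite ler_pdivrMr// => hn.
have hp : e^-1 <= n%:R * y - 1 by lra.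
have p0 : 0 < n%:R * y - 1 by apply: lt_le_trans hp; rewrite invr_gt0.
rewrite ger0_norm ?subr_ge0 ?flat1_le1// /flat p0 hornerC mul1r.
have := expR_ge1Dx (- (n%:R * y - 1)^-1).
have : (n%:R * y - 1)^-1 <= e by rewrite invf_ple.
by lra.
Unshelve. all: by end_near. Qed.

End flat_function.

(** * A class of smooth functions closed under differentiation *)

Section elementary_functions.
Context {R : realType} {d : nat}.
Implicit Types (f g : 'rV[R]_d -> R).

(* Contains the polynomials and smooth cut-off functions of polytopes. *)
Inductive elementary : ('rV[R]_d -> R) -> Prop :=
| elementary_cst c : elementary (fun=> c)
| elementary_coord i : elementary (fun x => x ord0 i)
| elementary_flat q l c : elementary (fun x => flat q (dotv l x + c))
| elementaryD f g : elementary f -> elementary g -> elementary (fun x => f x + g x)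
| elementaryM f g : elementary f -> elementary g -> elementary (fun x => f x * g x).

Lemma is_derive_coord (x v : 'rV[R]_d) i :
  is_derive x v (fun y : 'rV[R]_d => y ord0 i : R) (v ord0 i).
Proof.
apply: DeriveDef; first exact/diff_derivable/differentiable_coord.
apply: cvg_lim => //; apply/cvgrPdist_le => e e0; near=> h; have h0 : h != 0 by near: h; exact: nbhs_dnbhs_neq.
by rewrite /= !mxE addrK /GRing.scale/= mulKf// subrr normr0 ltW.
Unshelve. all: by end_near. Qed.

Lemma differentiable_dotv (l x : 'rV[R]_d) c : differentiable (fun y => dotv l y + c) x.
Proof.
apply: differentiableD => //; rewrite /dotv.
rewrite (_ : (fun _ => _) = \sum_(i < d) (fun y : 'rV[R]_d => l ord0 i * y ord0 i)).
  apply: differentiable_sum => i; apply: differentiableM => //.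
  exact: differentiable_coord.
by apply/funext => y; rewrite fct_sumE.
Qed.

Lemma derive_dotv (l x v : 'rV[R]_d) c : 'D_v (fun y => dotv l y + c) x = dotv l v.
Proof.
rewrite /dotv.
rewrite (_ : (fun _ => _) =
    \sum_(i < d) (l ord0 i *: (fun y : 'rV[R]_d => y ord0 i : R)) + cst c); last first.
  by apply/funext => y; rewrite /= fctE fct_sumE.
have h i := is_deriveZ (l ord0 i) (is_derive_coord x v i).
have := is_deriveD (is_derive_sum h) (is_derive_cst c x v).
by move=> /(@derive_val _ _ _ _ _ _ _) ->; rewrite addr0.
Qed.

Lemma partial_dotv (l : 'rV[R]_d) c i x : partial i (fun y => dotv l y + c) x = l ord0 i.
Proof.
rewrite /partial derive_dotv /dotv (bigD1 i)//= big1 ?addr0.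
  by rewrite mxE !eqxx mulr1.
by move=> j ji; rewrite mxE (negbTE ji) andbF mulr0.
Qed.

Lemma differentiable_flat q (y : R) : differentiable (flat q) y.
Proof.
apply/derivable1_diffP; exact: (ex_derive (is_derive := is_derive_flat q y)).
Qed.

Lemma partial_coord i j x :
  partial i (fun y : 'rV[R]_d => y ord0 j) x = (j == i)%:R.
Proof.
by rewrite /partial (derive_val (is_derive := is_derive_coord _ _ _)) mxE eqxx.
Qed.

Lemma partialD f g i x : differentiable f x -> differentiable g x ->
  partial i (fun y => f y + g y) x = partial i f x + partial i g x.
Proof. by move=> df dg; apply: deriveD; exact: diff_derivable. Qed.

Lemma partialM f g i x : differentiable f x -> differentiable g x ->
  partial i (fun y => f y * g y) x = f x * partial i g x + g x * partial i f x.
Proof. by move=> df dg; apply: deriveM; exact: diff_derivable. Qed.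

Lemma partial_cst (c : R) i (x : 'rV[R]_d) : partial i (fun=> c) x = 0.
Proof. exact: derive_cst. Qed.

Lemma partial_flat q (l : 'rV[R]_d) c i x :
  partial i (fun y => flat q (dotv l y + c)) x =
  l ord0 i * flat (dflat q) (dotv l x + c).
Proof.
have dl := differentiable_dotv l x c.
have df := differentiable_flat q (dotv l x + c).
rewrite /partial deriveE; last exact: (@differentiable_comp _ _ _ _ _ (flat q)).
have e : 'd (fun y => dotv l y + c) x (delta_mx ord0 i) = l ord0 i.
  by rewrite -deriveE//; exact: partial_dotv.
rewrite (@diff_comp _ _ _ _ _ (flat q))//= e.
rewrite deriv1E; last exact/derivable1_diffP.
by rewrite derive1E (derive_val (is_derive := is_derive_flat _ _)).
Qed.

Lemma elementary_differentiable f : elementary f -> forall x, differentiable f x.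
Proof.
elim=> {f} [c|i|q l c|f g _ df _ dg|f g _ df _ dg] x.
- exact: differentiable_cst.
- exact: differentiable_coord.
- apply: (@differentiable_comp _ _ _ _ _ (flat q)); first exact: differentiable_dotv.
  exact: differentiable_flat.
- exact: differentiableD.
- exact: differentiableM.
Qed.

Lemma elementary_partial f i : elementary f -> elementary (partial i f).
Proof.
elim=> {f} [c|j|q l c|f g ef df eg dg|f g ef df eg dg].
- rewrite (_ : partial i _ = fun=> 0); first exact: elementary_cst.
  by apply/funext => x; rewrite partial_cst.
- rewrite (_ : partial i _ = fun=> (j == i)%:R); first exact: elementary_cst.
  by apply/funext => x; rewrite partial_coord.
- rewrite (_ : partial i _ = fun x => l ord0 i * flat (dflat q) (dotv l x + c)).
    by apply: elementaryM; [exact: elementary_cst|exact: elementary_flat].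
  by apply/funext => x; rewrite partial_flat.
- rewrite (_ : partial i _ = fun x => partial i f x + partial i g x).
    exact: elementaryD.
  by apply/funext => x; rewrite partialD//; exact: elementary_differentiable.
- rewrite (_ : partial i _ = fun x => f x * partial i g x + g x * partial i f x).
    by apply: elementaryD; exact: elementaryM.
  by apply/funext => x; rewrite partialM//; exact: elementary_differentiable.
Qed.

Lemma elementary_smooth f : elementary f -> smooth f.
Proof.
move=> ef s; suff : elementary (foldr (@partial R d) f s) by exact: elementary_differentiable.
by elim: s => //= i s; exact: elementary_partial.
Qed.

Lemma elementary_continuous f : elementary f -> continuous f.
Proof. by move=> ef x; exact/differentiable_continuous/elementary_differentiable. Qed.

Lemma elementary_sum (I : Type) (s : seq I) (P : pred I) (F : I -> 'rV[R]_d -> R) :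
  (forall i, elementary (F i)) -> elementary (fun x => \sum_(i <- s | P i) F i x).
Proof.
move=> eF; elim: s => [|i s ih].
  by under eq_fun do rewrite big_nil; exact: elementary_cst.
under eq_fun do rewrite big_cons; case: (P i) => //.
exact: elementaryD.
Qed.

Lemma elementary_prod (I : Type) (s : seq I) (P : pred I) (F : I -> 'rV[R]_d -> R) :
  (forall i, elementary (F i)) -> elementary (fun x => \prod_(i <- s | P i) F i x).
Proof.
move=> eF; elim: s => [|i s ih].
  by under eq_fun do rewrite big_nil; exact: elementary_cst.
under eq_fun do rewrite big_cons; case: (P i) => //.
exact: elementaryM.
Qed.

Lemma elementaryX f n : elementary f -> elementary (fun x => f x ^+ n).
Proof.
move=> ef; elim: n => [|n ih]; first exact: elementary_cst.
by under eq_fun do rewrite exprS; exact: elementaryM.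
Qed.

Lemma elementaryN f : elementary f -> elementary (fun x => - f x).
Proof.
move=> ef; rewrite (_ : (fun _ => _) = fun x => -1 * f x).
  by apply: elementaryM => //; exact: elementary_cst.
by apply/funext => x; rewrite mulN1r.
Qed.

Lemma elementaryB f g : elementary f -> elementary g -> elementary (fun x => f x - g x).
Proof. by move=> ef eg; apply: elementaryD => //; exact: elementaryN. Qed.

Lemma Pk_elementary k f : Pk k f -> elementary f.
Proof.
move=> [c /funext ->].
apply: elementary_sum => m; apply: elementaryM; first exact: elementary_cst.
by apply: elementary_prod => i; apply: elementaryX; exact: elementary_coord.
Qed.

Lemma elementary_dotv (f g : 'rV[R]_d -> 'rV[R]_d) :
  (forall i, elementary (fun x => f x ord0 i)) ->
  (forall i, elementary (fun x => g x ord0 i)) ->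
  elementary (fun x => dotv (f x) (g x)).
Proof. by move=> ef eg; apply: elementary_sum => i; exact: elementaryM. Qed.

Lemma elementary_grad f i : elementary f -> elementary (fun x => grad f x ord0 i).
Proof. by move=> ef; under eq_fun do rewrite mxE; exact: elementary_partial. Qed.

Lemma PkB k f g : Pk k f -> Pk k g -> Pk k (fun x => f x - g x).
Proof.
move=> [c fE] [b gE]; exists (fun m => c m - b m) => x; rewrite fE gE -sumrB.
by apply: eq_bigr => m _; rewrite mulrBl.
Qed.

Lemma Pk_cst k (a : R) : Pk k (fun _ : 'rV[R]_d => a).
Proof.
exists (fun m => if m == [ffun=> ord0] then a else 0) => x.
rewrite (bigD1 [ffun=> ord0])/=; last by rewrite big1// => i _; rewrite ffunE.
rewrite eqxx big1 ?mulr1; last by move=> i _; rewrite ffunE expr0.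
by rewrite big1 ?addr0// => m /andP[_ /negbTE ->]; rewrite mul0r.
Qed.

End elementary_functions.

(** * Integrals and square integrable fields *)

Section integration.
Context {R : realType} {d : nat}.
Notation mu := (@lebesgue_rV R d).
Implicit Types (f g : 'rV[R]_d -> R) (D : set 'rV[R]_d).
Notation intble D f := (mu.-integrable D (EFin \o f)).

Lemma intble_le D f g : measurable D -> measurable_fun D f ->
  (forall x, D x -> `|f x| <= g x) -> intble D g -> intble D f.
Proof.
move=> mD mf fg; apply: le_integrable => //; first exact/measurable_EFinP.
move=> x Dx /=; rewrite lee_fin; apply: le_trans (fg _ Dx) _; exact: ler_norm.
Qed.

Lemma intbleD D f g : measurable D -> intble D f -> intble D g ->
  intble D (fun x => f x + g x).
Proof.
move=> mD fi gi; apply: (@eq_integrable _ _ _ mu D mD ((EFin \o f) \+ (EFin \o g))%E) => //.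
exact: integrableD.
Qed.

Lemma intbleB D f g : measurable D -> intble D f -> intble D g ->
  intble D (fun x => f x - g x).
Proof.
move=> mD fi gi; apply: (@eq_integrable _ _ _ mu D mD ((EFin \o f) \- (EFin \o g))%E) => //.
exact: integrableB.
Qed.

Lemma intbleZ D f c : measurable D -> intble D f -> intble D (fun x => c * f x).
Proof.
move=> mD fi; apply: (@eq_integrable _ _ _ mu D mD (fun x => c%:E * (f x)%:E)%E) => //.
exact: integrableZl.
Qed.

Lemma intble_sum D (I : Type) (s : seq I) (F : I -> 'rV[R]_d -> R) : measurable D ->
  (forall i, intble D (F i)) -> intble D (fun x => \sum_(i <- s) F i x).
Proof.
move=> mD iF; apply: (@eq_integrable _ _ _ mu D mD (fun x => \sum_(i <- s) (F i x)%:E)%E).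
  by move=> x _ /=; rewrite sumEFin.
by apply: integrable_sum => // i _; exact: iF.
Qed.

Lemma Rintegral_sum D (I : Type) (s : seq I) (F : I -> 'rV[R]_d -> R) : measurable D ->
  (forall i, intble D (F i)) ->
  \int[mu]_(x in D) (\sum_(i <- s) F i x) = \sum_(i <- s) \int[mu]_(x in D) F i x.
Proof.
move=> mD iF; elim: s => [|i s ih].
  rewrite big_nil; under eq_Rintegral do rewrite big_nil.
  by rewrite Rintegral_cst// mul0r.
rewrite big_cons; under eq_Rintegral do rewrite big_cons.
by rewrite RintegralD// ?ih//; exact: intble_sum.
Qed.

Lemma intble_bounded D f M : measurable D -> (mu D < +oo)%E -> measurable_fun D f ->
  (forall x, D x -> `|f x| <= M) -> intble D f.
Proof.
move=> mD Doo mf fM; apply: (@intble_le _ _ (cst M)) => //.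
apply/integrableP; split; first exact/measurable_EFinP.
under eq_integral do rewrite /=.
by rewrite integral_cst// lte_mul_pinfty.
Qed.

Lemma Rintegral_ae D f g : measurable D -> intble D f -> measurable_fun D g ->
  ae_eq mu D f g -> \int[mu]_(x in D) f x = \int[mu]_(x in D) g x.
Proof.
move=> mD fi mg fg; rewrite /Rintegral; congr fine; apply: ae_eq_integral => //.
- exact: measurable_int fi.
- exact/measurable_EFinP.
- by apply: filterS fg => x /= h Dx; rewrite h.
Qed.

Lemma intble_affine (A : 'M[R]_d) b f : A \in unitmx ->
  intble setT f -> intble setT (fun x => f (b + x *m A)).
Proof.
move=> uA /integrableP[mf fi]; apply/integrableP; split.
  by apply: (measurableT_comp mf); exact: measurable_affine.
move: fi; rewrite (ge0_integral_affine b uA)//; last exact: measurableT_comp.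
rewrite !ltey; apply: contra => /eqP ->.
by rewrite gt0_muley// lte_fin normr_gt0 -unitfE -unitmxE.
Qed.

(** The nonnegative case is applied to the positive and negative parts; integrability makes their
    integrals finite, so that [fine] commutes with the difference and the product. *)
Lemma Rintegral_affine (A : 'M[R]_d) b f : A \in unitmx -> intble setT f ->
  \int[mu]_x f x = `|\det A| * \int[mu]_x f (b + x *m A).
Proof.
move=> uA fi; have gi := intble_affine b uA fi.
have mf : measurable_fun setT (EFin \o f) by exact: measurable_int fi.
have h1 := integrable_pos_fin_num measurableT fi.
have h2 := integrable_neg_fin_num measurableT fi.
have h3 := integrable_pos_fin_num measurableT gi.
have h4 := integrable_neg_fin_num measurableT gi.
rewrite /Rintegral integralE [in RHS]integralE (fineB h1 h2) (fineB h3 h4).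
rewrite mulrBr; congr (_ - _).
- have hp : (\int[mu]_x (EFin \o f)^\+ (b + x *m A)%R =
      \int[mu]_x (EFin \o (fun x => f (b + x *m A)%R))^\+ x)%E.
    by apply: eq_integral => x _; rewrite !funeposE.
  have := ge0_integral_affine b uA (measurable_funepos mf) (fun x => funepos_ge0 _ x).
  rewrite hp => e; apply: etrans (congr1 fine e) _.
  exact: (@fineM _ `|\det A|%:E _ isT h3).
- have hp : (\int[mu]_x (EFin \o f)^\- (b + x *m A)%R =
      \int[mu]_x (EFin \o (fun x => f (b + x *m A)%R))^\- x)%E.
    by apply: eq_integral => x _; rewrite !funenegE.
  have := ge0_integral_affine b uA (measurable_funeneg mf) (fun x => funeneg_ge0 _ x).
  rewrite hp => e; apply: etrans (congr1 fine e) _.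
  exact: (@fineM _ `|\det A|%:E _ isT h4).
Qed.

Lemma Rintegral_translate b f : intble setT f ->
  \int[mu]_x f (x + b) = \int[mu]_x f x.
Proof.
move=> fi; rewrite (Rintegral_affine b (unitmx1 _ _) fi) det1 normr1 mul1r.
by apply: eq_Rintegral => x _; rewrite mulmx1 addrC.
Qed.

Lemma intble_translate b f : intble setT f -> intble setT (fun x => f (x + b)).
Proof.
move=> fi; have := intble_affine b (unitmx1 _ _) fi.
by apply: eq_integrable => // x _ /=; rewrite mulmx1 addrC.
Qed.

End integration.

Section square_integrable.
Context {R : realType} {d : nat}.
Notation mu := (@lebesgue_rV R d).
Implicit Types (f g : 'rV[R]_d -> R) (D : set 'rV[R]_d).
Implicit Types (s t : 'rV[R]_d -> 'rV[R]_d).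
Notation intble D f := (mu.-integrable D (EFin \o f)).

(** The common core of the Cauchy-Schwarz inequalities for vectors, functions and fields: [a] and
    [b] are the squared norms, [c] the inner product. *)
Lemma discriminant_le (a b c : R) : 0 <= a -> 0 <= b ->
  (forall r : R, 0 <= a - 2 * r * c + r ^+ 2 * b) -> c <= Num.sqrt a * Num.sqrt b.
Proof.
move=> a0 b0 h; have [c0|c0] := leP c 0.
  by apply: (le_trans c0); rewrite mulr_ge0.
rewrite -sqrtrM// -[leLHS](gtr0_norm c0) -sqrtr_sqr; apply: ler_wsqrtr.
have [b1|b1] := eqVneq b 0.
  (* When [b] vanishes the quadratic is affine in [r]; this choice gives it the value -1. *)
  have := h ((a + 1) / (2 * c)); rewrite b1 mulr0 addr0.
  rewrite (_ : 2 * _ * c = a + 1); first by lra.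
  by field; rewrite gt_eqF.
have bp : 0 < b by rewrite lt_neqAle eq_sym b1.
have := h (c / b); rewrite (_ : _ + _ = (a * b - c ^+ 2) / b); last by field.
by rewrite pmulr_lge0 ?invr_gt0// subr_ge0.
Qed.

Lemma L2_intbleM D f g : measurable D -> L2 D f -> L2 D g ->
  intble D (fun x => f x * g x).
Proof.
move=> mD [mf fi] [mg gi].
apply: (@intble_le _ _ _ _ (fun x => f x ^+ 2 + g x ^+ 2)) => //.
- exact: measurable_funM.
- move=> x _; have h1 := sqr_ge0 (f x - g x); have h2 := sqr_ge0 (f x + g x).
  by rewrite ler_norml; apply/andP; split; nra.
- exact: intbleD.
Qed.

Lemma L2Z D f c : measurable D -> L2 D f -> L2 D (fun x => c * f x).
Proof.
move=> mD [mf fi]; split; first exact: measurable_funM.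
have := intbleZ (c ^+ 2) mD fi; apply: eq_integrable => // x _ /=.
by rewrite exprMn.
Qed.

Lemma L2D D f g : measurable D -> L2 D f -> L2 D g -> L2 D (fun x => f x + g x).
Proof.
move=> mD lf lg; have [[mf fi] [mg gi]] := (lf, lg).
split; first exact: measurable_funD.
have := intbleD mD (intbleD mD fi gi) (intbleZ 2 mD (L2_intbleM mD lf lg)).
by apply: eq_integrable => // x _ /=; congr _%:E; ring.
Qed.

Lemma L2B D f g : measurable D -> L2 D f -> L2 D g -> L2 D (fun x => f x - g x).
Proof.
move=> mD lf lg; have := L2D mD lf (L2Z (-1) mD lg).
by under [in X in X -> _]eq_fun do rewrite mulN1r.
Qed.

Lemma L2S D E f : measurable D -> measurable E -> E `<=` D -> L2 D f -> L2 E f.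
Proof.
move=> mD mE ED [mf fi]; split; first exact: measurable_funS mf.
exact: integrableS fi.
Qed.

Lemma L2vS D E s : measurable D -> measurable E -> E `<=` D -> L2v D s -> L2v E s.
Proof. by move=> mD mE ED ls i; exact: L2S (ls i). Qed.

Lemma L2vB D s t : measurable D -> L2v D s -> L2v D t -> L2v D (fun x => s x - t x).
Proof.
move=> mD ls lt i; under eq_fun do rewrite !mxE.
exact: L2B.
Qed.

Lemma L2vZ D s c : measurable D -> L2v D s -> L2v D (fun x => c *: s x).
Proof.
by move=> mD ls i; under eq_fun do rewrite mxE; exact: L2Z.
Qed.

Lemma L2_bounded D f M : measurable D -> (mu D < +oo)%E -> measurable_fun D f ->
  (forall x, D x -> `|f x| <= M) -> L2 D f.
Proof.
move=> mD Doo mf fM; split => //; apply: (@intble_bounded _ _ _ _ (M ^+ 2)) => //.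
  exact: measurable_funX.
move=> x Dx; rewrite normrX ler_sqr ?nnegrE//; first exact: fM.
exact: le_trans (fM _ Dx).
Qed.

Lemma L2_intble D f : measurable D -> (mu D < +oo)%E -> L2 D f -> intble D f.
Proof.
move=> mD Doo lf.
have l1 : L2 D (cst 1) by apply: (@L2_bounded _ _ 1) => //= x _; rewrite normr1.
have := L2_intbleM mD lf l1; apply: eq_integrable => // x _ /=.
by rewrite mulr1.
Qed.

Lemma intble_dotv D s t : measurable D -> L2v D s -> L2v D t ->
  intble D (fun x => dotv (s x) (t x)).
Proof. by move=> mD ls lt; apply: intble_sum => // i; exact: L2_intbleM. Qed.

Lemma dotvC (x y : 'rV[R]_d) : dotv x y = dotv y x.
Proof. by apply: eq_bigr => i _; rewrite mulrC. Qed.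

Lemma dotvBl (x y z : 'rV[R]_d) : dotv (x - y) z = dotv x z - dotv y z.
Proof. by rewrite /dotv -sumrB; apply: eq_bigr => i _; rewrite !mxE mulrBl. Qed.

Lemma dotvDl (x y z : 'rV[R]_d) : dotv (x + y) z = dotv x z + dotv y z.
Proof. by rewrite /dotv -big_split; apply: eq_bigr => i _; rewrite !mxE mulrDl. Qed.

Lemma dotvZl c (x z : 'rV[R]_d) : dotv (c *: x) z = c * dotv x z.
Proof. by rewrite /dotv mulr_sumr; apply: eq_bigr => i _; rewrite !mxE mulrA. Qed.

Lemma dotvBr (x y z : 'rV[R]_d) : dotv z (x - y) = dotv z x - dotv z y.
Proof. by rewrite dotvC dotvBl !(dotvC z). Qed.

Lemma dotvDr (x y z : 'rV[R]_d) : dotv z (x + y) = dotv z x + dotv z y.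
Proof. by rewrite dotvC dotvDl !(dotvC z). Qed.

Lemma dotvZr c (x z : 'rV[R]_d) : dotv z (c *: x) = c * dotv z x.
Proof. by rewrite dotvC dotvZl (dotvC z). Qed.

Lemma dotv_ge0 (x : 'rV[R]_d) : 0 <= dotv x x.
Proof. by apply: sumr_ge0 => i _; rewrite -expr2 sqr_ge0. Qed.

Lemma innervC D s t : innerv D s t = innerv D t s.
Proof. by apply: eq_Rintegral => x _; rewrite dotvC. Qed.

Lemma innervBl D s t r : measurable D -> L2v D s -> L2v D t -> L2v D r ->
  innerv D (fun x => s x - t x) r = innerv D s r - innerv D t r.
Proof.
move=> mD ls lt lr; rewrite /innerv -RintegralB//; try exact: intble_dotv.
by apply: eq_Rintegral => x _; rewrite dotvBl.
Qed.

Lemma innervZl D s t c : measurable D -> L2v D s -> L2v D t ->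
  innerv D (fun x => c *: s x) t = c * innerv D s t.
Proof.
move=> mD ls lt; rewrite /innerv -RintegralZl//; try exact: intble_dotv.
by apply: eq_Rintegral => x _; rewrite dotvZl.
Qed.

Lemma innervBr D s t r : measurable D -> L2v D s -> L2v D t -> L2v D r ->
  innerv D r (fun x => s x - t x) = innerv D r s - innerv D r t.
Proof. by move=> *; rewrite innervC innervBl// !(innervC D r). Qed.

Lemma innervZr D s t c : measurable D -> L2v D s -> L2v D t ->
  innerv D t (fun x => c *: s x) = c * innerv D t s.
Proof. by move=> *; rewrite innervC innervZl// (innervC D t). Qed.

Lemma innervv_ge0 D s : 0 <= innerv D s s.
Proof. by apply: Rintegral_ge0 => x _; exact: dotv_ge0. Qed.

Lemma sqr_norm0v D s : norm0v D s ^+ 2 = innerv D s s.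
Proof. by rewrite sqr_sqrtr// innervv_ge0. Qed.

Lemma innerv_le D s t : measurable D -> L2v D s -> L2v D t ->
  innerv D s t <= norm0v D s * norm0v D t.
Proof.
move=> mD ls lt; apply: discriminant_le; try exact: innervv_ge0.
move=> r; have lr := L2vZ r mD lt.
have : 0 <= innerv D (fun x => s x - r *: t x) (fun x => s x - r *: t x).
  exact: innervv_ge0.
rewrite innervBl//; last exact: L2vB.
rewrite innervZl//; last exact: L2vB.
rewrite !innervBr// !innervZr//.
by rewrite (innervC _ t s); congr (0 <= _); ring.
Qed.

Lemma inner_le D f g : measurable D -> L2 D f -> L2 D g ->
  inner D f g <= norm0 D f * norm0 D g.
Proof.
move=> mD lf lg; apply: discriminant_le.
- by apply: Rintegral_ge0 => x _; rewrite -expr2 sqr_ge0.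
- by apply: Rintegral_ge0 => x _; rewrite -expr2 sqr_ge0.
move=> r; have iff := L2_intbleM mD lf lf; have igg := L2_intbleM mD lg lg.
have ifg := L2_intbleM mD lf lg.
rewrite /inner -RintegralZl// -RintegralB//; last exact: intbleZ.
rewrite -RintegralZl// -RintegralD//; last exact: intbleZ; last first.
  by apply: intbleB => //; exact: intbleZ.
apply: Rintegral_ge0 => x _.
by rewrite (_ : _ + _ = (f x - r * g x) ^+ 2) ?sqr_ge0//; ring.
Qed.

Lemma norm0v_triangle D s t r : measurable D -> L2v D s -> L2v D t -> L2v D r ->
  norm0v D (fun x => s x - r x) <=
  norm0v D (fun x => s x - t x) + norm0v D (fun x => t x - r x).
Proof.
move=> mD ls lt lr.
have l1 := L2vB mD ls lt; have l2 := L2vB mD lt lr; have l3 := L2vB mD ls lr.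
have n1 : 0 <= norm0v D (fun x => s x - t x) by exact: sqrtr_ge0.
have n2 : 0 <= norm0v D (fun x => t x - r x) by exact: sqrtr_ge0.
rewrite -ler_sqr ?nnegrE ?sqrtr_ge0 ?addr_ge0// sqrrD !sqr_norm0v.
have h := innerv_le mD l1 l2.
suff -> : innerv D (fun x => s x - r x) (fun x => s x - r x) =
    innerv D (fun x => s x - t x) (fun x => s x - t x) +
    2 * innerv D (fun x => s x - t x) (fun x => t x - r x) +
    innerv D (fun x => t x - r x) (fun x => t x - r x) by lra.
rewrite /innerv -RintegralZl//; last exact: intble_dotv.
rewrite -RintegralD//; try exact: intble_dotv; last first.
  by apply: intbleZ => //; exact: intble_dotv.
rewrite -RintegralD//; try exact: intble_dotv; last first.
  by apply: intbleD => //; try exact: intble_dotv; apply: intbleZ => //; exact: intble_dotv.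
apply: eq_Rintegral => x _.
rewrite (_ : s x - r x = (s x - t x) + (t x - r x)); last by rewrite addrA subrK.
move: (s x - t x) (t x - r x) => p q.
by rewrite dotvDl !dotvDr [dotv q p]dotvC; ring.
Qed.

End square_integrable.

(** * Integration by parts against compactly supported functions *)

Section compact_support.
Context {R : realType} {d : nat}.
Notation mu := (@lebesgue_rV R d).
Implicit Types (f g : 'rV[R]_d -> R) (D : set 'rV[R]_d).
Notation intble D f := (mu.-integrable D (EFin \o f)).

Lemma dominated_convergence_Rintegral D (F : nat -> 'rV[R]_d -> R) f g : measurable D ->
  (forall n, measurable_fun D (F n)) -> measurable_fun D f ->
  (\forall x \ae mu, D x -> F n x @[n --> \oo] --> f x) ->
  (forall n x, D x -> `|F n x| <= g x) -> intble D g ->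
  \int[mu]_(x in D) F n x @[n --> \oo] --> \int[mu]_(x in D) f x.
Proof.
move=> mD mF mf cF Fg ig.
have mF' n : measurable_fun D (EFin \o F n) by exact/measurable_EFinP.
have mf' : measurable_fun D (EFin \o f) by exact/measurable_EFinP.
have cF' : \forall x \ae mu, D x -> (F n x)%:E @[n --> \oo] --> (f x)%:E.
  by apply: filterS cF => x h Dx; apply: cvg_EFin; [exact: nearW|exact: h].
have Fg' : \forall x \ae mu, forall n, D x -> (`|(F n x)%:E| <= (g x)%:E)%E.
  by apply: aeW => x n Dx; rewrite lee_fin; exact: Fg.
have [fi _ c] := dominated_convergence mD mF' mf' cF' ig Fg'.
apply: fine_cvg; rewrite fineK//; exact: (integrable_fin_num mD fi).
Qed.

Lemma bounded_set_norm_le (V : normedModType R) (A : set V) : bounded_set A ->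
  exists2 M, 0 <= M & forall x, A x -> `|x| <= M.
Proof.
move=> [M [_ hM]]; exists (`|M| + 1) => [|x Ax]; first by rewrite addr_ge0.
by apply: hM => //; rewrite (le_lt_trans (ler_norm M))// ltrDl.
Qed.

Lemma norm_le_bounded (V : normedModType R) (A : set V) M :
  (forall x, A x -> `|x| <= M) -> bounded_set A.
Proof.
move=> h; exists M; split; first exact: num_real.
by move=> N MN x Ax; apply: le_trans (h _ Ax) (ltW MN).
Qed.

Lemma continuous_bounded f D : continuous f -> bounded_set D ->
  exists2 M, 0 <= M & forall x, D x -> `|f x| <= M.
Proof.
move=> cf /bounded_set_norm_le[M M0 hM].
have M1 : 0 < M + 1 by rewrite ltr_wpDl.
have kE x : closed_ball (0 : 'rV[R]_d) (M + 1) x <-> `|x| <= M + 1.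
  by rewrite closed_ballE// /closed_ball_/= sub0r normrN.
have cK : compact (closed_ball (0 : 'rV[R]_d) (M + 1)).
  apply: bounded_closed_compact; last exact: closed_ball_closed.
  by apply: (@norm_le_bounded _ _ (M + 1)) => x /kE.
have /compact_bounded/bounded_set_norm_le[N N0 hN] :
    compact (f @` closed_ball (0 : 'rV[R]_d) (M + 1)).
  by apply: continuous_compact => //; exact: continuous_subspaceT.
exists N => // x Dx; apply: hN; exists x => //; apply/kE.
by apply: (le_trans (hM _ Dx)); rewrite lerDl.
Qed.

Lemma continuous_L2 f D : continuous f -> measurable D -> bounded_set D -> L2 D f.
Proof.
move=> cf mD bD; have [M M0 hM] := continuous_bounded cf bD.
apply: (@L2_bounded _ _ _ _ M) => //; first exact: bounded_measure_fin.
by apply: measurable_funTS; exact: continuous_rV_measurable.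
Qed.

Lemma continuous_intble f D : continuous f -> measurable D -> bounded_set D ->
  intble D f.
Proof.
move=> cf mD bD; apply: L2_intble => //; last exact: continuous_L2.
exact: bounded_measure_fin.
Qed.

Lemma partial0_notin (f : 'rV[R]_d -> R) (A : set 'rV[R]_d) i x : closed A ->
  (forall x, ~ A x -> f x = 0) -> ~ A x -> partial i f x = 0.
Proof.
move=> cA fA nAx; rewrite /partial.
have : \forall y \near x, f y = cst 0 y.
  have : nbhs x (~` A) by apply: open_nbhs_nbhs; split => //; exact: closed_openC.
  by apply: filterS => y; exact: fA.
by move=> /near_eq_derive ->; rewrite derive_cst.
Qed.

Lemma is_derive_line f (x e : 'rV[R]_d) (t : R) : differentiable f (x + t *: e) ->
  is_derive t 1 (fun t => f (x + t *: e)) ('D_e f (x + t *: e)).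
Proof.
move=> df.
have eqf : (fun h : R => h^-1 *: (((fun t => f (x + t *: e)) \o shift t) (h *: 1) -
      f (x + t *: e))) =
    (fun h : R => h^-1 *: ((f \o shift (x + t *: e)) (h *: e) - f (x + t *: e))).
  apply/funext => h /=; rewrite -[_ *: 1]/(h * 1) mulr1 scalerDl.
  by rewrite [in LHS]addrCA.
have := @diff_derivable _ _ _ _ _ e df; rewrite /derivable => de.
by apply: DeriveDef; [rewrite /derivable eqf|rewrite /derive eqf].
Qed.

(** The mean value theorem on the segment; it provides a bound of the difference quotients that is
    uniform in [h], for dominated convergence. *)
Lemma difference_quotient_le f i (x : 'rV[R]_d) (h M : R) : (forall x, differentiable f x) ->
  (forall x, `|partial i f x| <= M) -> 0 < h ->
  `|f (x + h *: delta_mx ord0 i) - f x| <= M * h.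
Proof.
move=> df fM h0; set e := delta_mx _ _.
have dg (t : R) : is_derive t 1 (fun t : R => f (x + t *: e)) (partial i f (x + t *: e)).
  exact: is_derive_line.
have [|c _] := @MVT _ (fun t : R => f (x + t *: e)) _ 0 h h0 (fun t _ => dg t).
  apply: continuous_subspaceT => t; apply: differentiable_continuous.
  by apply/derivable1_diffP; exact: (ex_derive (is_derive := dg t)).
rewrite scale0r addr0 subr0 => ->.
by rewrite normrM (gtr0_norm h0) ler_wpM2r// ltW.
Qed.

(* Translation invariance kills the integral of every difference quotient. *)
Lemma integral_partial_eq0 f i (A : set 'rV[R]_d) : (forall x, differentiable f x) ->
  continuous (partial i f) -> compact A -> (forall x, ~ A x -> f x = 0) ->
  \int[mu]_x partial i f x = 0.
Proof.
move=> df cpf cA fA.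
have clA : closed A by apply: compact_closed => //; exact: norm_hausdorff.
have bA := compact_bounded cA.
have mA : measurable A.
  by rewrite -[A]setCK; apply: measurableC; apply: open_rV_measurable; exact: closed_openC.
have cf : continuous f by move=> x; exact: differentiable_continuous.
have mf := continuous_rV_measurable cf.
have [M M0 hM] := continuous_bounded cpf bA.
have {}hM x : `|partial i f x| <= M.
  have [Ax|nAx] := pselect (A x); first exact: hM.
  by rewrite (@partial0_notin _ A)// normr0.
have [N N0 hN] := bounded_set_norm_le bA.
(* The steps [h n] are at most 1, so every difference quotient vanishes outside [B], and [M] times
   the indicator of [B] dominates them all. *)
pose B := box (0 : 'rV[R]_d) (N + 2).
have mB : measurable B by exact: measurable_box.
have Boo : (mu B < +oo)%E.
  apply: bounded_measure_fin => //; apply: (@norm_le_bounded _ _ (N + 2)) => x /boxE h.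
  apply: norm_le_coord => [|j]; first by rewrite addr_ge0.
  by have := h j; rewrite mxE subr0 => /ltW.
pose e : 'rV[R]_d := delta_mx ord0 i.
pose h (n : nat) : R := n.+1%:R^-1.
have h0 n : 0 < h n by rewrite invr_gt0.
have h1 n : h n <= 1 by rewrite invf_le1// ler1n.
pose F n x := (h n)^-1 * (f (x + h n *: e) - f x).
have if_ : intble setT f.
  have : intble A f by exact: continuous_intble.
  rewrite (integrable_mkcond _ mA); apply: eq_integrable => // x _.
  rewrite patchE; case: ifPn => //= /negP nA; rewrite (fA _ (fun h => nA (mem_set h))).
  by [].
have iF n : \int[mu]_x F n x = 0.
  rewrite /F RintegralZl//; last by apply: intbleB => //; exact: intble_translate.
  by rewrite RintegralB// ?Rintegral_translate ?subrr ?mulr0//; exact: intble_translate.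
have mF n : measurable_fun setT (EFin \o F n).
  apply/measurable_EFinP; apply: measurable_funM => //; apply: measurable_funB => //.
  apply: measurableT_comp => //.
  have := measurable_affine (h n *: e) (1%:M : 'M[R]_d).
  by under eq_fun do rewrite mulmx1 addrC.
have FB n x : `|F n x| <= M * \1_B x.
  rewrite indicE; have [Bx|nBx] := boolP (x \in B).
    rewrite mulr1 /F normrM gtr0_norm ?invr_gt0// mulrC ler_pdivrMr//.
    exact: difference_quotient_le.
  rewrite mulr0 /F (fA x) ?(fA (x + _)) ?subr0 ?mulr0 ?normr0// => Ax;
    move: nBx; rewrite notin_setE; apply; apply/boxE => j; rewrite mxE subr0.
  - have := le_trans (coord_le_norm (x + h n *: e) j) (hN _ Ax); rewrite !mxE.
    have : `|h n * ((0 == 0 :> 'I_1) && (j == i))%:R| <= 1 :> R.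
      rewrite normrM (gtr0_norm (h0 n)) [X in _ * X]ger0_norm ?ler0n// eqxx.
      by case: (j == i); rewrite ?mulr1 ?mulr0// ler01.
    set c := _ * _; rewrite !ler_norml ltr_norml => /andP[? ?] /andP[? ?].
    by apply/andP; split; lra.
  - by have := coord_le_norm x j; have := hN _ Ax; lra.
have cvF x : F n x @[n --> \oo] --> partial i f x.
  have c : k^-1 *: ((f \o shift x) (k *: e) - f x) @[k --> (0 : R)^'] --> partial i f x.
    exact: (@diff_derivable _ _ _ _ _ e (df x)).
  have hn0 : (forall n, h n != 0) /\ h n @[n --> \oo] --> (0 : R).
    by split => [n|]; [rewrite gt_eqF|exact: cvg_harmonic].
  have hc := (proj1 (cvgr_dnbhsP _ _ _) c) h hn0.
  rewrite (_ : (fun n => F n x) =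
      (fun n => (h n)^-1 *: ((f \o shift x) (h n *: e) - f x)))//.
  by apply/funext => n; rewrite /F /= [x + _]addrC.
have h4 : \int[mu]_x F n x @[n --> \oo] --> (0 : R).
  by under eq_fun do rewrite iF; exact: cvg_cst.
rewrite -(cvg_lim (@norm_hausdorff _ _) h4); apply/esym/cvg_lim => //.
apply: (@dominated_convergence_Rintegral _ _ _ (fun x => M * \1_B x)) => //.
- by move=> n; have /measurable_EFinP := mF n.
- exact: continuous_rV_measurable.
- by apply: aeW => x _; exact: cvF.
- apply: intbleZ => //.
  have : intble B (cst 1) by apply: (@intble_bounded _ _ _ _ 1) => //= x _; rewrite normr1.
  rewrite (integrable_mkcond _ mB); apply: eq_integrable => // x _.
  by rewrite patchE /= indicE; case: ifPn.
Qed.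

(** The product [f * g] inherits the compact support of [f], so its partial derivative has integral
    zero; the Leibniz rule splits it. *)
Lemma integration_by_parts f g i (A : set 'rV[R]_d) : (forall x, differentiable f x) ->
  (forall x, differentiable g x) -> continuous (partial i f) -> continuous (partial i g) ->
  compact A -> (forall x, ~ A x -> f x = 0) ->
  \int[mu]_x (f x * partial i g x) = - \int[mu]_x (partial i f x * g x).
Proof.
move=> df dg cpf cpg cA fA.
have clA : closed A by apply: compact_closed => //; exact: norm_hausdorff.
have cf : continuous f by move=> x; exact: differentiable_continuous.
have cg : continuous g by move=> x; exact: differentiable_continuous.
have ci (h : 'rV[R]_d -> R) : continuous h -> (forall x, ~ A x -> h x = 0) -> intble setT h.
  have mA : measurable A.
    by rewrite -[A]setCK; apply: measurableC; apply: open_rV_measurable; exact: closed_openC.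
  move=> ch hA; have : intble A h by exact: continuous_intble (compact_bounded cA).
  rewrite (integrable_mkcond _ mA); apply: eq_integrable => // x _.
  rewrite patchE; case: ifPn => //= /negP nA; rewrite (hA _ (fun h => nA (mem_set h))).
  by [].
have c1 : continuous (fun x => f x * partial i g x).
  by move=> x; exact: (cvgM (cf x) (cpg x)).
have c2 : continuous (fun x => partial i f x * g x).
  by move=> x; exact: (cvgM (cpf x) (cg x)).
have := @integral_partial_eq0 (fun x => f x * g x) i A.
have -> : partial i (fun x => f x * g x) =
    fun x => f x * partial i g x + partial i f x * g x.
  by apply/funext => x; rewrite partialM// [g x * _]mulrC.
rewrite RintegralD//; last 2 first.
- by apply: ci => // x nAx; rewrite fA// mul0r.
- by apply: ci => // x nAx; rewrite (partial0_notin i clA fA nAx) mul0r.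
move=> h; apply/eqP; rewrite -addr_eq0; apply/eqP; apply: h => //.
- by move=> x; exact: differentiableM.
- by move=> x; exact: (cvgD (c1 x) (c2 x)).
- by move=> x nAx; rewrite fA// mul0r.
Qed.

End compact_support.

(** * Simplices and the divergence theorem *)

Section edge_matrix.
Context {R : realType}.

Definition edges m n (F : 'M[R]_(m.+1, n)) : 'M[R]_(m, n) :=
  \matrix_(i < m) (row (lift ord0 i) F - row ord0 F).

(** The difference operator from vertices to edges: by [edgesE], multiplying a vertex matrix by it
    on the left yields its edge matrix. *)
Definition edge_mx m : 'M[R]_(m, m.+1) := edges 1%:M.

(** Right inverse of [edge_mx], and inverse in the other order on rows of sum zero, whose first
    entry is determined by the others. *)
Definition drop_first m : 'M[R]_(m.+1, m) := \matrix_(i, j) (i == lift ord0 j)%:R.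

Lemma row_edges m n (F : 'M[R]_(m.+1, n)) i :
  row i (edges F) = row (lift ord0 i) F - row ord0 F.
Proof. exact: rowK. Qed.

Lemma edgesE m n (F : 'M[R]_(m.+1, n)) : edges F = edge_mx m *m F.
Proof.
apply/row_matrixP => i; rewrite row_mul !row_edges mulmxBl -!row_mul.
by rewrite !mul1mx.
Qed.

Lemma edge_mx_drop_first m : edge_mx m *m drop_first m = 1%:M.
Proof.
rewrite -edgesE; apply/matrixP => i j; rewrite !mxE.
by rewrite (inj_eq lift_inj) (negbTE (neq_lift _ _)) subr0.
Qed.

Lemma mul_drop_first k m (w : 'M[R]_(k, m.+1)) i j :
  (w *m drop_first m) i j = w i (lift ord0 j).
Proof.
rewrite mxE (bigD1 (lift ord0 j))//= mxE eqxx mulr1 big1 ?addr0// => l lj.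
by rewrite mxE (negbTE lj) mulr0.
Qed.

Lemma drop_first_edge_mx k m (w : 'M[R]_(k, m.+1)) :
  (forall i, \sum_j w i j = 0) -> w *m drop_first m *m edge_mx m = w.
Proof.
move=> w0; apply/matrixP => i j; rewrite mxE.
under eq_bigr do rewrite mul_drop_first !mxE mulrBr.
rewrite sumrB -mulr_suml.
have -> : \sum_(l < m) w i (lift ord0 l) = - w i ord0.
  by apply/eqP; rewrite -addr_eq0 addrC -(big_ord_recl _ (w i)) w0.
case: (unliftP ord0 j) => [j'|] ->.
  rewrite (bigD1 j')//= eqxx mulr1 big1 ?addr0 => [|l lj].
    by rewrite mulr0 subr0.
  by rewrite (inj_eq lift_inj) (negbTE lj) mulr0.
rewrite big1 => [|l _]; first by rewrite eqxx mulr1 sub0r opprK.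
by rewrite eq_sym (negbTE (neq_lift _ _)) mulr0.
Qed.

Lemma edge_mx_sum m i : \sum_j edge_mx m i j = 0.
Proof.
under eq_bigr do rewrite !mxE; rewrite sumrB.
rewrite (bigD1 (lift ord0 i))//= eqxx big1 ?addr0 => [|j]; last first.
  by rewrite eq_sym => /negbTE ->.
rewrite (bigD1 ord0)//= big1 ?addr0 ?subrr// => j.
by rewrite eq_sym => /negbTE ->.
Qed.

Lemma perm_mx_sum k m (w : 'M[R]_(k, m)) (s : {perm 'I_m}) i :
  \sum_j (w *m perm_mx s) i j = \sum_j w i j.
Proof.
have -> : w *m perm_mx s = col_perm s^-1%g w by rewrite col_permE invgK.
rewrite [RHS](reindex_inj (@perm_inj _ (s^-1)%g))/=.
by apply: eq_bigr => j _; rewrite mxE.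
Qed.

(** The action of a permutation of the vertices on the edge vectors; it is multiplicative in [s] by
    [edge_permM]. *)
Definition edge_perm m (s : {perm 'I_m.+1}) : 'M[R]_m :=
  edge_mx m *m perm_mx s *m drop_first m.

Lemma edge_permE m (s : {perm 'I_m.+1}) :
  edge_mx m *m perm_mx s = edge_perm s *m edge_mx m.
Proof.
rewrite /edge_perm drop_first_edge_mx// => i.
by rewrite perm_mx_sum edge_mx_sum.
Qed.

Lemma edges_row_perm m n (s : {perm 'I_m.+1}) (F : 'M[R]_(m.+1, n)) :
  edges (row_perm s F) = edge_perm s *m edges F.
Proof. by rewrite !edgesE row_permE mulmxA edge_permE mulmxA. Qed.

Lemma edge_permM m (s t : {perm 'I_m.+1}) : edge_perm (s * t)%g = edge_perm s *m edge_perm t.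
Proof.
rewrite {1}/edge_perm perm_mxM mulmxA edge_permE -!mulmxA.
by rewrite [edge_perm t in RHS]/edge_perm -!mulmxA.
Qed.

Lemma edge_perm1 m : edge_perm (1%g : {perm 'I_m.+1}) = 1%:M.
Proof. by rewrite /edge_perm perm_mx1 mulmx1 edge_mx_drop_first. Qed.

(** A permutation has finite order, so the determinant is a root of unity in an ordered field; its
    sign is never computed. *)
Lemma norm_det_edge_perm m (s : {perm 'I_m.+1}) : `|\det (edge_perm s)| = 1.
Proof.
have h n : \det (edge_perm (s ^+ n)%g) = \det (edge_perm s) ^+ n.
  by elim: n => [|n ih]; rewrite ?edge_perm1 ?det1// expgS edge_permM det_mulmx ih exprS.
have := h #[s]%g; rewrite expg_order edge_perm1 det1 => /(congr1 Num.norm).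
rewrite normrX normr1 => /esym/eqP; rewrite pexpr_eq1 ?order_gt0//.
by move=> /eqP.
Qed.

Lemma edge_perm_unitmx m (s : {perm 'I_m.+1}) : edge_perm s \in unitmx.
Proof.
rewrite unitmxE unitfE -normr_eq0 norm_det_edge_perm; exact: oner_neq0.
Qed.

(** If [u] annihilates the edges, then [u *m edge_mx d] annihilates the vertices, and also the
    column of ones because the rows of [edge_mx] have sum zero. *)
Lemma affinely_independent_edges d (S : 'M[R]_(d.+1, d)) :
  affinely_independent S -> edges S \in unitmx.
Proof.
rewrite /affinely_independent => fS; rewrite -row_free_unit -kermx_eq0.
apply/rowV0P => u /sub_kermxP; rewrite edgesE mulmxA => uS.
have : u *m edge_mx d *m row_mx S (const_mx 1 : 'M[R]_(d.+1, 1)) = 0.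
  rewrite mul_mx_row uS (_ : _ *m const_mx 1 = 0) ?row_mx0//.
  rewrite -mulmxA (_ : _ *m const_mx 1 = 0) ?mulmx0//.
  apply/matrixP => i j; rewrite !mxE -[RHS](edge_mx_sum i).
  by apply: eq_bigr => l _; rewrite !mxE mulr1.
move=> uS1; have : u *m edge_mx d = 0 by apply: (row_free_inj fS); rewrite mul0mx.
move=> /(congr1 (mulmx^~ (drop_first d))).
by rewrite -mulmxA edge_mx_drop_first mulmx1 mul0mx.
Qed.

(** Removing vertex [a] after relabelling gives the face opposite to [s a], with its own vertices
    relabelled by some [s']. *)
Lemma row'_row_perm m n (s : {perm 'I_m.+2}) (F : 'M[R]_(m.+2, n)) a :
  exists s', row' a (row_perm s F) = row_perm s' (row' (s a) F).
Proof.
have h j : exists j', s (lift a j) = lift (s a) j'.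
  case: (unliftP (s a) (s (lift a j))) => [j' ->|]; first by exists j'.
  by move/perm_inj/esym/eqP; rewrite (negbTE (neq_lift _ _)).
have [f fE] := choice h.
have injf : injective f.
  move=> i j ij; apply: (@lift_inj _ a); apply: (@perm_inj _ s).
  by rewrite !fE ij.
exists (perm injf); apply/matrixP => i j.
by rewrite !mxE permE fE.
Qed.

End edge_matrix.

(** * Barycentric parametrization and integrals over the reference simplex *)

Section simplex_parametrization.
Context {R : realType}.

Definition simplex_param m n (F : 'M[R]_(m.+1, n)) (t : 'rV[R]_m) : 'rV[R]_n :=
  row ord0 F + t *m edges F.

(** Barycentric coordinates, with 1 minus the sum of [t] in front of [t], seen as the
    parametrization of the standard simplex whose vertices are the unit vectors. *)
Definition bary m (t : 'rV[R]_m) : 'rV[R]_m.+1 := simplex_param 1%:M t.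

Lemma simplex_paramE m n (F : 'M[R]_(m.+1, n)) t : simplex_param F t = bary t *m F.
Proof.
rewrite /bary /simplex_param mulmxDl -row_mul mul1mx.
by rewrite -mulmxA -/(edge_mx m) -edgesE.
Qed.

Lemma bary_lift m (t : 'rV[R]_m) j : bary t ord0 (lift ord0 j) = t ord0 j.
Proof.
rewrite /bary /simplex_param !mxE (negbTE (neq_lift _ _)) add0r.
rewrite (bigD1 j)//= !mxE eqxx (negbTE (neq_lift _ _)) subr0 mulr1.
rewrite big1 ?addr0// => i ij.
by rewrite !mxE (inj_eq lift_inj) (negbTE ij) (negbTE (neq_lift _ _)) subr0 mulr0.
Qed.

Lemma bary0 m (t : 'rV[R]_m) : bary t ord0 ord0 = 1 - \sum_i t ord0 i.
Proof.
rewrite /bary /simplex_param !mxE eqxx -sumrN; congr (_ + _).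
apply: eq_bigr => i _; rewrite !mxE eqxx eq_sym (negbTE (neq_lift _ _)).
by rewrite sub0r mulrN1.
Qed.

Lemma bary_sum m (t : 'rV[R]_m) : \sum_i bary t ord0 i = 1.
Proof.
rewrite big_ord_recl bary0 (eq_bigr _ (fun i _ => bary_lift t i)).
by rewrite subrK.
Qed.

Lemma bary_drop_first m (w : 'rV[R]_m.+1) : \sum_i w ord0 i = 1 ->
  bary (w *m drop_first m) = w.
Proof.
move=> w1; apply/rowP => i; case: (unliftP ord0 i) => [j|] ->.
  by rewrite bary_lift mul_drop_first.
rewrite bary0; under eq_bigr do rewrite mul_drop_first.
by rewrite -w1 big_ord_recl addrK.
Qed.

Lemma ref_simplexP m (t : 'rV[R]_m) :
  ref_simplex t <-> forall i, 0 <= bary t ord0 i.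
Proof.
split=> [[t0 t1] i|h].
  by case: (unliftP ord0 i) => [j|] ->; rewrite ?bary_lift// bary0 subr_ge0.
split=> [i|]; first by rewrite -bary_lift.
by have := h ord0; rewrite bary0 subr_ge0.
Qed.

Lemma hullP m n (F : 'M[R]_(m.+1, n)) x :
  hull F x <-> exists2 t, ref_simplex t & x = simplex_param F t.
Proof.
split=> [[l [l0 _ l1 ->]]|[t /ref_simplexP t0 ->]].
  exists (l *m drop_first m); last by rewrite simplex_paramE bary_drop_first.
  by apply/ref_simplexP => i; rewrite bary_drop_first.
exists (bary t); split => //; last by rewrite simplex_paramE.
  by move=> i; rewrite inE.
exact: bary_sum.
Qed.

Lemma measurable_ref_simplex m : measurable (@ref_simplex R m).
Proof.
rewrite (_ : ref_simplex (p:=m) = \bigcap_(i in [set: 'I_m.+1])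
   ((fun t => bary t ord0 i) @^-1` `[0, +oo[%classic)).
  apply: fin_bigcap_measurable => // i _; rewrite -[X in measurable X]setTI.
  apply: (measurableT_comp (measurable_coord i)) => //.
  exact: measurable_affine.
apply/seteqP; split => t; first by move=> /ref_simplexP h i _ /=; rewrite in_itv/= h.
by move=> h; apply/ref_simplexP => i; have := h i I; rewrite /= in_itv/= andbT.
Qed.

Lemma ref_simplex_le1 m (t : 'rV[R]_m) i : ref_simplex t -> t ord0 i <= 1.
Proof.
move=> [t0 t1]; apply: le_trans t1; rewrite (bigD1 i)//= lerDl.
exact: sumr_ge0.
Qed.

Lemma bounded_ref_simplex m : bounded_set (@ref_simplex R m).
Proof.
apply: (@norm_le_bounded _ _ _ 1) => t ht; apply: norm_le_coord => // i.
by have [t0 _] := ht; rewrite ger0_norm// ref_simplex_le1.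
Qed.

Lemma elementary_affine m n (f : 'rV[R]_n -> R) b (A : 'M[R]_(m, n)) :
  elementary f -> elementary (fun t => f (b + t *m A)).
Proof.
elim=> {f} [c|i|q l c|f g _ ef _ eg|f g _ ef _ eg].
- exact: elementary_cst.
- under eq_fun do rewrite !mxE; apply: elementaryD; first exact: elementary_cst.
  apply: elementary_sum => j; apply: elementaryM; last exact: elementary_cst.
  exact: elementary_coord.
- rewrite (_ : (fun _ => _) =
      fun t => flat q (dotv (l *m A^T) t + (dotv l b + c))).
    exact: elementary_flat.
  apply/funext => t; congr flat.
  suff e : dotv l (t *m A) = dotv (l *m A^T) t by rewrite dotvDr e; ring.
  rewrite /dotv; under eq_bigr do rewrite mxE mulr_sumr.
  rewrite exchange_big; apply: eq_bigr => i _.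
  by rewrite mxE mulr_suml; apply: eq_bigr => j _; rewrite mxE; ring.
- exact: elementaryD.
- exact: elementaryM.
Qed.

Lemma elementary_simplex_param m n (f : 'rV[R]_n -> R) (F : 'M[R]_(m.+1, n)) :
  elementary f -> elementary (fun t => f (simplex_param F t)).
Proof. exact: elementary_affine. Qed.

Lemma intble_restrict m (D : set 'rV[R]_m) (f : 'rV[R]_m -> R) : measurable D ->
  (lebesgue_rV m).-integrable D (EFin \o f) <->
  (lebesgue_rV m).-integrable setT (EFin \o (f \_ D)).
Proof.
move=> mD; rewrite (integrable_mkcond _ mD) restrict_EFin.
by [].
Qed.

Lemma elementary_intble m (D : set 'rV[R]_m) f : measurable D -> bounded_set D ->
  elementary f -> (lebesgue_rV m).-integrable D (EFin \o f).
Proof. by move=> mD bD /elementary_continuous cf; exact: continuous_intble. Qed.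

(** [simplex_integral] without its Gram factor, which is handled together with the unit normal in
    [outward_normalP]. *)
Definition face_integral m n (F : 'M[R]_(m.+1, n)) (g : 'rV[R]_n -> R) : R :=
  \int[lebesgue_rV m]_(t in @ref_simplex R m) g (simplex_param F t).

(** Permuting barycentric coordinates is an affine bijection of the reference simplex with
    determinant 1 in absolute value. *)
Lemma face_integral_row_perm m n (F : 'M[R]_(m.+1, n)) (s : {perm 'I_m.+1}) g :
  elementary g -> face_integral (row_perm s F) g = face_integral F g.
Proof.
move=> eg; rewrite /face_integral Rintegral_mkcond [RHS]Rintegral_mkcond.
pose b : 'rV[R]_m := row ord0 1%:M *m perm_mx s *m drop_first m.
have baryE t : bary t *m perm_mx s = bary (b + t *m edge_perm s).
  rewrite -[LHS]bary_drop_first; last first.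
    by rewrite perm_mx_sum bary_sum.
  rewrite /b /bary /simplex_param -/(edge_mx m) !mulmxDl /edge_perm.
  by rewrite !mulmxA.
have fi : (lebesgue_rV m).-integrable setT
    (EFin \o ((fun t => g (simplex_param F t)) \_ (@ref_simplex R m))).
  apply: (proj1 (intble_restrict _ (@measurable_ref_simplex m))).
  apply: elementary_intble; first exact: measurable_ref_simplex.
    exact: bounded_ref_simplex.
  exact: elementary_simplex_param.
rewrite [RHS](Rintegral_affine b (edge_perm_unitmx s) fi) norm_det_edge_perm mul1r.
apply: eq_Rintegral => t _; rewrite !patchE.
have -> : (b + t *m edge_perm s \in @ref_simplex R m) = (t \in @ref_simplex R m).
  have pE i : bary (b + t *m edge_perm s) ord0 i = bary t ord0 (s^-1%g i).
    by rewrite -baryE -[s in perm_mx s]invgK -col_permE mxE.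
  apply/idP/idP => /set_mem/ref_simplexP h; apply/mem_set/ref_simplexP => i.
    by have := h (s i); rewrite pE permK.
  by rewrite pE.
case: ifP => // _; congr g; rewrite simplex_paramE row_permE mulmxA baryE.
by rewrite simplex_paramE.
Qed.

End simplex_parametrization.

(** * The fundamental theorem of calculus along an edge *)

Section simplex_FTC.
Context {R : realType}.

Lemma derive_grad d (f : 'rV[R]_d -> R) x v : differentiable f x ->
  'D_v f x = dotv v (grad f x).
Proof.
move=> df; rewrite deriveE// {1}(row_sum_delta v) linear_sum; apply: eq_bigr => i _.
by rewrite linearZ /grad mxE /partial deriveE.
Qed.

Lemma elementary_derive d (f : 'rV[R]_d -> R) v : elementary f ->
  elementary (fun x => 'D_v f x).
Proof.
move=> ef; rewrite (_ : (fun _ => _) = fun x => dotv v (grad f x)).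
  apply: elementary_dotv => i; first exact: elementary_cst.
  exact: elementary_grad.
by apply/funext => x; rewrite derive_grad//; exact: elementary_differentiable.
Qed.

(** Fubini with the inner integral supplied in closed form by [g], as the fundamental theorem of
    calculus delivers it. *)
Lemma Rintegral_rVS d (f : 'rV[R]_d.+1 -> R) (g : 'rV[R]_d -> R) :
  (lebesgue_rV d.+1).-integrable setT (EFin \o f) ->
  (forall v, (\int[lebesgue_measure]_a (f (row_cons (a, v)))%:E = (g v)%:E)%E) ->
  \int[lebesgue_rV d.+1]_x f x = \int[lebesgue_rV d]_v g v.
Proof.
move=> fi fg; have /integrableP[mf foo] := fi.
have mrc : measurable_fun setT (@row_cons R d) by exact: measurable_row_cons.
have gi : (lebesgue_measure \x lebesgue_rV d)%E.-integrable setT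
    ((EFin \o f) \o @row_cons R d).
  apply/integrableP; split; first exact: measurableT_comp.
  move: foo; rewrite [X in (X < _)%E](ge0_integral_pushforward mrc)//.
  exact: measurableT_comp.
rewrite /Rintegral; congr fine.
rewrite [LHS](integral_pushforward mrc mf gi)// preimage_setT.
rewrite -integral21_prod_meas1//.
apply: eq_integral => v _; exact: fg.
Qed.

Lemma ref_simplexS m a (v : 'rV[R]_m) : ref_simplex (row_cons (a, v)) <->
  ref_simplex v /\ 0 <= a <= 1 - \sum_i v ord0 i.
Proof.
have e0 : row_cons (a, v) ord0 ord0 = a by rewrite mxE unlift_none.
have eS j : row_cons (a, v) ord0 (lift ord0 j) = v ord0 j by rewrite mxE liftK.
rewrite /ref_simplex/= big_ord_recl e0 (eq_bigr _ (fun j _ => eS j)).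
split=> [[h0 h1]|[[h0 h1] /andP[a0 a1]]].
  have a0 := h0 ord0; rewrite e0 in a0; split; last by apply/andP; split; lra.
  by split=> [i|]; [rewrite -eS|lra].
split; last by lra.
by move=> i; case: (unliftP ord0 i) => [j|] ->; rewrite ?eS ?e0.
Qed.

(** A point whose barycentric coordinate at [a] vanishes lies on the face opposite to [a], with the
    remaining coordinates. *)
Lemma mul_row' m n (w : 'rV[R]_m.+1) (u : 'rV[R]_m) (F : 'M[R]_(m.+1, n)) a :
  w ord0 a = 0 -> (forall j, w ord0 (lift a j) = u ord0 j) -> w *m F = u *m row' a F.
Proof.
move=> wa wu; apply/rowP => i; rewrite !mxE (bigD1_ord a)//= wa mul0r add0r.
by apply: eq_bigr => j _; rewrite wu mxE.
Qed.

Lemma row_cons_bary m a (v : 'rV[R]_m) :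
  [/\ bary (row_cons (a, v)) ord0 ord0 = 1 - \sum_i v ord0 i - a,
     bary (row_cons (a, v)) ord0 (lift ord0 ord0) = a &
     forall j, bary (row_cons (a, v)) ord0 (lift ord0 (lift ord0 j)) = v ord0 j].
Proof.
have e0 : row_cons (a, v) ord0 ord0 = a by rewrite mxE unlift_none.
have eS j : row_cons (a, v) ord0 (lift ord0 j) = v ord0 j by rewrite mxE liftK.
split=> [||j]; rewrite ?bary_lift//.
by rewrite bary0 big_ord_recl e0 (eq_bigr _ (fun j _ => eS j)); ring.
Qed.

Lemma simplex_param_row'0 m n (F : 'M[R]_(m.+2, n)) (v : 'rV[R]_m) :
  simplex_param F (row_cons (1 - \sum_i v ord0 i, v)) = simplex_param (row' ord0 F) v.
Proof.
have [b0 b1 bS] := row_cons_bary (1 - \sum_i v ord0 i) v.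
rewrite !simplex_paramE; apply: mul_row'; first by rewrite b0 subrr.
move=> j; case: (unliftP ord0 j) => [j'|] ->; first by rewrite bS bary_lift.
by rewrite b1 bary0.
Qed.

Lemma simplex_param_row'1 m n (F : 'M[R]_(m.+2, n)) (v : 'rV[R]_m) :
  simplex_param F (row_cons (0, v)) = simplex_param (row' (lift ord0 ord0) F) v.
Proof.
have [b0 b1 bS] := row_cons_bary 0 v.
rewrite !simplex_paramE; apply: mul_row'; first by rewrite b1.
move=> j; case: (unliftP ord0 j) => [j'|] ->.
  rewrite bary_lift -bS; congr (bary _ _ _); exact/val_inj.
rewrite bary0 (_ : lift _ _ = ord0); last exact/val_inj.
by rewrite b0 subr0.
Qed.

Lemma simplex_param_row_cons m n (F : 'M[R]_(m.+2, n)) a (v : 'rV[R]_m) :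
  simplex_param F (row_cons (a, v)) =
  simplex_param (row' (lift ord0 ord0) F) v + a *: row ord0 (edges F).
Proof.
rewrite -simplex_param_row'1 /simplex_param -addrA; congr (_ + _).
rewrite rowE scalemxAl -mulmxDl; congr (_ *m _).
apply/rowP => i; rewrite !mxE eqxx /=; case: (unliftP ord0 i) => [j|] ->.
  by rewrite eq_sym (negbTE (neq_lift _ _)) mulr0 addr0.
by rewrite eqxx mulr1 add0r.
Qed.

Lemma elementary_line_continuous n (f : 'rV[R]_n -> R) (x e : 'rV[R]_n) : elementary f ->
  continuous (fun a : R => f (x + a *: e)).
Proof.
move=> ef a; apply: differentiable_continuous; apply/derivable1_diffP.
have h := is_derive_line (e := e) (elementary_differentiable ef (x + a *: e)).
exact: (ex_derive (is_derive := h)).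
Qed.

(** A line parallel to the edge from vertex 0 to vertex 1 enters the simplex through the face
    opposite to vertex 1 and leaves through the face opposite to vertex 0. The first reference
    coordinate runs along it. *)
Lemma simplex_FTC p n (S : 'M[R]_(p.+2, n)) (g : 'rV[R]_n -> R) : elementary g ->
  \int[lebesgue_rV p.+1]_(t in @ref_simplex R p.+1)
    'D_(row ord0 (edges S)) g (simplex_param S t) =
  face_integral (row' ord0 S) g - face_integral (row' (lift ord0 ord0) S) g.
Proof.
move=> eg; set e := row ord0 (edges S).
have eDg : elementary (fun x => 'D_e g x) by exact: elementary_derive.
have mref m := @measurable_ref_simplex R m.
have fi := elementary_intble (mref p.+1) (bounded_ref_simplex _)
  (elementary_simplex_param S eDg).
pose E a v := g (simplex_param S (row_cons (a, v))).
have ii m (F : 'M[R]_(m.+1, n)) : (lebesgue_rV m).-integrable (@ref_simplex R m)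
    (EFin \o (fun v => g (simplex_param F v))).
  apply: elementary_intble => //; first exact: bounded_ref_simplex.
  exact: elementary_simplex_param.
rewrite /face_integral -(RintegralB (mref p) (ii _ _) (ii _ _)).
rewrite Rintegral_mkcond [RHS]Rintegral_mkcond.
apply: Rintegral_rVS; first exact: (proj1 (intble_restrict _ (mref p.+1))).
move=> v; have [hv|hv] := pselect (ref_simplex v); last first.
  rewrite integral0_eq => [|a _].
    by rewrite patchE ifF//; apply/negbTE/negP => /set_mem.
  by rewrite patchE ifF//; apply/negbTE/negP => /set_mem/ref_simplexS[].
have : 0 <= 1 - \sum_i v ord0 i by have [_] := hv; rewrite subr_ge0.
set b := 1 - _ => b0.
transitivity (\int[lebesgue_measure]_(a in `[0%R, b]%classic)
    ('D_e g (simplex_param S (row_cons (a, v))))%:E)%E.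
  rewrite [RHS]integral_mkcond; apply: eq_integral => a _.
  rewrite !patchE (_ : (_ \in ref_simplex (p:=_)) = (a \in `[0%R, b]%classic)).
    by case: ifP.
  apply/idP/idP => /set_mem h; apply/mem_set.
    by case/ref_simplexS : h => _ h; rewrite /= in_itv.
  by apply/ref_simplexS; split => //; move: h; rewrite /= in_itv.
rewrite patchE ifT; last exact: mem_set.
rewrite -simplex_param_row'0 -simplex_param_row'1 -/b.
(* [continuous_FTC2] asks for a nondegenerate interval; when the slice is a point, both sides
   vanish. *)
move: b0; rewrite le_eqVlt => /predU1P[<-|b0].
  by rewrite set_itv1 integral_set1 subrr.
have EE a : E a v = g (simplex_param (row' (lift ord0 ord0) S) v + a *: e).
  by rewrite /E simplex_param_row_cons.
have dE (a : R) : is_derive a 1 (E ^~ v) ('D_e g (simplex_param S (row_cons (a, v)))).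
  have := is_derive_line (e := e) (elementary_differentiable eg
    (simplex_param (row' (lift ord0 ord0) S) v + a *: e)).
  by rewrite -simplex_param_row_cons; under eq_fun do rewrite -simplex_param_row_cons.
have cE : continuous (E ^~ v).
  by under eq_fun do rewrite EE; exact: elementary_line_continuous.
have cdE : continuous (fun a : R => 'D_e g (simplex_param S (row_cons (a, v)))).
  rewrite (_ : (fun _ => _) = (fun a : R =>
      'D_e g (simplex_param (row' (lift ord0 ord0) S) v + a *: e))).
    exact: elementary_line_continuous eDg.
  by apply/funext => a; rewrite simplex_param_row_cons.
rewrite (continuous_FTC2 (F := E ^~ v) b0) ?EFinB//.
- exact: continuous_subspaceT.
- split.
  + by move=> a _; exact: (ex_derive (is_derive := dE a)).
  + by apply: cvg_at_right_filter; exact: cE.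
  + by apply: cvg_at_left_filter; exact: cE.
- by move=> a _; rewrite derive1E (derive_val (is_derive := dE a)).
Qed.

End simplex_FTC.

(** * Outward normals and gradients of barycentric coordinates *)

Section face_normals.
Context {R : realType}.

Lemma dotv_mul d (x y : 'rV[R]_d) : dotv x y = (x *m y^T) ord0 ord0.
Proof. by rewrite mxE; apply: eq_bigr => i _; rewrite mxE. Qed.

(** The constant gradient of the barycentric coordinate at vertex [a], as [bary_coordE] confirms. *)
Definition bary_grad d (S : 'M[R]_(d.+1, d)) (a : 'I_d.+1) : 'rV[R]_d :=
  (col a (invmx (edges S) *m edge_mx d))^T.

Lemma dotv_bary_grad d (S : 'M[R]_(d.+1, d)) a j : edges S \in unitmx ->
  dotv (row j (edges S)) (bary_grad S a) = edge_mx d j a.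
Proof.
move=> uB; rewrite dotv_mul trmxK colE mulmxA -row_mul mulKVmx//.
by rewrite -colE !mxE.
Qed.

Lemma det_gram_row_perm m n (s : {perm 'I_m.+1}) (F : 'M[R]_(m.+1, n)) :
  \det (edges (row_perm s F) *m (edges (row_perm s F))^T) =
  \det (edges F *m (edges F)^T).
Proof.
rewrite edges_row_perm trmx_mul mulmxA -[_ *m _ *m (edges F)^T]mulmxA.
rewrite !det_mulmx det_tr mulrAC -expr2 -real_normK ?num_real//.
by rewrite norm_det_edge_perm expr1n mul1r.
Qed.

(** Volume is height times base. Replacing [r] by the unit normal [nu] gives a matrix whose Gram
    matrix is block diagonal, so the square of its determinant is the Gram determinant of [E]; the
    replacement divides the absolute determinant by [h]. *)
Lemma det_gram_col_mx p (nu r : 'rV[R]_(1 + p)) (E : 'M[R]_(p, 1 + p)) h :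
  col_mx r E \in unitmx -> 0 < h -> dotv nu nu = 1 -> dotv nu r = - h ->
  E *m nu^T = 0 ->
  `|\det (col_mx r E)| = h * Num.sqrt (\det (E *m E^T)).
Proof.
move=> uB h0 nn nr En; set B := col_mx r E.
have mx11 (A : 'M[R]_1) : A = (A ord0 ord0)%:M.
  by apply/matrixP => i j; rewrite !ord1 !mxE mulr1n.
pose M : 'M[R]_(1 + p) := col_mx nu E.
have En' : nu *m E^T = 0 by rewrite -[LHS]trmxK trmx_mul trmxK En trmx0.
have MM : \det (E *m E^T) = \det M ^+ 2.
  rewrite expr2 -[in X in _ * X]det_tr -det_mulmx tr_col_mx mul_col_row.
  by rewrite En' En det_lblock det_mx11 -dotv_mul nn mul1r.
rewrite MM sqrtr_sqr.
(* [x] is the coefficient of [r] in the expansion of [nu] over the rows of [B]; pairing this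
   expansion with [nu] gives [- h * x = 1]. *)
pose x := (nu *m invmx B) ord0 ord0.
have hx : - h * x = 1.
  have : nu *m invmx B *m (B *m nu^T) = 1%:M.
    rewrite mulmxA mulmxKV//.
    by rewrite [LHS]mx11 -dotv_mul nn.
  rewrite mul_col_mx En -[nu *m _](@hsubmxK _ _ 1 p) mul_row_col mulmx0 addr0.
  move=> /(congr1 (fun A : 'M[R]_1 => A ord0 ord0)).
  rewrite mxE big_ord1 -dotv_mul dotvC nr [RHS]mxE eqxx => e.
  rewrite -[RHS]e mulrC; congr (_ * _); rewrite /x [RHS]mxE.
  by congr (_ _ _); exact/val_inj.
have MB : M *m invmx B = block_mx x%:M (rsubmx (nu *m invmx B)) 0 1%:M.
  rewrite mul_col_mx.
  have -> : E *m invmx B = row_mx 0 1%:M.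
    have : col_mx r E *m invmx B = 1%:M by rewrite mulmxV.
    by rewrite mul_col_mx (scalar_mx_block 1 p) => /eq_col_mx[_ ->].
  rewrite -[nu *m _ in LHS](@hsubmxK _ _ 1 p); congr (col_mx (row_mx _ _) _).
  by rewrite [LHS]mx11 mxE /x; congr (_ _ _)%:M; exact/val_inj.
have dM : \det M = x * \det B.
  have : \det (M *m invmx B) = x by rewrite MB det_ublock det1 mulr1 det_scalar1.
  rewrite det_mulmx det_inv => <-.
  by rewrite mulfVK// -unitfE -unitmxE.
have hx1 : h * `|x| = 1 by rewrite -[h]gtr0_norm// -normrM -normrN -mulNr hx normr1.
by rewrite dM normrM mulrA hx1 mul1r.
Qed.

(** With [h] the height of vertex [a] over its opposite face, [nu] is [- h] times the gradient of
    the barycentric coordinate, and the determinant is [h] times the Gram factor. Surface integrals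
    of normal components thus lose their square roots. *)
Lemma outward_normalP p (S : 'M[R]_(p.+2, p.+1)) a nu : edges S \in unitmx ->
  outward_unit_normal S a nu ->
  Num.sqrt (\det (edges (row' a S) *m (edges (row' a S))^T)) *: nu =
  - `|\det (edges S)| *: bary_grad S a.
Proof.
move=> uB [nu1 nuo nua].
pose i0 := lift a ord0; have i0a : i0 != a by rewrite eq_sym neq_lift.
pose h := dotv nu (row i0 S - row a S).
have h0 : 0 < h by have := nua _ i0a; rewrite /h !dotvBr subr_lt0 subr_gt0.
have hE i : i != a -> dotv nu (row i S - row a S) = h.
  move=> ia; have := nuo _ _ ia i0a; rewrite /h !dotvBr; lra.
have nn : dotv nu nu = 1.
  by have := sqr_sqrtr (dotv_ge0 nu); rewrite -/(enorm nu) nu1 expr1n => <-.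
(* Both vectors have the same inner product with every edge, and the edges form a basis. *)
have nuE : nu = - h *: bary_grad S a.
  have uBt : (edges S)^T \in unitmx by rewrite unitmx_tr.
  apply: (can_inj (mulmxK uBt)).
  apply/rowP => j.
  have tE (x : 'rV[R]_p.+1) : (x *m (edges S)^T) ord0 j = dotv x (row j (edges S)).
    by rewrite mxE; apply: eq_bigr => i _; rewrite !mxE.
  rewrite !tE dotvZl [dotv (bary_grad _ _) _]dotvC dotv_bary_grad// row_edges.
  rewrite !mxE; have [ja|ja] := eqVneq a (lift ord0 j).
    have a0 : ord0 != a by rewrite ja neq_lift.
    rewrite (negbTE a0) subr0 mulr1 -(hE ord0)// -ja.
    by rewrite !dotvBr; ring.
  have [a0|a0] := eqVneq a ord0.
    rewrite sub0r mulrN1 opprK; move: (hE (lift ord0 j)).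
    by rewrite eq_sym ja a0 => ->.
  rewrite subr0 mulr0; apply: nuo; rewrite eq_sym//.
suff hdet : `|\det (edges S)| =
    h * Num.sqrt (\det (edges (row' a S) *m (edges (row' a S))^T)).
  by rewrite hdet {1}nuE !scalerA; congr (_ *: _); ring.
(* In this labelling the first edge runs from [i0] to [a], and the other edges span the face
   opposite to [a], which is the shape [det_gram_col_mx] expects. *)
have [s s0 s1] : exists2 s : {perm 'I_p.+2}, s ord0 = i0 & s (lift ord0 ord0) = a.
  pose c := tperm ord0 i0 (lift ord0 ord0).
  have i0c : i0 != c.
    by rewrite -[X in X != _](tpermL ord0) (inj_eq perm_inj) neq_lift.
  exists (tperm ord0 i0 * tperm c a)%g; rewrite permM.
    by rewrite tpermL tpermD// eq_sym.
  by rewrite -/c tpermL.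
have [s' Es'] := row'_row_perm s S (lift ord0 ord0).
rewrite s1 in Es'.
rewrite -(det_gram_row_perm s' (row' a S)) -Es'.
have uS : edges (row_perm s S) \in unitmx.
  by rewrite edges_row_perm unitmx_mul edge_perm_unitmx.
have -> : `|\det (edges S)| = `|\det (edges (row_perm s S))|.
  by rewrite edges_row_perm det_mulmx normrM norm_det_edge_perm mul1r.
have eB : edges (row_perm s S) =
   col_mx (row a S - row i0 S) (edges (row' (lift ord0 ord0) (row_perm s S))) :> 'M[R]_(1 + p).
  apply/row_matrixP => j; case: (split_ordP j) => k ->.
    rewrite (_ : lshift p k = ord0); last by apply/val_inj; rewrite /= ord1.
    apply/rowP => l; rewrite !mxE.
    case: splitP => [k' _|k' //].
    by rewrite !mxE s0 s1.
  apply/rowP => l; rewrite !mxE; case: splitP => [k' /= |k' /= [kk]].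
    by rewrite ord1.
  have -> : k' = k by exact/val_inj.
  rewrite !mxE; congr (S (s _) _ - S (s _) _); exact/val_inj.
rewrite eB; apply: (@det_gram_col_mx p nu) => //; first by rewrite -eB.
  by rewrite /h !dotvBr; ring.
apply/colP => j; rewrite mxE [RHS]mxE.
have -> : \sum_(i < 1 + p) edges (row' (lift ord0 ord0) (row_perm s S)) j i * nu^T i ord0 =
   dotv nu (row (s (lift (lift ord0 ord0) (lift ord0 j))) S -
            row (s (lift (lift ord0 ord0) ord0)) S).
  by apply: eq_bigr => i _; rewrite !mxE mulrC.
by apply: nuo; rewrite -s1 (inj_eq perm_inj) eq_sym neq_lift.
Qed.

End face_normals.

Lemma measure_integral_indic (R : realType) d (A : set 'rV[R]_d) : measurable A ->
  lebesgue_rV d A = (\int[lebesgue_rV d]_x (\1_A x)%:E)%E.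
Proof. by move=> mA; rewrite integral_indic// setIT. Qed.

Lemma row_row_perm (R : Type) m n (s : {perm 'I_m}) (A : 'M[R]_(m, n)) i :
  row i (row_perm s A) = row (s i) A.
Proof. by apply/rowP => j; rewrite !mxE. Qed.

Lemma partial_sum (R : realType) d n (F : 'I_n -> 'rV[R]_d -> R) j x :
  (forall i, differentiable (F i) x) ->
  partial j (fun y => \sum_i F i y) x = \sum_i partial j (F i) x.
Proof.
move=> dF; rewrite /partial (_ : (fun y => _) = \sum_i F i); last first.
  by apply/funext => y; rewrite fct_sumE.
by rewrite derive_sum// => i; exact: diff_derivable.
Qed.

Lemma partial_dotvl (R : realType) d (q : 'rV[R]_d -> 'rV[R]_d) v j x :
  (forall i, elementary (fun y => q y ord0 i)) ->
  partial j (fun y => dotv (q y) v) x =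
  \sum_i v ord0 i * partial j (fun y => q y ord0 i) x.
Proof.
move=> eq_; rewrite partial_sum => [|i]; last first.
  apply: differentiableM => //; exact: (elementary_differentiable (eq_ i)).
apply: eq_bigr => i _; rewrite partialM//; last first.
  exact: (elementary_differentiable (eq_ i)).
by rewrite partial_cst mulr0 add0r.
Qed.

Lemma bary_grad_lift (R : realType) d (S : 'M[R]_(d.+1, d)) b i :
  bary_grad S (lift ord0 b) ord0 i = invmx (edges S) i b.
Proof.
rewrite 2!mxE -mul_drop_first -mulmxA edge_mx_drop_first mulmx1.
by [].
Qed.

Lemma bary_grad_sum (R : realType) d (S : 'M[R]_(d.+1, d)) :
  \sum_a bary_grad S a = 0.
Proof.
apply/rowP => i; rewrite summxE [RHS]mxE.
under eq_bigr do rewrite 3!mxE.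
rewrite exchange_big big1// => j _.
by rewrite -mulr_sumr edge_mx_sum mulr0.
Qed.

(** * Integration over an element and the divergence theorem *)

Section element.
Context {R : realType} {p : nat}.
Variable S : 'M[R]_(p.+2, p.+1).
Hypothesis uS : edges S \in unitmx.
Notation mu := (@lebesgue_rV R p.+1).

Definition bary_coord (x : 'rV[R]_p.+1) : 'rV[R]_p.+2 :=
  bary ((x - row ord0 S) *m invmx (edges S)).

Lemma simplex_paramK t : bary_coord (simplex_param S t) = bary t.
Proof. by rewrite /bary_coord /simplex_param addrC addKr mulmxK. Qed.

Lemma bary_coordK x : simplex_param S ((x - row ord0 S) *m invmx (edges S)) = x.
Proof. by rewrite /simplex_param mulmxKV// addrC subrK. Qed.

Lemma hull_bary_coord x : hull S x <-> forall i, 0 <= bary_coord x ord0 i.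
Proof.
split=> [/hullP[t /ref_simplexP ht ->]|h]; first by rewrite simplex_paramK.
apply/hullP; exists ((x - row ord0 S) *m invmx (edges S)); rewrite ?bary_coordK//.
exact/ref_simplexP.
Qed.

Lemma bary_coordE i : exists c, forall x,
  bary_coord x ord0 i = dotv (bary_grad S i) x + c.
Proof.
exists ((row ord0 1%:M - row ord0 S *m invmx (edges S) *m edge_mx p.+1) ord0 i) => x.
rewrite /bary_coord /bary /simplex_param -/(edge_mx _) mulmxBl mulmxBl.
rewrite addrCA mxE [in RHS]dotvC; congr (_ + _).
by rewrite -mulmxA mxE; apply: eq_bigr => j _; rewrite !mxE.
Qed.

Lemma elementary_bary_coord i : elementary (fun x => bary_coord x ord0 i).
Proof.
have [c bE] := bary_coordE i; under eq_fun do rewrite bE.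
apply: elementaryD; last exact: elementary_cst.
apply: elementary_sum => j; apply: elementaryM; first exact: elementary_cst.
exact: elementary_coord.
Qed.

(** A concrete open simplex. It is contained in [elem S], defined as a topological interior, and the
    converse is established only almost everywhere. *)
Definition core : set 'rV[R]_p.+1 := [set x | forall i, 0 < bary_coord x ord0 i].

Lemma core_elem : core `<=` elem S.
Proof.
move=> x hx; rewrite /elem /interior.
have : \forall y \near x, forall i, 0 < bary_coord y ord0 i.
  apply: (@filter_forall _ _ (fun i y => is_true (0 < bary_coord y ord0 i)) (nbhs x) _) => i.
  have cb := elementary_continuous (elementary_bary_coord i).
  exact: (cb x [set z | 0 < z] (lt_nbhsr (hx i))).
by apply: filterS => y hy; apply/hull_bary_coord => i; exact: ltW.
Qed.

Lemma elem_hull : elem S `<=` hull S.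
Proof. exact: interior_subset. Qed.

Lemma measurable_elem : measurable (elem S).
Proof. by apply: open_rV_measurable; exact: open_interior. Qed.

Lemma bounded_hull : bounded_set (hull S).
Proof.
pose M := \sum_i \sum_j `|S i j|.
apply: (@norm_le_bounded _ _ _ M) => x [l [l0 _ l1 ->]].
have M0 : 0 <= M by apply: sumr_ge0 => i _; exact: sumr_ge0.
apply: norm_le_coord => // j; rewrite mxE.
apply: (le_trans (ler_norm_sum _ _ _)); apply: ler_sum => i _.
have li : `|l ord0 i| <= 1.
  by rewrite ger0_norm// -l1 (bigD1 i)//= lerDl sumr_ge0.
rewrite normrM (le_trans (ler_wpM2r (normr_ge0 _) li))// mul1r.
by rewrite (bigD1 j)//= lerDl sumr_ge0.
Qed.

Lemma bounded_elem : bounded_set (elem S).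
Proof.
have [M _ h] := bounded_set_norm_le bounded_hull.
by apply: (@norm_le_bounded _ _ _ M) => x /elem_hull; exact: h.
Qed.

Lemma measurable_bary_coord i : measurable_fun setT (fun x => bary_coord x ord0 i).
Proof.
exact: (continuous_rV_measurable (elementary_continuous (elementary_bary_coord i))).
Qed.

(** For a coordinate of [t] the set is a box with one side reduced to a point; for the coordinate at
    vertex 0, every slice in the first variable is a point. *)
Lemma negligible_bary_eq0 (i : 'I_p.+2) :
  lebesgue_rV p.+1 [set t : 'rV[R]_p.+1 | bary t ord0 i = 0] = 0%E.
Proof.
case: (unliftP ord0 i) => [j|] ->.
  pose A (k : 'I_p.+1) : set (measurableTypeR R) := if k == j then [set 0] else setT.
  rewrite (_ : [set t | _] = [set t : 'rV[R]_p.+1 | forall k, A k (t ord0 k)]); last first.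
    apply/seteqP; split => t /=; rewrite bary_lift.
      by move=> tj k; rewrite /A; case: eqVneq => [->|].
    by move/(_ j); rewrite /A eqxx.
  rewrite lebesgue_rV_box => [|k]; last by rewrite /A; case: ifP.
  by rewrite (bigD1 j)//= {1}/A eqxx lebesgue_measure_set1 mul0e.
set N := [set t : 'rV[R]_p.+1 | bary t ord0 ord0 = 0].
have mN : measurable N.
  rewrite (_ : N = (fun t : 'rV[R]_p.+1 => bary t ord0 ord0) @^-1` [set 0])//.
  rewrite -[X in measurable X]setTI.
  by apply: (measurableT_comp (measurable_coord ord0)) => //; exact: measurable_affine.
rewrite measure_integral_indic// ge0_integral_rVS_swap; last 2 first.
- by apply/measurable_EFinP.
- by move=> t; rewrite lee_fin.
apply: integral0_eq => v _.
have e a : row_cons (a, v) \in N = (a \in [set 1 - \sum_i v ord0 i]).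
  have [b0 _ _] := row_cons_bary a v.
  apply/idP/idP => /set_mem h; apply/mem_set; move: h; rewrite /N/= b0.
    by move/eqP; rewrite subr_eq0 => /eqP.
  by move=> ->; rewrite subrr.
under eq_integral do rewrite indicE e -indicE.
rewrite integral_indic// setIT; exact: lebesgue_measure_set1.
Qed.

Lemma negligible_face i : mu [set x | bary_coord x ord0 i = 0] = 0%E.
Proof.
set N := [set x | _].
have mN : measurable N.
  rewrite (_ : N = (fun x => bary_coord x ord0 i) @^-1` [set 0])//.
  by rewrite -[X in measurable X]setTI; exact: measurable_bary_coord.
rewrite measure_integral_indic//.
rewrite (ge0_integral_affine (row ord0 S) uS)//; last exact/measurable_EFinP.
rewrite (_ : (\int[_]_x _)%E = 0%E) ?mule0//.
rewrite -[RHS](negligible_bary_eq0 i) measure_integral_indic//.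
  apply: eq_integral => t _; rewrite !indicE; congr ((nat_of_bool _)%:R%:E).
  rewrite -/(simplex_param S t).
  by apply/idP/idP => /set_mem h; apply/mem_set; move: h; rewrite /N/= simplex_paramK.
rewrite (_ : [set t | _] = (fun t : 'rV[R]_p.+1 => bary t ord0 i) @^-1` [set 0])//.
rewrite -[X in measurable X]setTI.
by apply: (measurableT_comp (measurable_coord i)) => //; exact: measurable_affine.
Qed.

Lemma hull_core_ae : \forall x \ae mu, hull S x -> core x.
Proof.
have h i : \forall x \ae mu, bary_coord x ord0 i != 0.
  exists [set x | bary_coord x ord0 i = 0]; split; last first.
  - by move=> x /= /negP; rewrite negbK => /eqP.
  - exact: negligible_face.
  - rewrite (_ : [set x | _] = (fun x => bary_coord x ord0 i) @^-1` [set 0])//.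
    by rewrite -[X in measurable X]setTI; exact: measurable_bary_coord.
have : \forall x \ae mu, forall i, bary_coord x ord0 i != 0.
  exact: (@filter_forall _ _ (fun i y => is_true (bary_coord y ord0 i != 0))).
apply: filterS => x hx /hull_bary_coord h0 i.
by rewrite lt_neqAle eq_sym hx h0.
Qed.

Lemma elem_core_ae : \forall x \ae mu, elem S x -> core x.
Proof. by apply: filterS hull_core_ae => x h /elem_hull. Qed.

(** The hull replaces its interior up to a null set, and the hull is the affine image of the
    reference simplex. *)
Lemma integral_elem (g : 'rV[R]_p.+1 -> R) : elementary g ->
  \int[mu]_(x in elem S) g x = `|\det (edges S)| * face_integral S g.
Proof.
move=> eg.
have mh : measurable (hull S).
  rewrite (_ : hull S = (fun x => (x - row ord0 S) *m invmx (edges S)) @^-1`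
      (@ref_simplex R p.+1)).
    rewrite -[X in measurable X]setTI.
    have := measurable_affine (- row ord0 S *m invmx (edges S)) (invmx (edges S)).
    under eq_fun do rewrite addrC -mulmxDl.
    by apply => //; exact: measurable_ref_simplex.
  by apply/seteqP; split => x; rewrite hull_bary_coord => /ref_simplexP.
have me := measurable_elem.
have ig (D : set 'rV[R]_p.+1) : measurable D -> bounded_set D -> mu.-integrable setT (EFin \o (g \_ D)).
  by move=> mD bD; apply: (proj1 (intble_restrict _ mD)); exact: elementary_intble.
have ie := ig _ me bounded_elem; have ih := ig _ mh bounded_hull.
rewrite Rintegral_mkcond (Rintegral_ae _ ie (g := g \_ (hull S))) => //; first last.
- apply: filterS hull_core_ae => x hc _; rewrite !patchE.
  have [hx|hx] := pselect (hull S x).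
    have ex : elem S x by exact/core_elem/hc.
    by rewrite !ifT//; exact: mem_set.
  by rewrite !ifF//; apply/negbTE/negP => /set_mem; [|move=> /elem_hull].
- by have /integrableP[/measurable_EFinP] := ih.
rewrite (Rintegral_affine (row ord0 S) uS ih) /face_integral [in RHS]Rintegral_mkcond.
congr (_ * _); apply: eq_Rintegral => t _; rewrite !patchE -/(simplex_param S t).
congr (if _ then _ else _); apply/idP/idP => /set_mem h; apply/mem_set.
  by apply/ref_simplexP; move: h; rewrite hull_bary_coord simplex_paramK.
by apply/hull_bary_coord; rewrite simplex_paramK; exact/ref_simplexP.
Qed.

(** A transposition brings the end of edge [b] to position 1 while fixing vertex 0, which reduces
    the claim to the first edge. *)
Lemma integral_elem_derive (g : 'rV[R]_p.+1 -> R) b : elementary g ->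
  \int[mu]_(x in elem S) 'D_(row b (edges S)) g x =
  `|\det (edges S)| *
  (face_integral (row' ord0 S) g - face_integral (row' (lift ord0 b) S) g).
Proof.
move=> eg; rewrite integral_elem; last exact: elementary_derive.
congr (_ * _).
pose s := tperm (lift ord0 ord0) (lift ord0 b : 'I_p.+2).
rewrite -(face_integral_row_perm _ s); last exact: elementary_derive.
have -> : row b (edges S) = row ord0 (edges (row_perm s S)).
  by rewrite !row_edges !row_row_perm tpermL tpermD.
rewrite [LHS](simplex_FTC (row_perm s S) eg).
have [s0 ->] := row'_row_perm s S ord0.
have [s1 ->] := row'_row_perm s S (lift ord0 ord0).
by rewrite !(face_integral_row_perm _ _ eg) tpermL tpermD.
Qed.

(** The divergence is the sum over the edges from vertex 0 of the derivative along the edge of the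
    component of [q] on the dual barycentric gradient. Each such derivative integrates to a
    difference of two faces. *)
Lemma divergence_theorem (q : 'rV[R]_p.+1 -> 'rV[R]_p.+1) nu :
  (forall i, elementary (fun x => q x ord0 i)) ->
  (forall a, outward_unit_normal S a (nu a)) ->
  boundary_integral S (fun a x => dotv (q x) (nu a)) =
  \int[mu]_(x in elem S) \sum_i partial i (fun x => q x ord0 i) x.
Proof.
move=> eq_ hnu.
have eqd v : elementary (fun x => dotv (q x) v).
  by apply: elementary_dotv => i //; exact: elementary_cst.
have mref := @measurable_ref_simplex R p.
have iq a v : (lebesgue_rV p).-integrable (@ref_simplex R p)
    (EFin \o (fun t => dotv (q (simplex_param (row' a S) t)) v)).
  apply: elementary_intble => //; first exact: bounded_ref_simplex.
  exact: (@elementary_simplex_param _ _ _ (fun x => dotv (q x) v)).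
have faceZ c a v : face_integral (row' a S) (fun x => dotv (q x) (c *: v)) =
    c * face_integral (row' a S) (fun x => dotv (q x) v).
  rewrite /face_integral -RintegralZl//.
  by apply: eq_Rintegral => t _; rewrite dotvZr.
have faceB a (I : Type) (r : seq I) (v : I -> 'rV[R]_p.+1) :
    face_integral (row' a S) (fun x => dotv (q x) (\sum_(i <- r) v i)) =
    \sum_(i <- r) face_integral (row' a S) (fun x => dotv (q x) (v i)).
  rewrite /face_integral -Rintegral_sum//.
  apply: eq_Rintegral => t _; rewrite /dotv exchange_big.
  by apply: eq_bigr => i _; rewrite summxE mulr_sumr.
have -> : boundary_integral S (fun a x => dotv (q x) (nu a)) =
    - `|\det (edges S)| *
      \sum_a face_integral (row' a S) (fun x => dotv (q x) (bary_grad S a)).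
  rewrite mulr_sumr; apply: eq_bigr => a _.
  rewrite [LHS](_ : _ = Num.sqrt (\det (edges (row' a S) *m (edges (row' a S))^T)) *
    face_integral (row' a S) (fun x => dotv (q x) (nu a)))//.
  by rewrite -faceZ (outward_normalP uS (hnu a)) faceZ.
(* Edges and barycentric gradients are dual bases: the gradients are the columns of the inverse edge
   matrix, so the mixed partial derivatives cancel. *)
have -> : \int[mu]_(x in elem S) \sum_i partial i (fun x => q x ord0 i) x =
    \sum_b \int[mu]_(x in elem S)
      'D_(row b (edges S)) (fun x => dotv (q x) (bary_grad S (lift ord0 b))) x.
  rewrite -Rintegral_sum; last 2 first.
  - exact: measurable_elem.
  - move=> b; apply: elementary_intble; [exact: measurable_elem|exact: bounded_elem|].
    exact: elementary_derive.
  apply: eq_Rintegral => x _.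
  have dE b : 'D_(row b (edges S)) (fun x => dotv (q x) (bary_grad S (lift ord0 b))) x =
      \sum_j \sum_i invmx (edges S) i b * edges S b j * partial j (fun x => q x ord0 i) x.
    rewrite derive_grad; last exact: (elementary_differentiable (eqd _)).
    apply: eq_bigr => j _; rewrite mxE [X in _ * X]mxE partial_dotvl// mulr_sumr.
    by apply: eq_bigr => i _; rewrite bary_grad_lift; ring.
  under [RHS]eq_bigr do rewrite dE.
  rewrite [RHS]exchange_big; apply: eq_bigr => j _ /=.
  rewrite [RHS]exchange_big [RHS](bigD1 j)//= [X in _ + X]big1 ?addr0 => [|i ij].
    rewrite -mulr_suml; have := mulVmx uS => /matrixP/(_ j j).
    by rewrite !mxE eqxx => ->; rewrite mul1r.
  rewrite -mulr_suml; have := mulVmx uS => /matrixP/(_ i j).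
  by rewrite !mxE (negbTE ij) => ->; rewrite mul0r.
under [RHS]eq_bigr do rewrite integral_elem_derive//.
(* The contributions on the face opposite to vertex 0 add up to the missing term because all
   barycentric gradients have sum zero. *)
rewrite -mulr_sumr sumrB big_ord_recl mulNr -mulrN opprD; congr (_ * (_ - _)).
rewrite -faceB -[LHS]mulN1r -faceZ; congr face_integral; apply/funext => x.
congr dotv; rewrite scaleN1r; apply/eqP; rewrite eq_sym -subr_eq0 opprK addrC.
by rewrite -(big_ord_recl _ (bary_grad S)) bary_grad_sum.
Qed.

End element.

(** * Test functions *)

Section test_functions.
Context {R : realType} {d : nat}.
Notation mu := (@lebesgue_rV R d).
Implicit Types (D : set 'rV[R]_d) (phi psi : 'rV[R]_d -> R).

Lemma test_function_differentiable D phi : test_function D phi ->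
  forall x, differentiable phi x.
Proof. by move=> [sphi _] x; exact: (sphi [::]). Qed.

Lemma test_function_partial_continuous D phi i : test_function D phi ->
  continuous (partial i phi).
Proof.
by move=> [sphi _] x; apply: differentiable_continuous; exact: (sphi [:: i]).
Qed.

Lemma test_function_continuous D phi : test_function D phi -> continuous phi.
Proof.
move=> tphi x; apply: differentiable_continuous.
exact: test_function_differentiable tphi x.
Qed.

Lemma Rintegral_support D (E : set 'rV[R]_d) phi : E `<=` D ->
  (forall x, ~ E x -> phi x = 0) ->
  \int[mu]_(x in D) phi x = \int[mu]_(x in E) phi x.
Proof.
move=> ED phi0; rewrite Rintegral_mkcond [RHS]Rintegral_mkcond.
congr Rintegral; apply/funext => x; rewrite !patchE.
have [Ex|nEx] := pselect (E x).
  by rewrite !ifT//; apply: mem_set => //; exact: ED.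
by rewrite phi0//; case: ifP; case: ifP.
Qed.

Lemma test_function_ibp D phi psi i : test_function D phi ->
  (forall x, differentiable psi x) -> continuous (partial i psi) ->
  \int[mu]_(x in D) (phi x * partial i psi x) =
  - \int[mu]_(x in D) (partial i phi x * psi x).
Proof.
move=> tphi dpsi cpsi; have [_ [A cA [AD phi0]]] := tphi.
have clA : closed A by apply: compact_closed => //; exact: norm_hausdorff.
have DT : D `<=` setT by [].
rewrite -(@Rintegral_support setT) => [|//|x nDx]; last first.
  by rewrite phi0 ?mul0r// => /AD.
rewrite (integration_by_parts _ dpsi _ cpsi cA phi0); last 2 first.
- exact: test_function_differentiable tphi.
- exact: test_function_partial_continuous tphi.
congr (- _); apply: Rintegral_support => // x nDx.
by rewrite (partial0_notin i clA phi0) ?mul0r// => /AD.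
Qed.

Lemma elementary_test_function D f (A : set 'rV[R]_d) : elementary f -> compact A ->
  A `<=` D -> (forall x, ~ A x -> f x = 0) -> test_function D f.
Proof. by move=> ef cA AD f0; split; [exact: elementary_smooth|exists A]. Qed.

(* A test function in one component: the fluxes that reveal the weak gradient. *)
Lemma test_function_Hdiv D phi i : measurable D -> bounded_set D ->
  test_function D phi ->
  Hdiv D (fun x => phi x *: delta_mx ord0 i) (partial i phi).
Proof.
move=> mD bD tphi; split.
- move=> j; under eq_fun do rewrite !mxE mulrC.
  by apply: L2Z => //; apply: continuous_L2 => //; exact: test_function_continuous tphi.
- by apply: continuous_L2 => //; exact: test_function_partial_continuous tphi.
move=> psi tpsi.
rewrite /innerv /inner -(test_function_ibp tphi); last 2 first.
- exact: test_function_differentiable tpsi.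
- exact: test_function_partial_continuous tpsi.
apply: eq_Rintegral => x _; rewrite dotvZl; congr (_ * _).
rewrite /dotv (bigD1 i)//= big1 ?addr0 => [|j ji]; last first.
  by rewrite mxE (negbTE ji) andbF mul0r.
by rewrite !mxE !eqxx mul1r.
Qed.

End test_functions.

(** * Smooth cut-offs of an element *)

Section cutoff.
Context {R : realType} {p : nat}.
Variable S : 'M[R]_(p.+2, p.+1).
Hypothesis uS : edges S \in unitmx.
Notation mu := (@lebesgue_rV R p.+1).

(** The shift by 1 confines the support to the points whose barycentric coordinates are all at least
    1/n, a compact part of the open element; for n = 0 the function is zero. *)
Definition cutoff (n : nat) (x : 'rV[R]_p.+1) : R :=
  \prod_i flat 1 (n%:R * bary_coord S x ord0 i - 1).

Definition inner_simplex (n : nat) : set 'rV[R]_p.+1 :=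
  [set x | forall i, 1 <= n%:R * bary_coord S x ord0 i].

Lemma elementary_cutoff n : elementary (cutoff n).
Proof.
apply: elementary_prod => i; have [c bE] := bary_coordE S i.
rewrite (_ : (fun _ => _) =
    fun x => flat 1 (dotv (n%:R *: bary_grad S i) x + (n%:R * c - 1))).
  exact: elementary_flat.
by apply/funext => x; rewrite bE dotvZl; congr flat; ring.
Qed.

Lemma inner_simplex_elem n : inner_simplex n `<=` elem S.
Proof.
move=> x hx; apply: (core_elem uS) => i; have := hx i.
case: n {hx} => [|n] h; first by move: h; rewrite mul0r ler10.
by rewrite -(pmulr_rgt0 _ (ltr0Sn R n)); apply: lt_le_trans h.
Qed.

Lemma compact_inner_simplex n : compact (inner_simplex n).
Proof.
apply: bounded_closed_compact.
  have [M _ h] := bounded_set_norm_le (bounded_elem S).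
  by apply: (@norm_le_bounded _ _ _ M) => x /inner_simplex_elem; exact: h.
rewrite (_ : inner_simplex n = \bigcap_(i in [set: 'I_p.+2])
    ((fun x => n%:R * bary_coord S x ord0 i) @^-1` [set y | 1 <= y])).
  apply: closed_bigI => i _; apply: closed_comp; last exact: closed_ge.
  move=> x _; apply: (elementary_continuous
    (f := fun x => n%:R * bary_coord S x ord0 i)).
  by apply: elementaryM; [exact: elementary_cst|exact: elementary_bary_coord].
by apply/seteqP; split => x h i; [move=> _; exact: h|exact: (h i)].
Qed.

Lemma cutoff_eq0 n x : ~ inner_simplex n x -> cutoff n x = 0.
Proof.
move=> /existsNP[i /negP]; rewrite -ltNge => h.
by rewrite /cutoff (bigD1 i)//= /flat ifF ?mul0r//; apply/negbTE; rewrite -leNgt subr_le0 ltW.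
Qed.

Lemma cutoff_ge0 n x : 0 <= cutoff n x.
Proof. by apply: prodr_ge0 => i _; exact: flat1_ge0. Qed.

Lemma cutoff_le1 n x : cutoff n x <= 1.
Proof.
by apply: prodr_ile1 => i _; rewrite flat1_ge0 flat1_le1.
Qed.

Lemma cutoff_cvg x : core S x -> cutoff n x @[n --> \oo] --> (1 : R).
Proof.
move=> hx; rewrite (_ : 1 = \prod_(i < p.+2) 1); last by rewrite big1_eq.
apply: cvg_big; first exact: mul_continuous.
by move=> i _; exact: flat1_cvg.
Qed.

Lemma cutoff_test_function (D : set 'rV[R]_p.+1) n f : elem S `<=` D -> elementary f ->
  test_function D (fun x => cutoff n x * f x).
Proof.
move=> SD ef; apply: (@elementary_test_function _ _ _ _ (inner_simplex n)).
- by apply: elementaryM => //; exact: elementary_cutoff.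
- exact: compact_inner_simplex.
- by move=> x /inner_simplex_elem /SD.
- by move=> x /cutoff_eq0 ->; rewrite mul0r.
Qed.

(** The cut-offs lie between 0 and 1 and tend to 1 almost everywhere on the element, so dominated
    convergence with bound |h f| removes them. *)
Lemma cutoff_integral_eq0 h f : L2 (elem S) h -> elementary f ->
  (forall n, \int[mu]_(x in elem S) (h x * (cutoff n x * f x)) = 0) ->
  \int[mu]_(x in elem S) (h x * f x) = 0.
Proof.
move=> lh ef h0; have mS := measurable_elem S; have bS := bounded_elem S.
have lf : L2 (elem S) f by apply: continuous_L2 => //; exact: elementary_continuous.
have mcut n : measurable_fun (elem S) (cutoff n).
  apply: measurable_funTS.
  exact: (continuous_rV_measurable (elementary_continuous (elementary_cutoff n))).
have [mh _] := lh; have [mf _] := lf.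
have ihf := L2_intbleM mS lh lf.
have c0 : \int[mu]_(x in elem S) (h x * (cutoff n x * f x)) @[n --> \oo] --> (0 : R).
  by under eq_fun do rewrite h0; exact: cvg_cst.
rewrite -(cvg_lim (@norm_hausdorff _ _) c0); apply/esym/cvg_lim => //.
apply: (@dominated_convergence_Rintegral _ _ _ _ _ (fun x => `|h x * f x|)) => //.
- by move=> n; apply: measurable_funM => //; exact: measurable_funM.
- exact: measurable_funM.
- apply: filterS (elem_core_ae uS) => x hx Sx.
  have := cvgM (cvg_cst (h x) (F := \oo)) (cvgM (cutoff_cvg (hx Sx)) (cvg_cst (f x))).
  by rewrite mul1r; apply.
- move=> n x _; rewrite mulrCA normrM ger0_norm ?cutoff_ge0//.
  by rewrite ler_piMl// cutoff_le1.
- exact: (integrable_norm ihf).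
Qed.

End cutoff.

(** * The Poincare inequality on a simplex *)

Section poincare.
Context {R : realType} {p : nat}.
Variable S : 'M[R]_(p.+2, p.+1).
Hypothesis uS : edges S \in unitmx.
Notation mu := (@lebesgue_rV R p.+1).
Notation K := (core S).

Lemma core_convex x y t : K x -> K y -> 0 <= t <= 1 -> K (y + t *: (x - y)).
Proof.
move=> Kx Ky /andP[t0 t1] i; have [c bE] := bary_coordE S i.
have := Kx i; have := Ky i; rewrite !bE dotvDr dotvZr dotvBr.
set a := dotv _ x; set b := dotv _ y => hb ha.
have [->|tp] := eqVneq t 0; first by rewrite mul0r addr0.
have tp' : 0 < t by rewrite lt_neqAle eq_sym tp.
have := mulr_gt0 tp' ha; have := mulr_ge0 _ (ltW hb) => /(_ (1 - t)).
by rewrite subr_ge0 => /(_ t1); nra.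
Qed.

Lemma measurable_core : measurable K.
Proof.
rewrite (_ : K = \bigcap_(i in [set: 'I_p.+2])
    ((fun x => bary_coord S x ord0 i) @^-1` `]0, +oo[%classic)).
  apply: fin_bigcap_measurable => // i _; rewrite -[X in measurable X]setTI.
  exact: measurable_bary_coord.
apply/seteqP; split => x h i; first by move=> _ /=; rewrite in_itv/= h.
by have := h i I; rewrite /= in_itv/= andbT.
Qed.

Lemma bounded_core : bounded_set K.
Proof.
have [M _ h] := bounded_set_norm_le (bounded_elem S).
by apply: (@norm_le_bounded _ _ _ M) => x /(core_elem uS); exact: h.
Qed.

Lemma Rintegral_elem_core f : elementary f ->
  \int[mu]_(x in elem S) f x = \int[mu]_(x in K) f x.
Proof.
move=> ef; rewrite Rintegral_mkcond [RHS]Rintegral_mkcond.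
have mf : measurable_fun setT f.
  exact: (continuous_rV_measurable (elementary_continuous ef)).
apply: Rintegral_ae => //.
- apply: (proj1 (intble_restrict _ (measurable_elem S))).
  by apply: elementary_intble; [exact: measurable_elem|exact: bounded_elem|].
- apply/(measurable_restrictT _ measurable_core).
  exact: measurable_funTS.
apply: filterS (elem_core_ae uS) => x h _; rewrite !patchE.
have [hx|hx] := pselect (elem S x).
  by rewrite !ifT//; apply: mem_set => //; exact: h.
by rewrite !ifF//; apply/negbTE/negP => /set_mem => // /(core_elem uS).
Qed.

Lemma dotv_le_diam x y : hull S x -> hull S y ->
  dotv (x - y) (x - y) <= diam (hull S) ^+ 2.
Proof.
move=> hx hy; suff h : enorm (x - y) <= diam (hull S).
  rewrite -(sqr_sqrtr (dotv_ge0 (x - y))) ler_sqr ?nnegrE ?sqrtr_ge0//.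
  exact: le_trans (sqrtr_ge0 _) h.
apply: ub_le_sup; last by exists x, y.
have [M M0 hM] := bounded_set_norm_le (bounded_hull S).
exists (Num.sqrt (\sum_(i < p.+1) (2 * M) ^+ 2)) => _ [x' [y' [hx' hy' ->]]].
apply: ler_wsqrtr; apply: ler_sum => i _; rewrite -expr2.
rewrite -real_normK ?num_real// ler_sqr ?nnegrE ?normr_ge0 ?mulr_ge0//.
rewrite !mxE; apply: (le_trans (ler_normB _ _)); rewrite mulr_natl mulr2n.
apply: lerD; first exact: le_trans (coord_le_norm x' i) (hM _ hx').
exact: le_trans (coord_le_norm y' i) (hM _ hy').
Qed.

Lemma dotv_sqr_le (x y : 'rV[R]_p.+1) : dotv x y ^+ 2 <= dotv x x * dotv y y.
Proof.
have h z : dotv z y <= Num.sqrt (dotv z z) * Num.sqrt (dotv y y).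
  apply: discriminant_le; try exact: dotv_ge0.
  move=> r; have := dotv_ge0 (z - r *: y).
  by rewrite dotvBl !dotvBr !dotvZl !dotvZr [dotv y z]dotvC; congr (0 <= _); ring.
have h2 : `|dotv x y| <= Num.sqrt (dotv x x) * Num.sqrt (dotv y y).
  rewrite ler_norml h andbT lerNl; have := h (- x).
  by rewrite -scaleN1r !dotvZl dotvZr !mulN1r opprK.
rewrite -real_normK ?num_real//.
have := lerXn2r 2 _ _ h2; rewrite exprMn !sqr_sqrtr ?dotv_ge0//.
by apply; rewrite nnegrE ?mulr_ge0 ?sqrtr_ge0.
Qed.

(** Cauchy-Schwarz for the derivative along the half segment from the midpoint to [x]; the factor
    1/2 is the length of the parameter interval. *)
Lemma segment_sqr_le (v : 'rV[R]_p.+1 -> R) x y : elementary v ->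
  (((v x - v (y + 2^-1 *: (x - y))) ^+ 2)%:E <=
   \int[lebesgue_measure]_(t in `[2^-1%R, 1%R]%classic)
     (2^-1 * dotv (x - y) (grad v (y + t *: (x - y))) ^+ 2)%:E)%E.
Proof.
move=> ev; set e := x - y; set r := v x - _.
pose g (t : R) := dotv e (grad v (y + t *: e)).
have eg : elementary (fun x => dotv e (grad v x)).
  by apply: elementary_dotv => i; [exact: elementary_cst|exact: elementary_grad].
have cg : continuous g by exact: (@elementary_line_continuous _ _ _ y e eg).
have dv (t : R) : is_derive t 1 (fun t : R => v (y + t *: e)) (g t).
  have dvx := elementary_differentiable ev (y + t *: e).
  by have := is_derive_line dvx; rewrite derive_grad.
(* [2 r g - 2 r^2 <= g^2 / 2] integrates to [r^2] on the left *)
have -> : (r ^+ 2)%:E =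
    (\int[lebesgue_measure]_(t in `[2^-1%R, 1%R]%classic) (2 * r * g t - 2 * r ^+ 2)%:E)%E.
  pose F (t : R) : R := 2 * r * v (y + t *: e) - 2 * r ^+ 2 * t.
  have dF (t : R) : is_derive t 1 F (2 * r * g t - 2 * r ^+ 2).
    have h := is_deriveB (is_deriveZ (2 * r) (dv t))
      (is_deriveZ (2 * r ^+ 2) (is_derive_id t (1 : R))).
    have {}h : is_derive t 1 F ((2 * r) *: g t - (2 * r ^+ 2) *: (1 : R)) by exact: h.
    by apply: (is_derive_eq h); rewrite /GRing.scale/= mulr1.
  have cF : continuous F.
    move=> t; apply: differentiable_continuous; apply/derivable1_diffP.
    exact: (ex_derive (is_derive := dF t)).
  rewrite (continuous_FTC2 (F := F)).
  - rewrite -EFinB; congr _%:E; rewrite /F.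
    have -> : y + 1 *: e = x by rewrite scale1r addrC subrK.
    by rewrite /r; field.
  - by rewrite invf_lt1// ltr1n.
  - apply: continuous_subspaceT => t; apply: cvgB; last exact: cvg_cst.
    by apply: cvgM; [exact: cvg_cst|exact: cg].
  - split.
    + by move=> a _; exact: (ex_derive (is_derive := dF a)).
    + by apply: cvg_at_right_filter; exact: cF.
    + by apply: cvg_at_left_filter; exact: cF.
  - by move=> a _; rewrite derive1E (derive_val (is_derive := dF a)).
have ci (h : R -> R) : continuous h ->
    lebesgue_measure.-integrable `[2^-1%R, 1%R]%classic (EFin \o h).
  move=> ch; apply: continuous_compact_integrable; first exact: segment_compact.
  exact: continuous_subspaceT.
apply: le_integral => //.
- apply: ci => t; apply: cvgB; last exact: cvg_cst.
  by apply: cvgM; [exact: cvg_cst|exact: cg].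
- apply: ci => t; apply: cvgM; first exact: cvg_cst.
  by apply: cvgM; exact: cg.
move=> t _; rewrite lee_fin -/(g t).
by have := sqr_ge0 (g t - 2 * r); nra.
Qed.

Notation k := (\1_K : 'rV[R]_p.+1 -> R).
Notation h := (diam (hull S)).
Notation G v := (fun x => dotv (grad v x) (grad v x)).

Lemma measurable_point_on_segment d' (T : measurableType d') (x y : T -> 'rV[R]_p.+1)
    (t : T -> measurableTypeR R) : measurable_fun setT x -> measurable_fun setT y ->
  measurable_fun setT t -> measurable_fun setT (fun z => y z + t z *: (x z - y z)).
Proof.
move=> mx my mt; apply: measurable_fun_rV => i; under eq_fun do rewrite !mxE.
have mi (w : T -> 'rV[R]_p.+1) : measurable_fun setT w ->
    measurable_fun setT (fun z => w z ord0 i).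
  by move=> mw; exact: (measurableT_comp (measurable_coord i) mw).
apply: measurable_funD; first exact: mi.
by apply: measurable_funM => //; apply: measurable_funB; exact: mi.
Qed.

(** The dilation of ratio [t] about [y] has Jacobian t^(p+1), at least 2^(-(p+1)). This is the
    origin of the power of 2 in the final constant. *)
Lemma ge0_integral_dilation_le (f : 'rV[R]_p.+1 -> \bar R) (y : 'rV[R]_p.+1) (t : R) : 2^-1 <= t ->
  measurable_fun setT f -> (forall x, 0 <= f x)%E ->
  (\int[mu]_x f (y + t *: (x - y))%R <= (2 ^+ p.+1)%:E * \int[mu]_x f x)%E.
Proof.
move=> t2 mf f0; have t0 : 0 < t by apply: lt_le_trans t2; rewrite invr_gt0.
have ut : (t%:M : 'M[R]_p.+1) \in unitmx.
  by rewrite unitmxE det_scalar unitfE expf_neq0// gt_eqF.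
rewrite [X in (_ <= _ * X)%E](ge0_integral_affine (y - t *: y) ut)// det_scalar.
have -> : (\int[mu]_x f (y - t *: y + x *m t%:M)%R = \int[mu]_x f (y + t *: (x - y))%R)%E.
  apply: eq_integral => x _; congr f.
  by rewrite mul_mx_scalar scalerBr -addrA [- _ + _]addrC.
rewrite muleA -EFinM gtr0_norm ?exprn_gt0// -exprMn.
rewrite -[leLHS]mul1e; apply: lee_wpmul2r; first exact: integral_ge0.
rewrite lee_fin exprn_ege1// -ler_pdivrMl// mulr1//.
Qed.

(** After Tonelli, the dilation bound applies at each fixed [t]. The constant collects h^2 / 2 from
    [segment_sqr_le], 2^(p+1) from the dilation and 1/2 from the length of the interval of [t]. *)
Lemma half_segment_integral_le v y : elementary v -> K y ->
  (\int[mu]_(x in K) ((v x - v (y + 2^-1 *: (x - y))) ^+ 2)%:E <=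
   (h ^+ 2 * 2 ^+ p.+1 / 4)%:E * \int[mu]_(x in K) (G v x)%:E)%E.
Proof.
move=> ev Ky; have mK := measurable_core.
have eG : elementary (G v) by apply: elementary_dotv => i; exact: elementary_grad.
have mG := continuous_rV_measurable (elementary_continuous eG).
pose T : set (measurableTypeR R) := `[2^-1%R, 1%R]%classic.
pose f z : \bar R := (k z * G v z)%:E.
have f0 z : (0 <= f z)%E by rewrite lee_fin mulr_ge0// dotv_ge0.
have mf : measurable_fun setT f.
  by apply/measurable_EFinP; exact: measurable_funM.
have fE : (\int[mu]_(x in K) (G v x)%:E = \int[mu]_z f z)%E.
  rewrite integral_mkcond; apply: eq_integral => z _; rewrite patchE /f indicE.
  by case: ifP; rewrite ?mul1r ?mul0r.
(* The indicator of [K] sits at the point of the segment instead of at [x]: convexity makes this an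
   upper bound, and [x] may then range over the whole space, as the change of variables requires. *)
pose Phi (z : 'rV[R]_p.+1 * measurableTypeR R) : \bar R :=
  ((h ^+ 2 / 2 * \1_T z.2)%:E * f (y + z.2 *: (z.1 - y))%R)%E.
have Phi0 z : (0 <= Phi z)%E.
  by rewrite mule_ge0// lee_fin mulr_ge0// mulr_ge0 ?sqr_ge0// invr_ge0.
have mPhi : measurable_fun setT Phi.
  apply: emeasurable_funM.
    apply/measurable_EFinP; apply: measurable_funM => //.
    apply: (measurableT_comp _ measurable_snd); apply: measurable_indic.
    exact: measurable_itv.
  apply: (measurableT_comp mf); apply: (measurable_point_on_segment _ _ measurable_snd).
    exact: measurable_fst.
  exact: measurable_cst.
apply: (@le_trans _ _ (\int[mu]_x \int[lebesgue_measure]_t Phi (x, t))%E).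
  rewrite integral_mkcond; apply: ge0_le_integral => //.
  - by move=> x _; apply: erestrict_ge0 => z _; rewrite lee_fin sqr_ge0.
  - apply/(measurable_restrictT _ mK)/measurable_funTS/measurable_EFinP.
    apply: measurable_funX; apply: measurable_funB.
      exact: (continuous_rV_measurable (elementary_continuous ev)).
    apply: (measurableT_comp (continuous_rV_measurable (elementary_continuous ev))).
    exact: (@measurable_point_on_segment _ _ id (cst y) (cst 2^-1)).
  - exact: measurable_fun_fubini_tonelli_F.
  move=> x _; rewrite patchE; case: ifPn => [/set_mem Kx|_]; last exact: integral_ge0.
  apply: (le_trans (segment_sqr_le x y ev)).
  rewrite integral_mkcond; apply: ge0_le_integral.
  - exact: measurableT.
  - by move=> t _; apply: erestrict_ge0 => z _; rewrite lee_fin mulr_ge0 ?sqr_ge0 ?invr_ge0.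
  - apply/(measurable_restrictT _ (measurable_itv _))/measurable_funTS/measurable_EFinP.
    apply: measurable_funM => //; apply: measurable_funX.
    apply: continuous_measurable_fun.
    have eg : elementary (fun z => dotv (x - y) (grad v z)).
      by apply: elementary_dotv => i; [exact: elementary_cst|exact: elementary_grad].
    exact: (@elementary_line_continuous _ _ _ y (x - y) eg).
  - exact: measurable_fun_pair2.
  move=> t _; rewrite patchE; case: ifPn => [/set_mem Tt|_]; last exact: Phi0.
  have /andP[t1 t2] : 2^-1 <= t <= 1 by move: Tt; rewrite /T/= in_itv.
  have Kz : K (y + t *: (x - y)).
    by apply: core_convex => //; rewrite t2 andbT (le_trans _ t1)// invr_ge0.
  rewrite /Phi /f [fst _]/= [snd _]/= !indicE (mem_set Kz) (mem_set Tt).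
  rewrite mul1r mulr1 -EFinM lee_fin.
  rewrite [h ^+ 2 / 2]mulrC -mulrA ler_wpM2l ?invr_ge0//.
  apply: (le_trans (dotv_sqr_le _ _)); apply: ler_wpM2r; first exact: dotv_ge0.
  by apply: dotv_le_diam; exact/elem_hull/core_elem.
rewrite (fubini_tonelli Phi mPhi Phi0).
apply: (@le_trans _ _ (\int[lebesgue_measure]_(t in T)
    ((h ^+ 2 / 2)%:E * ((2 ^+ p.+1)%:E * \int[mu]_z f z)))%E).
  rewrite [leRHS]integral_mkcond; apply: ge0_le_integral => //.
  - by move=> t _; exact: integral_ge0.
  - exact: measurable_fun_fubini_tonelli_G.
  - apply/(measurable_restrictT _ (measurable_itv _)); exact: measurable_cst.
  move=> t _; rewrite patchE; case: ifPn => [/set_mem Tt|Tt]; last first.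
    rewrite integral0_eq// => x _; rewrite /Phi/= indicE (negbTE Tt).
    by rewrite mulr0 mul0e.
  have /andP[t1 t2] : 2^-1 <= t <= 1 by move: Tt; rewrite /T/= in_itv.
  rewrite /Phi/= indicE mem_set// mulr1 ge0_integralZl//.
  - by apply: lee_wpmul2l; [rewrite lee_fin mulr_ge0 ?sqr_ge0 ?invr_ge0|exact: ge0_integral_dilation_le].
  - apply: (measurableT_comp mf).
    exact: (@measurable_point_on_segment _ _ id (cst y) (cst t)).
  - by rewrite lee_fin mulr_ge0 ?sqr_ge0 ?invr_ge0.
rewrite fE integral_cst//; last exact: measurable_itv.
rewrite [X in (_ * X <= _)%E](_ : _ = (2^-1)%:E); last first.
  apply: etrans (lebesgue_measure_itv `[2^-1%R, 1%R]) _.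
  rewrite /= lte_fin invf_lt1// ltr1n.
  by rewrite -EFinB; congr _%:E; field.
rewrite muleC !muleA -!EFinM; apply: lee_wpmul2r; first exact: integral_ge0.
by rewrite lee_fin le_eqVlt; apply/orP; left; apply/eqP; field.
Qed.

Lemma measurable_sqr_diff v : elementary v ->
  measurable_fun setT (fun y => \int[mu]_(x in K) ((v x - v y) ^+ 2)%:E)%E.
Proof.
move=> ev; have mK := measurable_core.
have mv := continuous_rV_measurable (elementary_continuous ev).
pose B (z : 'rV[R]_p.+1 * 'rV[R]_p.+1) : \bar R := (k z.1 * (v z.1 - v z.2) ^+ 2)%:E.
rewrite (_ : (fun y => _) = (fun y => \int[mu]_x B (x, y))%E); last first.
  apply/funext => y; rewrite integral_mkcond; apply: eq_integral => x _.
  by rewrite patchE /B/= indicE; case: ifP; rewrite ?mul1r ?mul0r.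
apply: measurable_fun_fubini_tonelli_G => [|z].
  apply/measurable_EFinP; apply: measurable_funM.
    by apply: (measurableT_comp _ measurable_fst); exact: measurable_indic.
  apply: measurable_funX; apply: measurable_funB.
    by apply: (measurableT_comp mv); exact: measurable_fst.
  by apply: (measurableT_comp mv); exact: measurable_snd.
by rewrite /B lee_fin; apply: mulr_ge0; [|exact: sqr_ge0].
Qed.

(** Exchanging the two variables leaves the double integral of [A] unchanged by Tonelli, so both
    halves of the pointwise bound contribute equally. *)
Lemma symmetrized_double_integral_le (F : 'rV[R]_p.+1 -> 'rV[R]_p.+1 -> \bar R)
    (A : 'rV[R]_p.+1 * 'rV[R]_p.+1 -> \bar R) :
  measurable_fun setT A -> (forall z, 0 <= A z)%E -> (forall x y, 0 <= F x y)%E ->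
  (forall y, measurable_fun setT (fun x => F x y)) ->
  measurable_fun setT (fun y => \int[mu]_(x in K) F x y)%E ->
  (forall x y, K x -> K y -> F x y <= 2%:E * A (x, y) + 2%:E * A (y, x))%E ->
  (\int[mu]_(y in K) \int[mu]_(x in K) F x y <=
   2%:E * (\int[mu]_y \int[mu]_x A (x, y)) + 2%:E * (\int[mu]_y \int[mu]_x A (x, y)))%E.
Proof.
move=> mA A0 F0 mF mIF pointwise; have mK := measurable_core.
have two : (0 <= 2%:E :> \bar R)%E by rewrite lee_fin.
pose A' (z : 'rV[R]_p.+1 * 'rV[R]_p.+1) : \bar R := A (z.2, z.1).
have mA' : measurable_fun setT A'.
  apply: (measurableT_comp mA); apply: measurable_fun_pair; first exact: measurable_snd.
  exact: measurable_fst.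
have A'0 z : (0 <= A' z)%E by exact: A0.
have JE : (\int[mu]_y \int[mu]_x A' (x, y) = \int[mu]_y \int[mu]_x A (x, y))%E.
  exact: (fubini_tonelli A mA A0).
have {}pointwise x y : K x -> K y -> (F x y <= 2%:E * A (x, y) + 2%:E * A' (x, y))%E.
  exact: pointwise.
clearbody A'.
have mI : measurable_fun setT (fun y => \int[mu]_x A (x, y))%E.
  exact: measurable_fun_fubini_tonelli_G.
have mI' : measurable_fun setT (fun y => \int[mu]_x A' (x, y))%E.
  exact: measurable_fun_fubini_tonelli_G.
have iI y : (0 <= \int[mu]_x A (x, y))%E by exact: integral_ge0.
have iI' y : (0 <= \int[mu]_x A' (x, y))%E by exact: integral_ge0.
have mKK : measurable_fun setT (fun y => 2%:E * \int[mu]_x A (x, y))%E.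
  exact: measurable_funeM.
have mKK' : measurable_fun setT (fun y => 2%:E * \int[mu]_x A' (x, y))%E.
  exact: measurable_funeM.
have I0 y : (0 <= 2%:E * \int[mu]_x A (x, y))%E.
  exact: (mule_ge0 two (iI y)).
have I0' y : (0 <= 2%:E * \int[mu]_x A' (x, y))%E.
  exact: (mule_ge0 two (iI' y)).
rewrite -[X in (_ <= _ + 2%:E * X)%E]JE.
have -> : (2%:E * (\int[mu]_y \int[mu]_x A (x, y)) + 2%:E * (\int[mu]_y \int[mu]_x A' (x, y)) =
    \int[mu]_y (2%:E * \int[mu]_x A (x, y) + 2%:E * \int[mu]_x A' (x, y)))%E.
  rewrite (ge0_integralD _ measurableT (fun y _ => I0 y) mKK (fun y _ => I0' y) mKK').
  rewrite (ge0_integralZl _ measurableT mI (fun y _ => iI y) two).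
  by rewrite (ge0_integralZl _ measurableT mI' (fun y _ => iI' y) two).
rewrite integral_mkcond; apply: ge0_le_integral.
- exact: measurableT.
- move=> y _; apply: erestrict_ge0 => z _; exact: integral_ge0.
- by apply/(measurable_restrictT _ mK); exact: measurable_funTS.
- exact: (emeasurable_funD mKK mKK').
move=> y _; rewrite patchE; case: ifPn => [/set_mem Ky|_]; last first.
  by apply: adde_ge0; [exact: I0|exact: I0'].
have mAy : measurable_fun setT (fun x => A (x, y)) by exact: measurable_fun_pair1.
have mAy' : measurable_fun setT (fun x => A' (x, y)) by exact: measurable_fun_pair1.
rewrite -(ge0_integralZl _ measurableT mAy (fun x _ => A0 _) two).
rewrite -(ge0_integralZl _ measurableT mAy' (fun x _ => A'0 _) two).
rewrite -(ge0_integralD _ measurableT (fun x _ => mule_ge0 two (A0 _)) _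
  (fun x _ => mule_ge0 two (A'0 _))); last 2 first.
- exact: (measurable_funeM _ mAy).
- exact: (measurable_funeM _ mAy').
rewrite [leLHS]integral_mkcond; apply: ge0_le_integral.
- exact: measurableT.
- by move=> x _; exact: erestrict_ge0.
- by apply/(measurable_restrictT _ mK); exact: measurable_funTS.
- apply: emeasurable_funD; apply: measurable_funeM; [exact: mAy|exact: mAy'].
move=> x _; rewrite patchE; case: ifPn => [/set_mem Kx|_]; first exact: pointwise.
by apply: adde_ge0; apply: mule_ge0; [exact: two|exact: A0|exact: two|exact: A'0].
Qed.

Lemma double_sum_le (j g : \bar R) (c : R) : (0 <= j)%E ->
  (j <= (c / 4)%:E * g)%E -> (2%:E * j + 2%:E * j <= c%:E * g)%E.
Proof.
move=> j0 jg; rewrite -ge0_muleDl ?lee_fin// -EFinD.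
apply: (@le_trans _ _ ((2 + 2)%:E * ((c / 4)%:E * g))%E).
  by apply: lee_wpmul2l => //; rewrite lee_fin.
by rewrite muleA -EFinM (_ : (2 + 2) * (c / 4) = c)//; field.
Qed.

(* Comparing both points of a pair with their midpoint keeps the dilation ratio
   above 1/2, so that [ge0_integral_dilation_le] applies. *)
Lemma double_integral_le v : elementary v ->
  (\int[mu]_(y in K) \int[mu]_(x in K) ((v x - v y) ^+ 2)%:E <=
   (h ^+ 2 * 2 ^+ p.+1)%:E * (mu K * \int[mu]_(x in K) (G v x)%:E))%E.
Proof.
move=> ev; have mK := measurable_core.
have two : (0 <= 2%:E :> \bar R)%E by rewrite lee_fin.
have mv := continuous_rV_measurable (elementary_continuous ev).
pose A (z : 'rV[R]_p.+1 * 'rV[R]_p.+1) : \bar R :=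
  (k z.1 * k z.2 * (v z.1 - v (z.2 + 2^-1 *: (z.1 - z.2))) ^+ 2)%:E.
have A0 z : (0 <= A z)%E by rewrite lee_fin; apply: mulr_ge0; [exact: mulr_ge0|exact: sqr_ge0].
have mk1 : measurable_fun setT (fun z : 'rV[R]_p.+1 * 'rV[R]_p.+1 => k z.1).
  by apply: (measurableT_comp _ measurable_fst); exact: measurable_indic.
have mk2 : measurable_fun setT (fun z : 'rV[R]_p.+1 * 'rV[R]_p.+1 => k z.2).
  by apply: (measurableT_comp _ measurable_snd); exact: measurable_indic.
have mA : measurable_fun setT A.
  apply/measurable_EFinP; apply: measurable_funM; first exact: measurable_funM.
  apply: measurable_funX; apply: measurable_funB.
    by apply: (measurableT_comp mv); exact: measurable_fst.
  apply: (measurableT_comp mv).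
  exact: (@measurable_point_on_segment _ _ fst snd (cst 2^-1)).
pose J := (\int[mu]_y \int[mu]_x A (x, y))%E.
have J0 : (0 <= J)%E by apply: integral_ge0 => y _; exact: integral_ge0.
have pointwise x y : K x -> K y ->
    (((v x - v y) ^+ 2)%:E <= 2%:E * A (x, y) + 2%:E * A (y, x))%E.
  move=> Kx Ky.
  have kx : k x = 1 by rewrite indicE mem_set.
  have ky : k y = 1 by rewrite indicE mem_set.
  have e : x + 2^-1 *: (y - x) = y + 2^-1 *: (x - y).
    by apply/rowP => i; rewrite !mxE; field.
  rewrite /A [fst _]/= [snd _]/= e kx ky -!EFinM -EFinD lee_fin.
  move: (v x) (v y) (v (y + _)) => a b m.
  (* This is (a - b)^2 <= 2 (a - m)^2 + 2 (b - m)^2. *)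
  by have := sqr_ge0 (a - m + (b - m)); nra.
have JA : (J <= (h ^+ 2 * 2 ^+ p.+1 / 4)%:E * (mu K * \int[mu]_(x in K) (G v x)%:E))%E.
  apply: (@le_trans _ _ (\int[mu]_(y in K)
      ((h ^+ 2 * 2 ^+ p.+1 / 4)%:E * \int[mu]_(x in K) (G v x)%:E))%E); last first.
    move: (h ^+ 2 * 2 ^+ p.+1 / 4)%:E (\int[mu]_(x in K) (G v x)%:E)%E => c g.
    have e : (\int[mu]_(y in K) (c * g) = c * g * mu K)%E by exact: (integral_cst mu mK).
    rewrite e.
    rewrite -muleA.
    rewrite (muleC g).
    exact: lexx.
  rewrite [leRHS]integral_mkcond.
  apply: ge0_le_integral.
  - exact: measurableT.
  - by move=> y _; exact: integral_ge0.
  - exact: measurable_fun_fubini_tonelli_G.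
  - by apply/(measurable_restrictT _ mK); exact: measurable_cst.
  move=> y _; rewrite patchE; case: ifPn => [/set_mem Ky|Ky]; last first.
    rewrite integral0_eq; first exact: lexx.
    move=> x _.
    have ky : k y = 0 by rewrite indicE (negbTE Ky).
    rewrite /A [snd _]/= ky mulr0 mul0r.
    reflexivity.
  apply: le_trans (half_segment_integral_le ev Ky).
  rewrite [leRHS]integral_mkcond le_eqVlt; apply/orP; left; apply/eqP.
  apply: eq_integral => x _; rewrite patchE.
  have ky : k y = 1 by rewrite indicE mem_set.
  rewrite /A [snd _]/= [fst _]/= ky mulr1 indicE.
  case: ifP => _.
    rewrite mul1r.
    reflexivity.
  rewrite mul0r.
  reflexivity.
apply: (@le_trans _ _ (2%:E * J + 2%:E * J)%E); last first.
  exact: (double_sum_le J0 JA).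
pose F x y : \bar R := ((v x - v y) ^+ 2)%:E.
have F0 x y : (0 <= F x y)%E by rewrite lee_fin; exact: sqr_ge0.
have mF y : measurable_fun setT (F^~ y).
  by apply/measurable_EFinP; apply: measurable_funX; apply: measurable_funB.
exact: (symmetrized_double_integral_le mA A0 F0 mF (measurable_sqr_diff ev) pointwise).
Qed.

(** For [c] the mean value, the integral of (v - a)^2 is smallest at a = c. Taking a = v y and
    integrating over [y] bounds the variance times the measure of [K] by the double integral, and
    that measure cancels. *)
Lemma poincare v : elementary v -> exists c : R,
  \int[mu]_(x in elem S) (v x - c) = 0 /\
  \int[mu]_(x in elem S) (v x - c) ^+ 2 <=
    h ^+ 2 * 2 ^+ p.+1 * innerv (elem S) (grad v) (grad v).
Proof.
move=> ev; have mK := measurable_core.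
have eG : elementary (G v) by apply: elementary_dotv => i; exact: elementary_grad.
have e1 c : elementary (fun x => v x - c).
  by apply: elementaryB => //; exact: elementary_cst.
have e2 c : elementary (fun x => (v x - c) ^+ 2) by exact: elementaryX.
have iK f : elementary f -> mu.-integrable K (EFin \o f).
  by apply: elementary_intble => //; exact: bounded_core.
have fK f : elementary f -> (\int[mu]_(x in K) (f x)%:E)%E = (\int[mu]_(x in K) f x)%:E.
  by move=> ef; rewrite /Rintegral fineK//; exact: integrable_fin_num (iK _ ef).
have Koo : (mu K < +oo)%E by apply: bounded_measure_fin => //; exact: bounded_core.
have [m mE] : exists m, mu K = m%:E.
  by exists (fine (mu K)); rewrite fineK// ge0_fin_numE.
have m0 : 0 <= m by rewrite -lee_fin -mE.
have icst c : \int[mu]_(x in K) c = c * m by rewrite Rintegral_cst//; congr (_ * _); exact: (congr1 fine mE).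
rewrite /innerv (Rintegral_elem_core eG).
(* The mean is a quotient by [m]; on a null set all the integrals vanish and any constant works. *)
have [mz|mz] := eqVneq m 0.
  exists 0; rewrite (Rintegral_elem_core (e1 0)) (Rintegral_elem_core (e2 0)).
  have K0 : mu K = 0 by rewrite mE mz.
  have I0 f : elementary f -> \int[mu]_(x in K) f x = 0.
    move=> ef; rewrite /Rintegral null_set_integral//.
    by apply/measurable_EFinP/measurable_funTS; exact: (continuous_rV_measurable (elementary_continuous ef)).
  by rewrite !I0// mulr0.
exists ((\int[mu]_(x in K) v x) / m); set c := _ / m.
rewrite (Rintegral_elem_core (e1 c)) (Rintegral_elem_core (e2 c)).
have c0 : \int[mu]_(x in K) (v x - c) = 0.
  rewrite RintegralB//; [|exact: iK|by apply: iK; exact: elementary_cst].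
  by rewrite icst /c divfK// subrr.
split=> //; set V := \int[mu]_(x in K) (v x - c) ^+ 2.
have VE a : \int[mu]_(x in K) (v x - a) ^+ 2 = V + (c - a) ^+ 2 * m.
  have -> : \int[mu]_(x in K) (v x - a) ^+ 2 =
      \int[mu]_(x in K) ((v x - c) ^+ 2 + (2 * (c - a) * (v x - c) + (c - a) ^+ 2)).
    by apply: eq_Rintegral => x _; ring.
  rewrite RintegralD//; [|exact: iK|]; last first.
    apply: iK; apply: elementaryD; last exact: elementary_cst.
    by apply: elementaryM => //; exact: elementary_cst.
  rewrite RintegralD//; last 2 first.
  - by apply: iK; apply: elementaryM => //; exact: elementary_cst.
  - by apply: iK; exact: elementary_cst.
  by rewrite RintegralZl ?c0 ?mulr0 ?add0r ?icst//; exact: iK.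
have := double_integral_le ev; rewrite (fK _ eG) mE -!EFinM => hJ.
have : ((V * m)%:E <= (h ^+ 2 * 2 ^+ p.+1 * (m * \int[mu]_(x in K) G v x))%:E)%E.
  apply: le_trans hJ.
  rewrite EFinM -mE -(integral_cst mu mK V%:E); apply: ge0_le_integral => //.
  - by move=> x _; rewrite lee_fin; apply: Rintegral_ge0 => z _; exact: sqr_ge0.
  - by apply: measurable_funTS; exact: measurable_sqr_diff.
  move=> y _; rewrite fK// VE lee_fin lerDl mulr_ge0// sqr_ge0//.
rewrite lee_fin [m * _]mulrC mulrA ler_pM2r//.
by rewrite lt_neqAle eq_sym mz.
Qed.

End poincare.

(** * The post-processed potential *)

Section piecewise_coefficient.
Context {R : realType} {d n : nat}.
Implicit Types (Om : 'I_n -> set 'rV[R]_d) (a : 'I_n -> R).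

(** At most one subdomain contains [x], and [g 0 = 0] covers the points in none. It is applied to
    t^-1 and (sqrt t)^-1, which vanish at 0 under the convention 0^-1 = 0. *)
Lemma piecewise_coef_comp (g : R -> R) Om a x : g 0 = 0 ->
  (forall i j, i != j -> Om i `&` Om j = set0) ->
  g (piecewise_coef Om a x) = piecewise_coef Om (g \o a) x.
Proof.
move=> g0 dOm; rewrite /piecewise_coef.
have [[i Oi]|nO] := pselect (exists i, Om i x); last first.
  by rewrite !big1 => // i _; rewrite indicE memNset ?mulr0// => Oi; apply: nO; exists i.
have E (b : 'I_n -> R) : \sum_(j < n) b j * \1_(Om j) x = b i.
  rewrite (bigD1 i)//= indicE mem_set// mulr1 big1 ?addr0// => j ji.
  rewrite indicE memNset ?mulr0// => Oj.
  by have : (Om j `&` Om i) x by []; rewrite dOm.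
by rewrite (E a) (E (g \o a)).
Qed.

Lemma measurable_piecewise_coef Om a : (forall i, measurable (Om i)) ->
  measurable_fun setT (piecewise_coef Om a).
Proof.
move=> mOm; apply: measurable_sum => i.
by apply: measurable_funM => //; exact: measurable_indic.
Qed.

Lemma piecewise_coef_le Om a x : `|piecewise_coef Om a x| <= \sum_i `|a i|.
Proof.
apply: le_trans (ler_norm_sum _ _ _) _; apply: ler_sum => i _.
by rewrite normrM ler_piMr// indicE; case: (_ \in _); rewrite ?normr1 ?normr0.
Qed.

End piecewise_coefficient.

Section bounded_multipliers.
Context {R : realType} {d : nat}.
Notation mu := (@lebesgue_rV R d).

Lemma L2M_bounded (D : set 'rV[R]_d) (b f : 'rV[R]_d -> R) M : measurable D ->
  measurable_fun D b -> (forall x, `|b x| <= M) -> L2 D f ->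
  L2 D (fun x => b x * f x).
Proof.
move=> mD mb bM [mf If]; split; first exact: measurable_funM.
apply: (intble_le mD _ _ (intbleZ (M ^+ 2) mD If)).
  by apply: measurable_funX; exact: measurable_funM.
move=> x _; rewrite ger0_norm ?sqr_ge0// exprMn ler_wpM2r ?sqr_ge0//.
by rewrite -[b x ^+ 2]real_normK ?num_real// ler_sqr ?nnegrE// (le_trans _ (bM x)).
Qed.

Lemma L2vM_bounded (D : set 'rV[R]_d) (b : 'rV[R]_d -> R) s M : measurable D ->
  measurable_fun D b -> (forall x, `|b x| <= M) -> L2v D s ->
  L2v D (fun x => b x *: s x).
Proof.
move=> mD mb bM Ls i; rewrite (_ : (fun x => _) = fun x => b x * s x ord0 i).
  exact: L2M_bounded bM (Ls i).
by apply/funext => x; rewrite mxE.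
Qed.

Lemma L2vN (D : set 'rV[R]_d) (s : 'rV[R]_d -> 'rV[R]_d) : measurable D ->
  L2v D s -> L2v D (fun x => - s x).
Proof.
move=> mD /(L2vZ (-1) mD); congr (L2v D).
by apply/funext => x; rewrite scaleN1r.
Qed.

Lemma norm0v_Z (D : set 'rV[R]_d) (s : 'rV[R]_d -> 'rV[R]_d) c : measurable D ->
  L2v D s -> 0 <= c -> norm0v D (fun x => c *: s x) = c * norm0v D s.
Proof.
move=> mD Ls c0; rewrite /norm0v innervZl// ?innervZr//; last exact: L2vZ.
by rewrite mulrA -expr2 sqrtrM ?sqr_ge0// sqrtr_sqr ger0_norm.
Qed.

Lemma norm0_Z (D : set 'rV[R]_d) (f : 'rV[R]_d -> R) c : measurable D ->
  L2 D f -> 0 <= c -> norm0 D (fun x => c * f x) = c * norm0 D f.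
Proof.
move=> mD Lf c0; rewrite /norm0 /inner.
rewrite (_ : (fun x => _) = fun x => c ^+ 2 * (f x * f x)); last first.
  by apply/funext => x; ring.
rewrite RintegralZl//; last exact: L2_intbleM.
by rewrite sqrtrM ?sqr_ge0// sqrtr_sqr ger0_norm.
Qed.

Lemma norm0v_sub (D : set 'rV[R]_d) (s t : 'rV[R]_d -> 'rV[R]_d) :
  norm0v D (fun x => s x - t x) = norm0v D (fun x => t x - s x).
Proof.
congr Num.sqrt; apply: eq_Rintegral => x _.
by rewrite -(opprB (t x)) -scaleN1r dotvZl dotvZr mulrA mulrNN !mul1r.
Qed.

Lemma norm0_sub (D : set 'rV[R]_d) (f g : 'rV[R]_d -> R) :
  norm0 D (fun x => f x - g x) = norm0 D (fun x => g x - f x).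
Proof. by congr Num.sqrt; apply: eq_Rintegral => x _; ring. Qed.

Lemma diam_ge0 (A : set 'rV[R]_d) : 0 <= diam A.
Proof.
rewrite /diam; set B := [set r | _].
(* Without a supremum, [sup] takes its default value 0. *)
have [sB|/sup_out ->//] := pselect (has_sup B).
have [[r Br] ubB] := sB; apply: le_trans (ub_le_sup ubB Br).
by case: Br => x [y [_ _ ->]]; exact: sqrtr_ge0.
Qed.

Lemma elementary_L2 (D : set 'rV[R]_d) f : measurable D -> bounded_set D ->
  elementary f -> L2 D f.
Proof. by move=> mD bD /elementary_continuous cf; exact: continuous_L2. Qed.

Lemma measurable_dotv (D : set 'rV[R]_d) (s t : 'rV[R]_d -> 'rV[R]_d) :
  (forall i, measurable_fun D (fun x => s x ord0 i)) ->
  (forall i, measurable_fun D (fun x => t x ord0 i)) ->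
  measurable_fun D (fun x => dotv (s x) (t x)).
Proof.
by move=> ms mt; apply: measurable_sum => i; exact: measurable_funM.
Qed.

Lemma innerv_ae (D : set 'rV[R]_d) (s s' t : 'rV[R]_d -> 'rV[R]_d) :
  measurable D -> L2v D s -> L2v D t ->
  (forall i, measurable_fun D (fun x => s' x ord0 i)) -> ae_eq mu D s s' ->
  innerv D s t = innerv D s' t.
Proof.
move=> mD Ls Lt ms' ss'; apply: Rintegral_ae => //; first exact: intble_dotv.
  by apply: measurable_dotv => // i; exact: (Lt i).1.
by apply: filterS ss' => x h Dx; rewrite h.
Qed.

Lemma norm0v_ae (D : set 'rV[R]_d) (s s' : 'rV[R]_d -> 'rV[R]_d) :
  measurable D -> L2v D s ->
  (forall i, measurable_fun D (fun x => s' x ord0 i)) -> ae_eq mu D s s' ->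
  norm0v D s = norm0v D s'.
Proof.
move=> mD Ls ms' ss'; congr Num.sqrt; apply: Rintegral_ae => //.
- exact: intble_dotv.
- exact: measurable_dotv.
- by apply: filterS ss' => x h Dx; rewrite h.
Qed.

Lemma norm0_ae (D : set 'rV[R]_d) (f f' : 'rV[R]_d -> R) :
  measurable D -> L2 D f -> measurable_fun D f' -> ae_eq mu D f f' ->
  norm0 D f = norm0 D f'.
Proof.
move=> mD Lf mf' ff'; congr Num.sqrt; apply: Rintegral_ae => //.
- exact: L2_intbleM.
- exact: measurable_funM.
- by apply: filterS ff' => x h Dx; rewrite h.
Qed.

Lemma dotv_delta (x : 'rV[R]_d) i : dotv x (delta_mx ord0 i) = x ord0 i.
Proof.
rewrite /dotv (bigD1 i)//= big1 ?addr0 ?mxE ?eqxx ?mulr1// => j ji.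
by rewrite mxE eqxx/= (negPf ji) mulr0.
Qed.

End bounded_multipliers.

(** * Localizing weak derivatives to an element *)

Section weak_derivatives.
Context {R : realType} {p : nat}.
Variable S : 'M[R]_(p.+2, p.+1).
Hypothesis uS : edges S \in unitmx.
Notation mu := (@lebesgue_rV R p.+1).
Notation K := (elem S).
Implicit Types (D : set 'rV[R]_p.+1) (f g h u : 'rV[R]_p.+1 -> R).
Implicit Types (s t q : 'rV[R]_p.+1 -> 'rV[R]_p.+1).

(** An elementary function times a cut-off of the element is a test function of the larger domain,
    which replaces any density argument. *)
Lemma L2_orthogonal D h f : measurable D -> K `<=` D -> L2 D h -> elementary f ->
  (forall phi, test_function D phi -> inner D h phi = 0) ->
  \int[mu]_(x in K) (h x * f x) = 0.
Proof.
move=> mD KD Lh ef h0; apply: (cutoff_integral_eq0 uS) => //.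
  exact: L2S mD (measurable_elem S) KD Lh.
move=> n; rewrite -(Rintegral_support KD).
  by apply: h0; exact: cutoff_test_function.
move=> x nKx; rewrite cutoff_eq0 ?mul0r ?mulr0// => Ix; apply: nKx.
exact: inner_simplex_elem Ix.
Qed.

(** [t] and [- s] are both weak gradients of [u] in direction [i], so their difference is orthogonal
    to all test functions. *)
Lemma weak_gradient_local D u t s f i : measurable D -> bounded_set D -> K `<=` D ->
  H1 D u t -> L2v D s ->
  (forall phi, test_function D phi -> inner D u (partial i phi) =
     inner D (fun x => s x ord0 i) phi) ->
  elementary f ->
  \int[mu]_(x in K) (t x ord0 i * f x) = - \int[mu]_(x in K) (s x ord0 i * f x).
Proof.
move=> mD bD KD [Lu Lt ut] Ls us ef; have mK := measurable_elem S.
have Lf : L2 K f by apply: elementary_L2 => //; exact: bounded_elem.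
have tK : L2 K (fun x => t x ord0 i) by exact: L2S mD mK KD (Lt i).
have sK : L2 K (fun x => s x ord0 i) by exact: L2S mD mK KD (Ls i).
apply/eqP; rewrite -addr_eq0 -RintegralD//; try exact: L2_intbleM.
under eq_Rintegral do rewrite -mulrDl.
apply/eqP; apply: (L2_orthogonal mD KD) => //; first exact: L2D.
move=> phi tphi; have Lphi : L2 D phi.
  by apply: continuous_L2 => //; exact: test_function_continuous tphi.
rewrite /inner; under eq_Rintegral do rewrite mulrDl.
rewrite RintegralD//; try exact: L2_intbleM.
by apply/eqP; rewrite addr_eq0; apply/eqP; rewrite -[LHS]opprK -[X in - X](ut _ tphi) us.
Qed.

Lemma test_functionS D (E : set 'rV[R]_p.+1) phi : E `<=` D ->
  test_function E phi -> test_function D phi.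
Proof. by move=> ED [sphi [A cA [AE A0]]]; split=> //; exists A => //; split=> // x /AE/ED. Qed.

(** Test functions supported in the element see the smooth field [q] in place of [s], so they have
    the same pairing with [g] as with the classical divergence of [q]. *)
Lemma weak_divergence_local D s g q f : measurable D -> K `<=` D -> Hdiv D s g ->
  (forall i, elementary (fun x => q x ord0 i)) -> ae_eq mu K s q -> elementary f ->
  \int[mu]_(x in K) (g x * f x) =
  \int[mu]_(x in K) ((\sum_i partial i (fun y => q y ord0 i) x) * f x).
Proof.
move=> mD KD [Ls Lg sg] eq sq ef; have mK := measurable_elem S; have bK := bounded_elem S.
have Lf : L2 K f by exact: elementary_L2.
have gK : L2 K g by exact: L2S mD mK KD Lg.
have sK : L2v K s by exact: L2vS mD mK KD Ls.
have edq : elementary (fun x => \sum_i partial i (fun y => q y ord0 i) x).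
  by apply: elementary_sum => i; exact: elementary_partial.
have dqK := elementary_L2 mK bK edq.
apply/eqP; rewrite -subr_eq0 -RintegralB//; try exact: L2_intbleM.
under eq_Rintegral do rewrite -mulrBl.
apply/eqP; apply: (L2_orthogonal mK (@subset_refl _ K)) => //; first exact: L2B.
move=> phi tphi; have Lphi : L2 K phi.
  by apply: continuous_L2 => //; exact: test_function_continuous tphi.
have [_ [A cA [AK A0]]] := tphi.
have phi0 x : ~ K x -> phi x = 0 by move=> nK; apply: A0 => /AK.
have dphi0 i x : ~ K x -> partial i phi x = 0.
  move=> nK; apply: (partial0_notin (A := A)) => //; last by move/AK.
  by apply: compact_closed => //; exact: norm_hausdorff.
have Ldphi : L2v K (grad phi).
  move=> i; apply: continuous_L2 => //.
  rewrite (_ : (fun x => _) = partial i phi); last by apply/funext => x; rewrite mxE.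
  exact: test_function_partial_continuous tphi.
rewrite /inner; under eq_Rintegral do rewrite mulrBl.
rewrite RintegralB//; try exact: L2_intbleM.
apply/eqP; rewrite subr_eq0; apply/eqP.
rewrite -(Rintegral_support KD); last by move=> x /phi0 ->; rewrite mulr0.
rewrite -[LHS]opprK -[X in - X](sg _ (test_functionS KD tphi)).
rewrite [innerv _ _ _](Rintegral_support KD); last first.
  by move=> x nK; rewrite /dotv big1// => i _; rewrite mxE dphi0 ?mulr0.
rewrite [X in - X](innerv_ae mK sK Ldphi _ sq); last first.
  by move=> i; apply: measurable_funTS; exact: continuous_rV_measurable (elementary_continuous (eq i)).
have iphi i : mu.-integrable K (EFin \o (fun x => partial i phi x * q x ord0 i)).
  apply: L2_intbleM => //; last exact: elementary_L2.
  by apply: continuous_L2 => //; exact: test_function_partial_continuous tphi.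
have iq i : mu.-integrable K (EFin \o (fun x => phi x * partial i (fun y => q y ord0 i) x)).
  by apply: L2_intbleM => //; apply: elementary_L2 => //; exact: elementary_partial.
transitivity (- \sum_i \int[mu]_(x in K) (partial i phi x * q x ord0 i)).
  rewrite -Rintegral_sum//; congr (- _); apply: eq_Rintegral => x _.
  by apply: eq_bigr => i _; rewrite mxE mulrC.
rewrite -sumrN; transitivity (\sum_i \int[mu]_(x in K) (phi x * partial i (fun y => q y ord0 i) x)).
  apply: eq_bigr => i _; rewrite -(test_function_ibp tphi)//.
    exact: elementary_differentiable.
  by apply: elementary_continuous; exact: elementary_partial.
rewrite -Rintegral_sum//; apply: eq_Rintegral => x _.
by rewrite mulr_suml; apply: eq_bigr => i _; rewrite mulrC.
Qed.

(** The scalar test space is all of L2, so the extension by zero of [h] from the element is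
    admissible. *)
Lemma weak_divergence_test D g f h : measurable D -> K `<=` D ->
  L2 D g -> L2 D f -> (forall v, L2 D v -> inner D g v = inner D f v) ->
  elementary h -> inner K g h = inner K f h.
Proof.
move=> mD KD Lg Lf gf eh; have mK := measurable_elem S; have bK := bounded_elem S.
have [mh Ih] := elementary_L2 mK bK eh.
have Lv : L2 D (h \_ K).
  split; first by apply: measurable_funTS; apply/(measurable_restrictT _ mK).
  have : mu.-integrable setT (EFin \o (h \_ K \* h \_ K)).
    have /(intble_restrict _ mK) := L2_intbleM mK (conj mh Ih) (conj mh Ih).
    congr (_.-integrable _ _); apply/funext => x /=; congr EFin.
    by rewrite !patchE; case: ifP; rewrite ?mul0r.
  move=> /(integrableS measurableT mD (@subsetT _ D)).
  by congr (_.-integrable _ _); apply/funext => x /=; rewrite expr2.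
have E v : inner D v (h \_ K) = inner K v h.
  rewrite [LHS](Rintegral_support KD); last first.
    by move=> x nK; rewrite patchE memNset ?mulr0.
  by apply: eq_Rintegral => x Kx; rewrite patchE Kx.
by rewrite -!E gf.
Qed.

(** The divergence theorem is applied to the polynomial representative times [f]; afterwards the
    weak data [s] and [g] replace [q] and its divergence inside the integrals. *)
Lemma element_integration_by_parts D s g q f nu : measurable D -> K `<=` D ->
  Hdiv D s g -> (forall i, elementary (fun x => q x ord0 i)) -> ae_eq mu K s q ->
  (forall a, outward_unit_normal S a (nu a)) -> elementary f ->
  boundary_integral S (fun a x => dotv (q x) (nu a) * f x) =
  innerv K s (grad f) + inner K g f.
Proof.
move=> mD KD Hs eq sq nuP ef; have mK := measurable_elem S; have bK := bounded_elem S.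
have sK : L2v K s by case: Hs => Ls _ _; exact: L2vS mD mK KD Ls.
have Ldf : L2v K (grad f) by move=> i; apply: elementary_L2 => //; exact: elementary_grad.
have eqf i : elementary (fun x => (f x *: q x) ord0 i).
  rewrite (_ : (fun x => _) = fun x => f x * q x ord0 i).
    exact: elementaryM.
  by apply/funext => x; rewrite mxE.
have edq : elementary (fun x => \sum_i partial i (fun y => q y ord0 i) x).
  by apply: elementary_sum => i; exact: elementary_partial.
rewrite (_ : (fun a x => _) = fun a x => dotv (f x *: q x) (nu a)); last first.
  by apply/funext => a; apply/funext => x; rewrite dotvZl mulrC.
rewrite (divergence_theorem uS eqf nuP) /inner (weak_divergence_local mD KD Hs eq sq ef).
rewrite (innerv_ae mK sK Ldf _ sq); last first.
  by move=> i; apply: measurable_funTS; exact: continuous_rV_measurable (elementary_continuous (eq i)).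
rewrite -RintegralD//; last 2 first.
- apply: elementary_intble => //; apply: elementary_dotv => // i; exact: elementary_grad.
- by apply: elementary_intble => //; exact: elementaryM.
apply: eq_Rintegral => x _; rewrite mulr_suml -big_split/=; apply: eq_bigr => i _.
rewrite (_ : (fun y => _) = fun y => f y * q y ord0 i); last by apply/funext => y; rewrite mxE.
rewrite partialM; [|exact: elementary_differentiable|exact: elementary_differentiable].
by rewrite [grad f x _ _]mxE [RHS]addrC; congr (_ + _); exact: mulrC.
Qed.

End weak_derivatives.

(** * Error estimates on one element *)

Section element_estimate.
Context {R : realType} {p : nat}.
Variable S : 'M[R]_(p.+2, p.+1).
Hypothesis uS : edges S \in unitmx.
Notation mu := (@lebesgue_rV R p.+1).
Notation K := (elem S).

Let mK := measurable_elem S.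
Let bK := bounded_elem S.

(** The boundary term is an abstract functional [b] and the weak equations are values on elementary
    functions, so that only algebra, Cauchy-Schwarz and Poincare remain. Norms are unweighted here;
    the powers of the coefficient are restored afterwards. *)
Lemma postprocessing_estimate (ak : R) (t s sh : 'rV[R]_p.+1 -> 'rV[R]_p.+1)
    (f g gh w us : 'rV[R]_p.+1 -> R) k (b : ('rV[R]_p.+1 -> R) -> R) :
  0 < ak -> L2v K t -> L2v K s -> L2v K sh -> L2 K g -> L2 K gh ->
  Pk k w -> Pk k us ->
  (forall v, elementary v -> ak * innerv K t (grad v) = - innerv K s (grad v)) ->
  (forall v, elementary v -> inner K g v = inner K f v) ->
  (forall v, elementary v -> b v = innerv K sh (grad v) + inner K gh v) ->
  (forall v, Pk k v -> \int[mu]_(x in K) v x = 0 ->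
     ak * innerv K (grad us) (grad v) = inner K f v - b v) ->
  ak * norm0v K (fun x => grad w x - grad us x) <=
  ak * norm0v K (fun x => t x - grad w x) + norm0v K (fun x => s x - sh x) +
  Num.sqrt (2 ^+ p.+1) * (diam (hull S) * norm0 K (fun x => g x - gh x)).
Proof.
move=> ak0 Lt Ls Lsh Lg Lgh Pw Pus tE gE bE usE.
have ew := Pk_elementary Pw; have eus := Pk_elementary Pus.
have Lgrad v : elementary v -> L2v K (grad v).
  by move=> ev i; apply: elementary_L2 => //; exact: elementary_grad.
have [c [c0 hc]] := poincare uS (elementaryB ew eus).
set v := fun x => w x - us x - c in c0 *.
have Pv : Pk k v by apply: PkB; [exact: PkB|exact: Pk_cst].
have ev := Pk_elementary Pv.
have gv0 : grad (fun x => w x - us x) = grad v.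
  apply/funext => x; apply/rowP => i; rewrite !mxE.
  rewrite [RHS](partialD (f := fun x => w x - us x) (g := fun=> - c)).
  - by rewrite partial_cst addr0.
  - by apply: elementary_differentiable; exact: elementaryB.
  - by apply: elementary_differentiable; exact: elementary_cst.
have gv : (fun x => grad w x - grad us x) = grad v.
  rewrite -gv0; apply/funext => x; apply/rowP => i; rewrite !mxE.
  have := partialD (f := w) (g := fun x => - us x) i (elementary_differentiable ew x)
    (elementary_differentiable (elementaryN eus) x).
  move=> ->; congr (_ + _); have := partialD i (elementary_differentiable eus x)
    (elementary_differentiable (elementaryN eus) x).
  rewrite (_ : (fun y => us y + - us y) = fun=> 0); last by apply/funext => y; rewrite subrr.
  by rewrite partial_cst => /esym/eqP; rewrite addrC addr_eq0 => /eqP ->.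
rewrite gv0 in hc; rewrite gv.
have Lv := elementary_L2 mK bK ev; have Lgv := Lgrad _ ev.
set X := norm0v K (grad v); set A := norm0v K (fun x => t x - _).
set B1 := norm0v K (fun x => s x - _); set B2 := norm0 K _; set h := diam _.
have X0 : 0 <= X by exact: sqrtr_ge0.
have A0 : 0 <= A by exact: sqrtr_ge0.
have B10 : 0 <= B1 by exact: sqrtr_ge0.
have B20 : 0 <= B2 by exact: sqrtr_ge0.
have h0 : 0 <= h by exact: diam_ge0.
set H := Num.sqrt (2 ^+ p.+1) * h.
have H0 : 0 <= H by rewrite mulr_ge0// sqrtr_ge0.
have vX : norm0 K v <= H * X.
  rewrite /norm0 /X /norm0v -(ger0_norm H0) -sqrtr_sqr -sqrtrM ?sqr_ge0// ler_wsqrtr//.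
  rewrite (_ : inner K v v = \int[mu]_(x in K) (w x - us x - c) ^+ 2); last first.
    by apply: eq_Rintegral => x _; rewrite expr2.
  by rewrite (le_trans hc)// /H exprMn sqr_sqrtr ?exprn_ge0// [h ^+ 2 * _]mulrC.
have key : ak * X ^+ 2 = ak * innerv K (fun x => grad w x - t x) (grad v) +
    innerv K (fun x => sh x - s x) (grad v) + inner K (fun x => gh x - g x) v.
  rewrite sqr_norm0v -{1}gv !innervBl//; try exact: Lgrad.
  have -> : inner K (fun x => gh x - g x) v = inner K gh v - inner K g v.
    rewrite /inner -RintegralB//; try exact: L2_intbleM.
    by apply: eq_Rintegral => x _; rewrite mulrBl.
  have := usE _ Pv c0; rewrite (bE _ ev) (gE _ ev); have := tE _ ev.
  move: (innerv K t _) (innerv K s _) (innerv K sh _) (innerv K (grad w) _)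
    (innerv K (grad us) _) (inner K gh v) (inner K f v) => x1 x2 x3 x4 x5 x6 x7 h1 h2.
  by rewrite !mulrBr h1 h2; ring.
(* Cauchy-Schwarz extracts a factor [X] from the first two pairings directly, and from the
   divergence pairing through [vX]. *)
have {key}key : ak * X ^+ 2 <= (ak * A + B1 + H * B2) * X.
  rewrite key !mulrDl; apply: lerD; first apply: lerD.
  - rewrite -mulrA ler_pM2l// /A norm0v_sub; apply: innerv_le => //.
    by apply: L2vB => //; exact: Lgrad.
  - by rewrite /B1 norm0v_sub; apply: innerv_le => //; exact: L2vB.
  - apply: le_trans (inner_le mK (L2B mK Lgh Lg) Lv) _.
    by rewrite norm0_sub -/B2 mulrC mulrAC ler_wpM2r.
rewrite mulrA -/H; have [->|nX] := eqVneq X 0.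
  by rewrite mulr0 !addr_ge0 ?mulr_ge0 ?(ltW ak0).
have Xp : 0 < X by rewrite lt_neqAle eq_sym nX.
by rewrite -(ler_pM2r Xp) -mulrA -expr2.
Qed.
End element_estimate.

(** Here [a] is the error of [w], [x] the distance from [w] to the post-processed potential, [b] and
    [d] the flux and divergence contributions, and [m] the local norm. Since a + x <= 2 a + (1 + c)
    m, the constant 2 + c suffices. *)
Lemma error_bound_combine (R : realType) (a x b d c m : R) : 0 <= a -> 0 <= c -> 0 <= m ->
  x <= a + b + d -> b <= m -> d <= c * m -> a + x <= (2 + c) * (a + m).
Proof.
move=> a0 c0 m0 xE bm dm; have ca0 : 0 <= c * a by rewrite mulr_ge0.
have : a + x <= 2 * a + c * a + (2 * m + c * m) by lra.
by rewrite mulrDl !mulrDr => /le_trans; apply; lra.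
Qed.

(** A weak gradient of [u] is read off the first mixed equation as the flux multiplied by
    [- alpha^-1]. For an arbitrary weak gradient, its pairings with gradients of elementary
    functions on an element are then determined. *)
Lemma postprocessing_error (R : realType) (p k : nat) (pair : mixed_pair)
    (Omega : set 'rV[R]_p.+1) (n : nat) (Om : 'I_n -> set 'rV[R]_p.+1)
    (a : 'I_n -> R) (f : 'rV[R]_p.+1 -> R) (T : seq 'M[R]_(p.+2, p.+1))
    (sigma sigmah : 'rV[R]_p.+1 -> 'rV[R]_p.+1)
    (divsigma divsigmah u uh : 'rV[R]_p.+1 -> R) :
  let alpha := piecewise_coef Om a in
  polygonal_domain Omega -> polygonal_partition Omega Om ->
  L2 Omega f -> triangulation Omega T ->
  mixed_solution Omega alpha f (Hdiv Omega) (L2 Omega) sigma divsigma u ->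
  mixed_solution Omega alpha f (flux_space pair Omega T k)
    (potential_space pair Omega T k) sigmah divsigmah uh ->
  (exists gradu, H1 Omega u gradu) /\
  forall gradu, H1 Omega u gradu ->
  forall (S : 'M[R]_(p.+2, p.+1)) (alphaK : R) (ustar : 'rV[R]_p.+1 -> R),
  S \in T -> ae_eq (lebesgue_rV p.+1) (elem S) alpha (cst alphaK) ->
  stenberg_postprocessed alpha f k S sigmah uh ustar ->
  norm0v (elem S) (fun x => Num.sqrt alphaK *: (gradu x - grad ustar x)) <=
  (2 + Num.sqrt (2 ^+ p.+1)) *
    (inf [set norm0v (elem S)
            (fun x => Num.sqrt alphaK *: (gradu x - grad w x)) | w in Pk k.+1]
     + local_Hdiv_norm alpha S (fun x => sigma x - sigmah x)
         (fun x => divsigma x - divsigmah x)).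
Proof.
move=> alpha [_ oO _ bO _] [POm dOm _] Lf [aiT _ eT _ _].
move=> [[Ls Lg sg] Lu mix1 mix2] [Hh _ _ _].
(* Either flux space lies in H(div); the polynomial trace is the field [q] provided by
   [stenberg_postprocessed]. *)
have {}Hh : Hdiv Omega sigmah divsigmah by case: pair Hh => -[].
have mO := open_rV_measurable oO.
have mOm i : measurable (Om i).
  by apply: open_rV_measurable; have [[]] := POm i.
have malpha (g : R -> R) : g 0 = 0 -> measurable_fun setT (fun x => g (alpha x)).
  move=> g0; rewrite (_ : (fun x => _) = piecewise_coef Om (g \o a)).
    exact: measurable_piecewise_coef.
  by apply/funext => x; exact: piecewise_coef_comp.
have balpha (g : R -> R) : g 0 = 0 -> forall x, `|g (alpha x)| <= \sum_i `|g (a i)|.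
  by move=> g0 x; rewrite /alpha piecewise_coef_comp//; exact: piecewise_coef_le.
pose s x := (alpha x)^-1 *: sigma x.
have Lsa : L2v Omega s.
  apply: (L2vM_bounded mO _ (balpha (fun t => t^-1) (invr0 R)) Ls).
  by apply: measurable_funTS; exact: (malpha (fun t => t^-1) (invr0 R)).
have us phi i : test_function Omega phi ->
    inner Omega u (partial i phi) = inner Omega (fun x => s x ord0 i) phi.
  move=> tphi; have := mix1 _ _ (test_function_Hdiv i mO bO tphi).
  move/eqP; rewrite subr_eq0 => /eqP h.
  transitivity (inner Omega (partial i phi) u).
    by apply: eq_Rintegral => x _; exact: mulrC.
  rewrite -h; apply: eq_Rintegral => x _.
  by rewrite dotvZr dotv_delta mulrC.
split.
  exists (fun x => - s x); split=> //; first exact: L2vN.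
  move=> phi tphi i; rewrite us//.
  have Lphi : L2 Omega phi.
    by apply: continuous_L2 => //; exact: test_function_continuous tphi.
  rewrite -[RHS]mulN1r /inner -RintegralZl//; last first.
    by apply: L2_intbleM => //; exact: (L2vN mO Lsa i).
  by apply: eq_Rintegral => x _; rewrite !mxE; ring.
move=> gradu Hu S aK us_ ST alphaE [Pus [q [nu [[m Pq] shq nuP usE]]] _].
have uS := affinely_independent_edges (aiT _ ST); have KO := eT _ ST.
have mK := measurable_elem S; have bK := bounded_elem S.
have eus := Pk_elementary Pus.
have Lgrad v : elementary v -> L2v (elem S) (grad v).
  by move=> ev i; apply: elementary_L2 => //; exact: elementary_grad.
have Lt : L2v (elem S) gradu by case: Hu => _ + _; exact: L2vS.
have LsK : L2v (elem S) sigma by exact: L2vS Ls.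
have LgK : L2 (elem S) divsigma by exact: L2S Lg.
have [LshK LghK] : L2v (elem S) sigmah /\ L2 (elem S) divsigmah.
  by case: Hh => h1 h2 _; split; [exact: L2vS h1|exact: L2S h2].
set N := local_Hdiv_norm _ _ _ _; set I := inf _.
have N0 : 0 <= N by exact: sqrtr_ge0.
set c := Num.sqrt (2 ^+ p.+1); have c0 : 0 <= c by exact: sqrtr_ge0.
have C0 : 0 < 2 + c by rewrite ltr_wpDr.
(* The set of errors is nonempty because [us_] itself is a candidate, so its infimum lies above
   every lower bound. *)
have infP r : (forall w, Pk k.+1 w -> r <= norm0v (elem S)
    (fun x => Num.sqrt aK *: (gradu x - grad w x))) -> r <= I.
  move=> h; apply: lb_le_inf; first by exists (norm0v (elem S)
    (fun x => Num.sqrt aK *: (gradu x - grad us_ x))), us_.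
  by move=> _ [w Pw <-]; exact: h.
have LE w : elementary w -> norm0v (elem S)
    (fun x => Num.sqrt aK *: (gradu x - grad w x)) =
    Num.sqrt aK * norm0v (elem S) (fun x => gradu x - grad w x).
  move=> ew; apply: norm0v_Z (sqrtr_ge0 _) => //.
  by apply: L2vB => //; exact: Lgrad.
have [aK0|aK0] := leP aK 0.
  rewrite LE// (ler0_sqrtr aK0) mul0r mulr_ge0 ?(ltW C0)// addr_ge0//.
  by apply: infP => w _; exact: sqrtr_ge0.
(* Solving the claim for the infimum reduces it to one inequality for each candidate [w]. *)
rewrite -ler_pdivrMl// -lerBlDr; apply: infP => w Pw.
have ew := Pk_elementary Pw; rewrite lerBlDr ler_pdivrMl// !LE//.
set r := Num.sqrt aK; have r0 : 0 < r by rewrite sqrtr_gt0.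
have rr : aK = r ^+ 2 by rewrite sqr_sqrtr// ltW.
have isqrt0 : (Num.sqrt 0 : R)^-1 = 0 by rewrite sqrtr0 invr0.
(* The pairing is split into components to apply [weak_gradient_local] in each direction; [aK * s]
   equals [sigma] almost everywhere on the element. *)
have sE v : elementary v ->
    aK * innerv (elem S) gradu (grad v) = - innerv (elem S) sigma (grad v).
  move=> ev; have Lv := Lgrad _ ev.
  have evi i : elementary (fun x => grad v x ord0 i) by exact: elementary_grad.
  rewrite /innerv !Rintegral_sum//; try by move=> i; exact: L2_intbleM.
  rewrite mulr_sumr -sumrN; apply: eq_bigr => i _.
  rewrite (weak_gradient_local uS (i := i) mO bO KO Hu Lsa)//; last by move=> phi; exact: us.
  rewrite mulrN; congr (- _).
  rewrite -[RHS]mul1r -(divff (lt0r_neq0 aK0)) -mulrA; congr (_ * _).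
  rewrite -RintegralZl//; last exact: L2_intbleM.
  symmetry; apply: Rintegral_ae => //.
  - by apply: intbleZ => //; exact: L2_intbleM.
  - by apply: measurable_funM; [case: (L2vS mO mK KO Lsa i)|case: (Lv i)].
  - by apply: filterS alphaE => x h Kx; rewrite [s x _ _]mxE h//=; exact: mulrA.
have est' := postprocessing_estimate uS aK0 Lt LsK LshK LgK LghK Pw Pus sE
  (fun v => weak_divergence_test mO KO Lg Lf mix2)
  (fun v => element_integration_by_parts uS mO KO Hh
     (fun i => Pk_elementary (Pq i)) shq nuP).
have est : aK * norm0v (elem S) (fun x => grad w x - grad us_ x) <=
    aK * norm0v (elem S) (fun x => gradu x - grad w x) +
    norm0v (elem S) (fun x => sigma x - sigmah x) +
    c * (diam (hull S) * norm0 (elem S) (fun x => divsigma x - divsigmah x)).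
  apply: est' => v Pv v0; have ev := Pk_elementary Pv; rewrite -(usE _ Pv v0).
  rewrite -innervZl//; [|exact: Lgrad|exact: Lgrad]; apply: innerv_ae => //.
  - by apply: L2vZ => //; exact: Lgrad.
  - exact: Lgrad.
  - move=> i; rewrite (_ : (fun x => _) = fun x => alpha x * grad us_ x ord0 i).
      apply: measurable_funM; last by case: (Lgrad _ eus i).
      by apply: measurable_funTS; exact: measurable_piecewise_coef.
    by apply/funext => x; rewrite mxE.
  - by apply: filterS alphaE => x h Kx; rewrite h.
have Ld : L2v (elem S) (fun x => sigma x - sigmah x) by exact: L2vB.
have Lgd : L2 (elem S) (fun x => divsigma x - divsigmah x) by exact: L2B.
have msa : measurable_fun (elem S) (fun x => (Num.sqrt (alpha x))^-1).
  by apply: measurable_funTS; exact: (malpha (fun t => (Num.sqrt t)^-1)).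
have ri0 : 0 <= r^-1 by rewrite invr_ge0 ltW.
set B1 := norm0v _ (fun x => sigma x - _) in est *.
set B2 := norm0 _ _ in est *; set h := diam _ in est *.
have E1 : norm0v (elem S) (fun x => (Num.sqrt (alpha x))^-1 *: (sigma x - sigmah x)) =
    r^-1 * B1.
  rewrite -(norm0v_Z mK Ld ri0); symmetry; apply: (norm0v_ae mK (L2vZ _ mK Ld)).
    move=> i; rewrite (_ : (fun x => _) =
        fun x => (Num.sqrt (alpha x))^-1 * (sigma x - sigmah x) ord0 i).
      by apply: measurable_funM => //; case: (Ld i).
    by apply/funext => x; exact: mxE.
  by apply: filterS alphaE => x hx Kx; rewrite hx.
have E2 : norm0 (elem S) (fun x => (Num.sqrt (alpha x))^-1 * (divsigma x - divsigmah x)) =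
    r^-1 * B2.
  rewrite -(norm0_Z mK Lgd ri0); symmetry; apply: (norm0_ae mK (L2Z _ mK Lgd)).
    by apply: measurable_funM => //; case: Lgd.
  by apply: filterS alphaE => x hx Kx; rewrite hx.
have NE : N = Num.sqrt ((r^-1 * B1) ^+ 2 + (h * (r^-1 * B2)) ^+ 2).
  by rewrite [(h * _) ^+ 2]exprMn -E1 -E2.
have N1 : r^-1 * B1 <= N.
  by rewrite NE (le_trans (ler_norm _))// -sqrtr_sqr ler_wsqrtr// lerDl sqr_ge0.
have N2 : h * (r^-1 * B2) <= N.
  by rewrite NE (le_trans (ler_norm _))// -sqrtr_sqr ler_wsqrtr// lerDr sqr_ge0.
have LwK := Lgrad _ ew; have LuK := Lgrad _ eus.
have tri := norm0v_triangle mK Lt LwK LuK.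
set Y := norm0v _ (fun x => gradu x - grad us_ x) in tri *.
set A := norm0v _ (fun x => gradu x - grad w x) in tri *.
set X := norm0v _ (fun x => grad w x - _) in tri *.
have A0 : 0 <= A by exact: sqrtr_ge0.
(* Dividing by [r], with [aK = r ^+ 2], puts the weight [r] on gradients and [r^-1] on fluxes, as in
   the local norm; this makes the constant independent of the coefficient. *)
have {}est : r * X <= r * A + r^-1 * B1 + c * (h * (r^-1 * B2)).
  rewrite -(ler_pM2l r0) mulrA -expr2 -rr (le_trans est)// rr.
  have E (x y z t e l : R) : x != 0 -> x ^+ 2 * y + z + e * (l * t) =
    x * (x * y + x^-1 * z + e * (l * (x^-1 * t))) by move=> x0; field.
  by rewrite E// lt0r_neq0.
apply: le_trans (_ : r * (A + X) <= _); first by rewrite ler_pM2l.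
have rA0 : 0 <= r * A by rewrite mulr_ge0// ltW.
have cN : c * (h * (r^-1 * B2)) <= c * N by rewrite ler_wpM2l.
rewrite [r * (A + X)]mulrDr.
exact: (error_bound_combine rA0 c0 N0 est N1 cN).
Qed.

Theorem theorem4p2 (R : realType) (d k : nat) (gamma : R) :
  d = 2%N \/ d = 3%N ->
  exists2 C : R, 0 < C &
  forall (pair : mixed_pair) (Omega : set 'rV[R]_d) (n : nat)
    (Om : 'I_n -> set 'rV[R]_d) (a : 'I_n -> R) (f : 'rV[R]_d -> R)
    (T : seq 'M[R]_(d.+1, d))
    (sigma sigmah : 'rV[R]_d -> 'rV[R]_d)
    (divsigma divsigmah u uh : 'rV[R]_d -> R),
  let alpha := piecewise_coef Om a in
  (pair = BDM_pair -> (1 <= k)%N) ->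
  polygonal_domain Omega -> polygonal_partition Omega Om ->
  (forall i, 0 < a i) -> L2 Omega f ->
  triangulation Omega T -> shape_regular gamma T -> interfaces_uncut Om T ->
  mixed_solution Omega alpha f (Hdiv Omega) (L2 Omega) sigma divsigma u ->
  mixed_solution Omega alpha f (flux_space pair Omega T k)
    (potential_space pair Omega T k) sigmah divsigmah uh ->
  (exists gradu, H1 Omega u gradu) /\
  forall gradu, H1 Omega u gradu ->
  forall (S : 'M[R]_(d.+1, d)) (alphaK : R) (ustar : 'rV[R]_d -> R),
  S \in T -> ae_eq (lebesgue_rV d) (elem S) alpha (cst alphaK) ->
  stenberg_postprocessed alpha f k S sigmah uh ustar ->
  norm0v (elem S) (fun x => Num.sqrt alphaK *: (gradu x - grad ustar x)) <=
  C * (inf [set norm0v (elem S)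
              (fun x => Num.sqrt alphaK *: (gradu x - grad w x)) | w in Pk k.+1]
       + local_Hdiv_norm alpha S (fun x => sigma x - sigmah x)
           (fun x => divsigma x - divsigmah x)).
Proof.
move=> hd; exists (2 + Num.sqrt (2 ^+ d)).
  by rewrite ltr_wpDr// sqrtr_ge0.
case: d hd => [|p] hd; first by case: hd.
move=> pair Omega n Om a f T sigma sigmah divsigma divsigmah u uh alpha _ pO pOm _ Lf tT _ _.
exact: postprocessing_error.
Qed.
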